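(* Let $M\subset\mathbb{M}^n(C)$ be a nontrivial concircular hypersurface with axis $V$, such that the tangential component of $V$ on $M$ does not vanish. Then $M$ can be locally described as follows: around each point of $M$ there exist a hypersurface $P^{n-2}$ of a totally umbilical hypersurface $Q^{n-1}(c)\subset\mathbb{M}^n(C)$, a real number $a$ and an interval $I_0$ around the origin such that $M$ is parametrized there by $$\Psi_a(p,z)=\exp_p(zW_a(p))=f\Big(\frac zR\Big)p+R\,g\Big(\frac zR\Big)W_a(p),\qquad (p,z)\in P^{n-2}\times I_0,$$ where $W_a(p)=\cos(a)\,\eta_1(p)+\sin(a)\,\eta_2(p)$, and $\eta_1$, $\eta_2$ are unit vector fields along $P^{n-2}$ normal to $P^{n-2}$ in $Q^{n-1}(c)$ and normal to $Q^{n-1}(c)$ in $\mathbb{M}^n(C)$, respectively.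
   Context: Let $C\neq 0$ be real, $n\ge 2$, and write $C=\varepsilon/R^2$ with $R>0$, $\varepsilon=(-1)^\nu$, $\nu\in\{0,1\}$. $\mathbb{R}^{n+1}_\nu$ is $\mathbb{R}^{n+1}$ with the flat metric $\langle\,,\rangle=\varepsilon\,dx_1^2+dx_2^2+\cdots+dx_{n+1}^2$. $\mathbb{M}^n(C)=\{p\in\mathbb{R}^{n+1}_\nu:\langle p,p\rangle=1/C\}$ (the sheet $x_1>0$ if $C<0$), with the induced metric, is the sphere or hyperbolic space of constant curvature $C$, with Levi-Civita connection $\overline\nabla$ and exponential map $\exp$. Put $f=\cos$, $g=\sin$ if $C>0$ and $f=\cosh$, $g=\sinh$ if $C<0$. A vector field $V$ on $\mathbb{M}^n(C)$ is concircular if $\overline\nabla_XV=\mu X$ for all tangent $X$, for some smooth function $\mu$ on $\mathbb{M}^n(C)$. A hypersurface $M\subset\mathbb{M}^n(C)$ with unit normal vector field $N$ is concircular with axis $V$ if $V$ is a concircular vector field on $\mathbb{M}^n(C)$ such that $\langle N,V\rangle$ is constant along $M$; it is nontrivial if it is not totally umbilical in $\mathbb{M}^n(C)$. A totally umbilical hypersurface $Q^{n-1}(c)$ (of constant curvature $c$) is (an open piece of) the intersection of $\mathbb{M}^n(C)$ with an affine hyperplane $H(p_0)$ of $\mathbb{R}^{n+1}_\nu$ orthogonal to a nonzero constant vector $p_0\in\mathbb{R}^{n+1}_\nu$. *)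

(* Defs.v *)
From mathcomp Require Import all_boot all_order all_algebra.
From mathcomp Require Import all_classical all_reals all_analysis.
Set Implicit Arguments.
Unset Strict Implicit.
Unset Printing Implicit Defensive.
Import Order.TTheory GRing.Theory Num.Theory.
Import numFieldNormedType.Exports.
Local Open Scope classical_set_scope.
Local Open Scope ring_scope.

(* C^k on an open set: all iterated directional derivatives of order at most k
   exist and are continuous.  For finite-dimensional [V] (the only case used)
   this is the usual notion. *)
Fixpoint Ck_on (K : realType) (V W : normedModType K) (k : nat) (U : set V)
    (F : V -> W) : Prop :=
  (forall x, U x -> {for x, continuous F}) /\
  (if k is j.+1 then
     (forall x v, U x -> derivable F x v) /\
     (forall v, Ck_on j U (fun x => 'D_v F x))
   else True).

Definition smooth_on (K : realType) (V W : normedModType K) (U : set V)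
    (F : V -> W) : Prop := forall k, Ck_on k U F.

(* Smoothness of a map that is only meaningful on the (not necessarily open)
   set [A]: near each point of [A] it has a smooth extension.  The values of
   [F] outside [A] play no role. *)
Definition smooth_along (K : realType) (V W : normedModType K) (A : set V)
    (F : V -> W) : Prop :=
  forall x, A x -> exists U : set V, exists G : V -> W,
    [/\ open U, U x, smooth_on U G & forall y, (A `&` U) y -> G y = F y].

Definition diffeo (K : realType) (V W : normedModType K) (A : set V)
    (B : set W) (F : V -> W) : Prop :=
  [/\ F @` A = B, smooth_along A F &
      exists G : W -> V, smooth_along B G /\ forall x, A x -> G (F x) = x].

(* Embedded k-dimensional submanifold, by slice charts. *)
Definition submanifold (K : realType) (n k : nat) (S : set 'rV[K]_n.+1) : Prop :=
  forall p, S p -> exists U W : set 'rV[K]_n.+1,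
    exists Phi : 'rV[K]_n.+1 -> 'rV[K]_n.+1,
    [/\ open U, U p, open W, diffeo U W Phi &
        forall q, U q -> (S q <-> forall i : 'I_n.+1, (k <= i)%N -> Phi q 0 i = 0)].

Definition curve_in (K : realType) (n : nat) (S : set 'rV[K]_n.+1)
    (c : K -> 'rV[K]_n.+1) : Prop :=
  exists e : K, [/\ 0 < e, smooth_on [set t : K | `|t| < e] c &
                    forall t, `|t| < e -> S (c t)].

Definition tangent (K : realType) (n : nat) (S : set 'rV[K]_n.+1)
    (p X : 'rV[K]_n.+1) : Prop :=
  exists c : K -> 'rV[K]_n.+1, [/\ curve_in S c, c 0 = p & derive1 c 0 = X].

(* The flat metric (-1)^nu dx_1^2 + dx_2^2 + ... + dx_(n+1)^2. *)
Definition mdot (K : realType) (n : nat) (nu : bool) (x y : 'rV[K]_n.+1) : K :=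
  (-1) ^+ nu * (x 0 0 * y 0 0) + \sum_(i < n.+1 | i != 0) x 0 i * y 0 i.

Definition space_form (K : realType) (n : nat) (nu : bool) (C : K) :
    set 'rV[K]_n.+1 :=
  [set p | mdot nu p p = C^-1 /\ (C < 0 -> 0 < p 0 0)].
Arguments space_form {K} n nu C _.

(* Orthogonal projection onto the tangent space of M^n(C) at p; the normal line
   there is spanned by p, and <p,p> = 1/C. *)
Definition tproj (K : realType) (n : nat) (nu : bool) (C : K)
    (p w : 'rV[K]_n.+1) : 'rV[K]_n.+1 :=
  w - (C * mdot nu w p) *: p.

(* Levi-Civita covariant derivative, at time t, of the field Y along the curve c
   of M^n(C): the tangential part of the derivative in the flat space. *)
Definition covder (K : realType) (n : nat) (nu : bool) (C : K)
    (c Y : K -> 'rV[K]_n.+1) (t : K) : 'rV[K]_n.+1 :=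
  tproj nu C (c t) (derive1 Y t).

(* [is_exp nu C p X q] says that exp_p(X) = q. *)
Definition is_exp (K : realType) (n : nat) (nu : bool) (C : K)
    (p X q : 'rV[K]_n.+1) : Prop :=
  exists c : K -> 'rV[K]_n.+1,
    [/\ smooth_on setT c,
        forall t, space_form n nu C (c t),
        forall t, covder nu C c (derive1 c) t = 0,
        c 0 = p /\ derive1 c 0 = X & c 1 = q].

Definition vector_field (K : realType) (n : nat) (nu : bool) (C : K)
    (V : 'rV[K]_n.+1 -> 'rV[K]_n.+1) : Prop :=
  smooth_along (space_form n nu C) V /\
  forall p, space_form n nu C p -> tangent (space_form n nu C) p (V p).

(* The tangent vectors X at p are the velocities c'(0) of the curves c through
   p, and then the covariant derivative of V in the direction X is that of
   V o c at 0. *)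
Definition concircular (K : realType) (n : nat) (nu : bool) (C : K)
    (V : 'rV[K]_n.+1 -> 'rV[K]_n.+1) : Prop :=
  vector_field nu C V /\
  exists mu : 'rV[K]_n.+1 -> K,
    smooth_along (space_form n nu C) mu /\
    forall c, curve_in (space_form n nu C) c ->
      covder nu C c (V \o c) 0 = mu (c 0) *: derive1 c 0.

Definition hypersurface (K : realType) (n : nat) (nu : bool) (C : K)
    (M : set 'rV[K]_n.+1) : Prop :=
  M `<=` space_form n nu C /\ submanifold n.-1 M.

(* [eta] is a smooth field of unit vectors along [A], tangent to [B] and normal
   to [S]. *)
Definition unit_normal_along (K : realType) (n : nat) (nu : bool)
    (A S B : set 'rV[K]_n.+1) (eta : 'rV[K]_n.+1 -> 'rV[K]_n.+1) : Prop :=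
  smooth_along A eta /\
  forall p, A p ->
    [/\ tangent B p (eta p), mdot nu (eta p) (eta p) = 1 &
        forall X, tangent S p X -> mdot nu (eta p) X = 0].

(* At each point the shape operator X |-> - (covariant derivative of N along X)
   is a multiple of the identity. *)
Definition totally_umbilical (K : realType) (n : nat) (nu : bool) (C : K)
    (M : set 'rV[K]_n.+1) (N : 'rV[K]_n.+1 -> 'rV[K]_n.+1) : Prop :=
  forall p, M p -> exists kappa : K,
    forall c, curve_in M c -> c 0 = p ->
      - covder nu C c (N \o c) 0 = kappa *: derive1 c 0.

Definition concircular_hypersurface (K : realType) (n : nat) (nu : bool) (C : K)
    (M : set 'rV[K]_n.+1) (N V : 'rV[K]_n.+1 -> 'rV[K]_n.+1) : Prop :=
  [/\ hypersurface nu C M,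
      unit_normal_along nu M M (space_form n nu C) N,
      concircular nu C V &
      exists lambda : K, forall p, M p -> mdot nu (N p) (V p) = lambda].

(* Hypersurface which is an open piece of the section of M^n(C) by an affine
   hyperplane; requiring the dimension to be n - 1 discards the degenerate
   sections (empty sections are harmless). *)
Definition umbilical_section (K : realType) (n : nat) (nu : bool) (C : K)
    (Q : set 'rV[K]_n.+1) : Prop :=
  hypersurface nu C Q /\
  exists (p0 : 'rV[K]_n.+1) (t : K) (U : set 'rV[K]_n.+1),
    [/\ p0 != 0, open U &
        Q = space_form n nu C `&` [set x | mdot nu x p0 = t] `&` U].

Definition cosh (K : realType) (x : K) : K := (expR x + expR (- x)) / 2.
Definition sinh (K : realType) (x : K) : K := (expR x - expR (- x)) / 2.

Definition fC (K : realType) (C : K) : K -> K := if 0 < C then @cos K else @cosh K.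
Definition gC (K : realType) (C : K) : K -> K := if 0 < C then @sin K else @sinh K.

Definition Wa (K : realType) (n : nat) (a : K)
    (eta1 eta2 : 'rV[K]_n.+1 -> 'rV[K]_n.+1) (p : 'rV[K]_n.+1) : 'rV[K]_n.+1 :=
  cos a *: eta1 p + sin a *: eta2 p.

Definition Psi (K : realType) (n : nat) (C r a : K)
    (eta1 eta2 : 'rV[K]_n.+1 -> 'rV[K]_n.+1) (pz : 'rV[K]_n.+1 * K) :
    'rV[K]_n.+1 :=
  fC C (pz.2 / r) *: pz.1 + (r * gC C (pz.2 / r)) *: Wa a eta1 eta2 pz.1.

(* Main.v *)
(** The axis is V(q) = p0 - C <q,p0> q for a constant vector p0.  On M, where
    <N,V> = lam, the unit field W in the direction of V - lam N has
    grad h = S W with h(q) = <q,p0> and S^2 = <p0,p0> - lam^2 - C h^2.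
    Differentiating <N,p0> = lam, the shape operator kills W, so W is
    geodesic in the ambient space: D_W W = - C q in the flat connection.
    Hence M is ruled by the geodesics issued from a level set P of h with
    velocity W, along which h depends on the parameter only.  P lies in the
    section Q of the space form by the hyperplane h = h0, and since
    V = lam N + S W, the field W is the combination of the unit normals of P in
    Q and of Q in the space form with a = acos (lam / sqrt (S^2 + lam^2)),
    constant on P.
    Since M need not be complete, that the geodesics stay in M is obtained from
    Gronwall's inequality applied to the defining functions of M. *)
From HB Require Import structures.
Require Import Defs.
From mathcomp Require Import all_boot all_order all_algebra.
From mathcomp Require Import all_classical all_reals all_analysis.
From mathcomp Require Import perm ring lra.
Set Implicit Arguments.
Unset Strict Implicit.
Unset Printing Implicit Defensive.
Import Order.TTheory GRing.Theory Num.Theory.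
Import numFieldNormedType.Exports.
Local Open Scope classical_set_scope.
Local Open Scope ring_scope.

(** * Derivatives in finite dimension *)

Section Derivatives.
Context {K : realType}.
Implicit Types V W Z : normedModType K.

(** The unit normal is given on M only, so near each point it is replaced by a smooth ambient
    extension [Nh]. The field W built from it can be differentiated in every direction, but D_W W =
    - C q is available only at points of M. No flow of W is integrated: the candidate ruling f(z/R)
    q + R g(z/R) W(q) is written down explicitly, and what has to be proved is that it stays in M
    with velocity W. Both failures vanish at z = 0 and, by Hadamard's lemma, obey a linear
    differential inequality; this is where Gronwall enters. The parametrization also needs a smooth
    inverse. Along a ruling the height is a function k(z) with k'(0) = S > 0, so z is recovered from
    the height by a one-variable inverse function, and the foot in P by following the ruling for the
    time - z. The constant vector p0 exists because V q - V p lies in the span of p and q when q is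
    near p; comparing q with two fixed points determines V q up to a multiple of q, which tangency
    fixes. *)

Lemma is_deriveZdir V W (F : V -> W) (x v : V) (c : K) (df : W) :
  is_derive x v F df -> is_derive x (c *: v) F (c *: df).
Proof.
move=> [dF <-]; have [->|c0] := eqVneq c 0.
  by rewrite !scale0r; exact: is_derive0.
have cv : (fun h : K => h^-1 *: ((F \o shift x) (h *: (c *: v)) - F x)) @ 0^'
    --> c *: 'D_v F x.
  have : (fun h : K => c *: ((h * c)^-1 *: ((F \o shift x) ((h * c) *: v) - F x)))
      @ 0^' --> c *: 'D_v F x.
    apply: cvgZ; first exact: cvg_cst.
    have := @cvg_comp _ _ _ (fun h : K => h * c)
      (fun h : K => h^-1 *: ((F \o shift x) (h *: v) - F x)) (0^') (0^') (nbhs ('D_v F x)).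
    apply; last exact: dF.
    move=> A /= [e e0 Ae]; near=> h => /=; apply: Ae.
      rewrite /ball /= sub0r normrN normrM -ltr_pdivlMr ?normr_gt0//.
      by near: h; apply: dnbhs0_lt; rewrite divr_gt0 ?normr_gt0.
    by rewrite mulf_neq0//; near: h; exact: nbhs_dnbhs_neq.
  apply: cvg_trans; apply: near_eq_cvg; near=> h => /=.
  have h0 : h != 0 by near: h; exact: nbhs_dnbhs_neq.
  by rewrite !scalerA invfM mulrCA divff// mulr1.
by split; [apply/cvg_ex; exists (c *: 'D_v F x)|exact: cvg_lim].
Unshelve. all: by end_near. Qed.

Lemma is_derive_lin V W Z (l : {linear W -> Z}) (F : V -> W) (x v : V) (df : W) :
  continuous l -> is_derive x v F df -> is_derive x v (fun y => l (F y)) (l df).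
Proof.
move=> lc [dF <-].
have cv : (fun h : K => h^-1 *: (((fun y => l (F y)) \o shift x) (h *: v) - l (F x))) @ 0^'
    --> l ('D_v F x).
  have -> : (fun h : K => h^-1 *: (((fun y => l (F y)) \o shift x) (h *: v) - l (F x)))
      = l \o (fun h : K => h^-1 *: ((F \o shift x) (h *: v) - F x)).
    by apply/funext => h /=; rewrite linearZ/= (linearB l).
  exact: (cvg_comp _ _ dF (lc _)).
by split; [apply/cvg_ex; exists (l ('D_v F x))|exact: cvg_lim].
Qed.

Lemma derive_line V W (F : V -> W) (x v : V) :
  'D_v F x = 'D_1 (fun h : K => F (h *: v + x)) (0 : K).
Proof.
rewrite /derive; set g1 := fun h : K => h^-1 *: _.
set g2 := fun h : K => h^-1 *: (((fun _ => _) \o _) _ - _).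
suff -> : g1 = g2 by [].
by rewrite funeqE /g1 /g2 => h /=; rewrite addr0 scale0r add0r [h%:A]mulr1.
Qed.

Lemma is_derive_line V W (F : V -> W) (x v : V) (df : W) :
  is_derive x v F df <-> is_derive (0 : K) 1 (fun h : K => F (h *: v + x)) df.
Proof.
split=> -[dF <-]; split; rewrite -?derive_line//.
  exact: (derivable1P F x v).1.
exact: (derivable1P F x v).2.
Qed.

Lemma is_derive_diff V W Z (F : V -> W) (G : W -> Z) (x v : V) (df : W) :
  is_derive x v F df -> differentiable G (F x) ->
  is_derive x v (fun y => G (F y)) ('d G (F x) df).
Proof.
move=> [dF <-] dG.
have dF1 : differentiable (fun h : K => F (h *: v + x)) 0.
  exact/derivable1_diffP/(derivable1P F x v).1.
have eF : F x = F ((0 : K) *: v + x) by rewrite scale0r add0r.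
have dGF : differentiable (G \o (fun h : K => F (h *: v + x))) 0.
  by apply: differentiable_comp => //; rewrite -eF.
apply/is_derive_line; split; first exact/derivable1_diffP.
rewrite deriveE// diff_comp//; last by rewrite -eF.
by rewrite -eF [in RHS]derive_line [in RHS]deriveE.
Qed.

Lemma MVT_dir V (F : V -> K) (x v : V) :
  (forall t : K, 0 <= t <= 1 -> derivable F (x + t *: v) v) ->
  exists2 t : K, 0 <= t <= 1 & F (x + v) - F x = 'D_v F (x + t *: v).
Proof.
move=> dF; pose f t := F (x + t *: v).
have df (t : K) : 0 <= t <= 1 -> is_derive t 1 f ('D_v F (x + t *: v)).
  move=> /dF /derivableP /is_derive_line d; apply/is_derive_line.
  move: d; rewrite (_ : (fun h : K => F (h *: v + (x + t *: v))) = (fun h : K => f (h *: 1 + t)))//.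
  apply/funext => h.
  by rewrite /f [h%:A]mulr1 scalerDl addrCA.
have fc : {within `[0, 1], continuous f}.
  apply: derivable_within_continuous => t; rewrite in_itv/= => t01.
  by have [] := df t t01.
have itv_oo01 (t : K) : t \in `]0, 1[ -> 0 <= t <= 1.
  by rewrite in_itv/= => /andP[t0 t1]; rewrite !ltW.
have [t t01] := @MVT_segment K f (fun t => 'D_v F (x + t *: v)) 0 1 ler01
  (fun t ht => df t (itv_oo01 t ht)) fc.
rewrite subr0 mulr1 /f scale1r scale0r addr0 => e; exists t => //.
Qed.

End Derivatives.

(** * Differentiability from continuous directional derivatives *)

Section FiniteDimension.
Context {K : realType}.
Implicit Types V W Z : normedModType K.

(* Scalars, row vectors and their products are the instances that occur. *)
Definition has_basis (V : normedModType K) := exists (m : nat) (b : 'I_m -> V)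
  (l : 'I_m -> {linear V -> K}),
  (forall i, continuous (l i)) /\ forall v, v = \sum_i l i v *: b i.

Lemma has_basisK : has_basis K.
Proof.
exists 1, (fun=> 1), (fun=> idfun); split=> [i x|v]; first exact: cvg_id.
by rewrite big_ord1 /= [_%:A]mulr1.
Qed.

Definition coord_rV (m : nat) (i : 'I_m) (v : 'rV[K]_m) : K := v 0 i.
Fact coord_rV_is_linear m i : linear (@coord_rV m i).
Proof. by move=> c u v; rewrite /coord_rV !mxE. Qed.
HB.instance Definition _ m i := GRing.isLinear.Build _ _ _ _ _ (@coord_rV_is_linear m i).

Lemma has_basis_rV m : has_basis 'rV[K]_m.
Proof.
exists m, (fun i => delta_mx 0 i), (fun i => coord_rV i); split=> [i|v].
  exact: coord_continuous.
exact: row_sum_delta.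
Qed.

Lemma diff_from_linear V W (F : V -> W) (x : V) (L : {linear V -> W}) :
  continuous L ->
  (forall e : K, 0 < e -> \forall w \near (0 : V), `|F (x + w) - F x - L w| <= e * `|w|) ->
  differentiable F x /\ 'd F x = L :> (V -> W).
Proof.
move=> Lc h.
have o : F \o shift x = cst (F x) + L +o_ (0 : V) id.
  apply/eqaddoP => e e0; move: (h e e0); apply: filterS => w /=.
  by rewrite !fctE /= opprD addrA [w + x]addrC.
have d := diff_unique Lc o; split => //.
by apply/diff_locallyP; rewrite d.
Qed.

(** Smoothness is stated through derivatives along constant vectors. This is its content at order 1
    near a point, from which Frechet differentiability, and with it linearity in the direction, is
    recovered. *)
Definition C1_at V W (F : V -> W) (x : V) :=
  forall v, (\forall y \near x, derivable F y v) /\ {for x, continuous (fun y => 'D_v F y)}.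

Lemma continuous_sumr (T : topologicalType) W m (F : 'I_m -> T -> W) (x : T) :
  (forall i, {for x, continuous (F i)}) -> {for x, continuous (fun y => \sum_i F i y)}.
Proof.
move=> h; apply: cvg_big => [|i _]; [exact: add_continuous|exact: h].
Qed.

(* The increment along [w] is split into increments along the coordinate
   directions, each of which is controlled by the mean value theorem. *)
Lemma C1_differentiableK V (F : V -> K) (x : V) : has_basis V -> C1_at F x ->
  differentiable F x.
Proof.
move=> [m [b [l [lc lE]]]] C1.
pose L (w : V) : K := \sum_i l i w * 'D_(b i) F x.
have Llin : linear L.
  move=> c u v; rewrite /L scaler_sumr -big_split/=; apply: eq_bigr => i _.
  by rewrite linearP/= mulrDl scalerAl.
pose LL : {linear V -> K} := HB.pack L (GRing.isLinear.Build _ _ _ _ _ Llin).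
have Lc : continuous LL.
  move=> w; apply: continuous_sumr => i; apply: cvgMr_tmp; exact: lc.
have [] // := @diff_from_linear V K F x LL Lc.
move=> e e0.
have [k k0 kP] : exists2 k : K, 0 < k & forall i w, `|l i w| <= k * `|w|.
  have /choice[k kP] : forall i, exists k : K, 0 < k /\ forall w, `|l i w| <= k * `|w|.
    by move=> i; have [k k0 h] := linear_lipschitz (lc i); exists k.
  exists (1 + \sum_i k i).
    by rewrite ltr_pwDl// sumr_ge0// => i _; have [/ltW] := kP i.
  move=> i w; have [ki0 /(_ w)/le_trans] := kP i; apply.
  rewrite ler_wpM2r// (bigD1 i)//= addrCA lerDl addr_ge0// sumr_ge0// => j _.
  by have [/ltW] := kP j.
(* Each of the [m] coordinate steps may cost at most [e / m.+1%:R] times the norm of the increment;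
   the successor avoids a division by zero when [m = 0], and [k] bounds the coordinate
   functionals. *)
pose e' := e / m.+1%:R / k.
have e'0 : 0 < e' by rewrite !divr_gt0.
have near1 : \forall y \near x, forall i, derivable F y (b i) /\
    `|'D_(b i) F x - 'D_(b i) F y| < e'.
  apply: filter_forall => i; have [h1 h2] := C1 (b i).
  near=> y; split; first by near: y.
  near: y; move/cvgrPdist_lt : h2; exact.
have [d /= d0 dP] := (nbhs_ballP _ _).1 near1.
(* The vertices of a polygonal path from 0 to [w]: the j-th one has moved along the coordinates of
   index below [j]. *)
pose s (w : V) (j : nat) : V := \sum_(i < m | (i < j)%N) l i w *: b i.
(* A bound on all the points of that path at once: vertices have coefficients 0 or 1, intermediate
   points a single coefficient [t] in between. *)
have [B B0 BP] : exists2 B : K, 0 < B & forall w (A : pred 'I_m) (c : 'I_m -> K),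
    (forall i, 0 <= c i <= 1) -> `|\sum_(i < m | A i) c i *: (l i w *: b i)| <= B * `|w|.
  exists (1 + k * \sum_i `|b i|).
    by rewrite ltr_pwDl// mulr_ge0 ?(ltW k0)// sumr_ge0.
  move=> w A c c01; apply: (le_trans (ler_norm_sum _ _ _)).
  rewrite mulrDl mul1r mulr_sumr mulr_suml big_mkcond/=.
  apply: ler_wpDl => //; apply: ler_sum => i _.
  case: ifP => _; last by rewrite !mulr_ge0// ltW.
  have /andP[c0 c1] := c01 i.
  rewrite !normrZ (ger0_norm c0); apply: (@le_trans _ _ (`|l i w| * `|b i|)).
    by rewrite ler_piMl// mulr_ge0.
  by rewrite mulrAC ler_wpM2r// kP.
near=> w.
have small : B * `|w| < d.
  rewrite -ltr_pdivlMl//.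
  near: w; apply/nbhs_normP; exists (B^-1 * d); first by rewrite /= mulr_gt0 ?invr_gt0.
  by move=> w /=; rewrite sub0r normrN.
have step (j : 'I_m) : `|F (x + s w j.+1) - F (x + s w j) - l j w * 'D_(b j) F x|
    <= `|l j w| * e'.
  have sS : s w j.+1 = s w j + l j w *: b j.
    rewrite /s (bigD1 j)//= addrC; congr (_ + _); apply: eq_bigl => i.
    by rewrite ltnS andbC ltn_neqAle -val_eqE.
  have inb (t : K) : 0 <= t <= 1 -> ball x d ((x + s w j) + t *: (l j w *: b j)).
    move=> t01; rewrite -ball_normE /ball_/= -addrA opprD addrA subrr sub0r normrN.
    apply: le_lt_trans small.
    have := BP w (fun i => i < j.+1)%N (fun i => if i == j then t else 1) _.
    rewrite (bigD1 j)//= eqxx addrC; set X := \sum_(i < m | _) _.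
    rewrite (_ : X = s w j).
      by apply => i; case: ifP => // _; rewrite ler01 lexx.
    rewrite /X /s; apply: eq_big => i; first by rewrite ltnS andbC ltn_neqAle -val_eqE.
    by move=> /andP[_ /negbTE->]; rewrite scale1r.
  have dd (t : K) : 0 <= t <= 1 -> is_derive ((x + s w j) + t *: (l j w *: b j))
      (l j w *: b j) F (l j w *: 'D_(b j) F ((x + s w j) + t *: (l j w *: b j))).
    move=> /inb/dP/(_ j)[dF _]; exact/is_deriveZdir/derivableP.
  have [t t01 tE] := @MVT_dir K V F (x + s w j) (l j w *: b j)
    (fun t h => @ex_derive _ _ _ _ _ _ _ (dd t h)).
  rewrite sS addrA tE (@derive_val _ _ _ _ _ _ _ (dd t t01)) -mulrBr normrM ler_wpM2l//.
  by rewrite distrC ltW//; have [] := dP _ (inb t t01) j.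
have E : F (x + w) - F x - LL w =
    \sum_(j < m) (F (x + s w j.+1) - F (x + s w j) - l j w * 'D_(b j) F x).
  rewrite sumrB; congr (_ - _).
  have -> : \sum_(i < m) (F (x + s w i.+1) - F (x + s w i)) =
      \sum_(0 <= i < m) (F (x + s w i.+1) - F (x + s w i)) by rewrite big_mkord.
  rewrite telescope_sumr// {2}/s big_pred0// addr0 {1}(lE w); congr (F (_ + _) - _).
  by rewrite /s; apply: eq_bigl => i; rewrite ltn_ord.
rewrite E; apply: (le_trans (ler_norm_sum _ _ _)).
apply: (@le_trans _ _ (\sum_(j < m) e / m.+1%:R * `|w|)).
  apply: ler_sum => j _; apply: (le_trans (step j)).
  apply: (@le_trans _ _ (k * `|w| * e')); first by rewrite ler_wpM2r ?(ltW e'0).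
  by rewrite mulrC /e' mulrA divfK// gt_eqF.
rewrite sumr_const card_ord -[X in X <= _]mulr_natr mulrAC ler_wpM2r//.
by rewrite -mulrA ler_piMr ?(ltW e0)// mulrC ler_pdivrMr// mul1r ler_nat.
Unshelve. all: by end_near. Qed.

End FiniteDimension.

(** * Calculus of C^k maps *)

Section Smoothness.
Context {K : realType}.
Implicit Types V W Z : normedModType K.

Lemma C1_differentiable V W (F : V -> W) (x : V) : has_basis V -> has_basis W ->
  C1_at F x -> differentiable F x.
Proof.
move=> hV [m [b [l [lc lE]]]] C1.
have dl i : differentiable (fun y => l i (F y)) x.
  apply: C1_differentiableK => // v; have [C1d C1c] := C1 v; split.
    by apply: filterS C1d => y /derivableP /(is_derive_lin (lc i)) [].
  have e : \forall y \near x, l i ('D_v F y) = 'D_v (fun y => l i (F y)) y.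
    by apply: filterS C1d => y /derivableP /(is_derive_lin (lc i)) [_ ->].
  rewrite /prop_for /continuous_at -(nbhs_singleton e).
  apply: cvg_trans; first exact: near_eq_cvg e.
  exact: (cvg_comp _ _ C1c (lc i _)).
have -> : F = \sum_i (fun y => l i (F y) *: b i).
  by apply/funext => y; rewrite fct_sumE; exact: lE.
by apply: differentiable_sum => i; exact: differentiableZl.
Qed.

Lemma is_derive_scale V W (f : V -> K) (g : V -> W) (x v : V) (df : K) (dg : W) :
  is_derive x v f df -> is_derive x v g dg ->
  is_derive x v (fun y => f y *: g y) (f x *: dg + df *: g x).
Proof.
move=> fd [gd <-]; have [fd' <-] := fd.
have cv : (fun h : K => h^-1 *: (((fun y => f y *: g y) \o shift x) (h *: v) - f x *: g x))
    @ 0^' --> f x *: 'D_v g x + 'D_v f x *: g x.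
  have -> : (fun h : K => h^-1 *: (((fun y => f y *: g y) \o shift x) (h *: v) - f x *: g x))
      = (fun h : K => (f \o shift x) (h *: v) *: (h^-1 *: ((g \o shift x) (h *: v) - g x))
        + (h^-1 *: ((f \o shift x) (h *: v) - f x)) *: g x).
    apply/funext => h; rewrite [RHS]/= [LHS]/=.
    set a := f _; set b := g _.
    have -> : (h^-1 *: (a - f x)) *: g x = h^-1 *: ((a - f x) *: g x) by rewrite scalerA.
    have -> : a *: (h^-1 *: (b - g x)) = h^-1 *: (a *: (b - g x)).
      by rewrite !scalerA mulrC.
    by rewrite -scalerDr [a *: (b - _)]scalerBr scalerBl addrA subrK.
  apply: cvgD; last by apply: cvgZ; [exact: fd'|exact: cvg_cst].
  apply: cvgZ; last exact: gd.
  have fl : differentiable (fun h : K => f (h *: v + x)) 0.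
    exact/derivable1_diffP/(derivable1P f x v).1.
  have := differentiable_continuous fl; rewrite /prop_for /continuous_at /= scale0r add0r.
  exact: cvg_within_filter.
by split; [apply/cvg_ex; eexists; exact: cv|exact: cvg_lim].
Qed.

Lemma is_derive_pair V W Z (f : V -> W) (g : V -> Z) (x v : V) df dg :
  is_derive x v f df -> is_derive x v g dg ->
  is_derive x v (fun y => (f y, g y)) (df, dg).
Proof.
move=> [fd <-] [gd <-].
have cv : (fun h : K => h^-1 *: (((fun y => (f y, g y)) \o shift x) (h *: v) - (f x, g x)))
    @ 0^' --> ('D_v f x, 'D_v g x).
  exact: (cvg_pair fd gd).
by split; [apply/cvg_ex; eexists; exact: cv|exact: cvg_lim].
Qed.

Section Ck.
Context {V W : normedModType K}.
Implicit Types (U : set V) (F G : V -> W) (k : nat).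

Lemma Ck_sub k U U' F : U' `<=` U -> Ck_on k U F -> Ck_on k U' F.
Proof.
elim: k F => [|k IH] F sU.
  by move=> [c _]; split=> // x /sU/c.
move=> [c [d h]]; split; first by move=> x /sU/c.
by split=> [x v /sU Ux|v]; [exact: d|exact: IH (h v)].
Qed.

Lemma Ck_pred k U F : Ck_on k.+1 U F -> Ck_on k U F.
Proof.
elim: k F => [|k IH] F [c h]; split=> //.
by case: h => d h; split=> // v; exact: IH (h v).
Qed.

Lemma Ck_eq k U F G : open U -> (forall x, U x -> F x = G x) ->
  Ck_on k U F -> Ck_on k U G.
Proof.
move=> oU; elim: k F G => [|k IH] F G FG.
  case=> c _; split=> // x Ux; rewrite /prop_for/continuous_at -FG//.
  apply: cvg_trans (c x Ux); apply: near_eq_cvg.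
  by apply: filterS (open_nbhs_nbhs (conj oU Ux)) => y /FG.
have nFG x : U x -> \forall y \near x, F y = G y.
  by move=> Ux; apply: filterS (open_nbhs_nbhs (conj oU Ux)) => y /FG.
case=> c [d h]; split.
  move=> x Ux; rewrite /prop_for/continuous_at -FG//.
  by apply: cvg_trans (c x Ux); apply: near_eq_cvg; exact: nFG.
split=> [x v Ux|v].
  by apply: near_eq_derivable (d x v Ux); exact: nFG.
by apply: IH (h v) => x Ux; apply: near_eq_derive; exact: nFG.
Qed.

Lemma Ck_C1 U F x : open U -> U x -> Ck_on 1 U F -> C1_at F x.
Proof.
move=> oU Ux [_ [d h]] v; split; last by have [c _] := h v; exact: c.
by apply: filterS (open_nbhs_nbhs (conj oU Ux)) => y /d.
Qed.

Lemma Ck_cst k U (w : W) : Ck_on k U (fun=> w).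
Proof.
elim: k w => [|k IH] w; split=> //; try by move=> x _; exact: cvg_cst.
split=> [x v _|v]; first exact: derivable_cst.
have -> : 'D_v (fun=> w) = (fun=> 0) :> (V -> W) by apply/funext => x; exact: derive_cst.
exact: IH.
Qed.

Lemma Ck_add k U F G : open U -> Ck_on k U F -> Ck_on k U G ->
  Ck_on k U (fun x => F x + G x).
Proof.
move=> oU; elim: k F G => [|k IH] F G [cF hF] [cG hG].
  by split=> // x Ux; apply: cvgD; [exact: cF|exact: cG].
split; first by move=> x Ux; apply: cvgD; [exact: cF|exact: cG].
case: hF hG => dF hF [dG hG]; split=> [x v Ux|v].
  by apply: derivableD; [exact: dF|exact: dG].
apply: Ck_eq oU _ (IH _ _ (hF v) (hG v)) => x Ux.
by rewrite -deriveD; [|exact: dF|exact: dG].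
Qed.

Lemma Ck_sum k U m (F : 'I_m -> V -> W) : open U -> (forall i, Ck_on k U (F i)) ->
  Ck_on k U (fun x => \sum_i F i x).
Proof.
move=> oU h; elim: m F h => [|m IH] F h.
  apply: Ck_eq oU _ (Ck_cst _ _ 0) => x _; by rewrite big_ord0.
apply: Ck_eq oU _ (Ck_add oU (h ord0) (IH (fun i => F (lift ord0 i)) (fun i => h _))).
by move=> x _; rewrite big_ord_recl.
Qed.

End Ck.

Lemma Ck_scale V W k (U : set V) (f : V -> K) (G : V -> W) : open U -> Ck_on k U f -> Ck_on k U G ->
  Ck_on k U (fun x => f x *: G x).
Proof.
move=> oU; elim: k f G => [|k IH] f G.
  move=> [cf _] [cG _].
  by split=> // x Ux; apply: cvgZ; [exact: cf|exact: cG].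
move=> Cf CG; have [cf [df hf]] := Cf; have [cG [dG hG]] := CG.
split; first by move=> x Ux; apply: cvgZ; [exact: cf|exact: cG].
have D x v : U x -> is_derive x v (fun x => f x *: G x) (f x *: 'D_v G x + 'D_v f x *: G x).
  by move=> Ux; apply: is_derive_scale; apply: derivableP; [exact: df|exact: dG].
split=> [x v Ux|v]; first by have [] := D x v Ux.
have CD := Ck_add oU (IH _ _ (Ck_pred Cf) (hG v)) (IH _ _ (hf v) (Ck_pred CG)).
by apply: (Ck_eq oU _ CD) => x Ux; have [_ ->] := D x v Ux.
Qed.

Lemma Ck_lin V W Z k (U : set V) (l : {linear W -> Z}) (F : V -> W) : open U ->
  continuous l -> Ck_on k U F -> Ck_on k U (fun x => l (F x)).
Proof.
move=> oU lc; elim: k F => [|k IH] F.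
  by move=> [c _]; split=> // x Ux; exact: (cvg_comp _ _ (c x Ux) (lc _)).
move=> [c [d h]]; split; first by move=> x Ux; exact: (cvg_comp _ _ (c x Ux) (lc _)).
have D x v : U x -> is_derive x v (fun x => l (F x)) (l ('D_v F x)).
  by move=> Ux; apply: is_derive_lin => //; apply: derivableP; exact: d.
split=> [x v Ux|v]; first by have [] := D x v Ux.
by apply: Ck_eq oU _ (IH _ (h v)) => x Ux; have [_ ->] := D x v Ux.
Qed.

Lemma Ck_pair V W Z k (U : set V) (F : V -> W) (G : V -> Z) : open U ->
  Ck_on k U F -> Ck_on k U G -> Ck_on k U (fun x => (F x, G x)).
Proof.
move=> oU; elim: k F G => [|k IH] F G.
  by move=> [cF _] [cG _]; split=> // x Ux; exact: (cvg_pair (cF x Ux) (cG x Ux)).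
move=> [cF [dF hF]] [cG [dG hG]]; split.
  by move=> x Ux; exact: (cvg_pair (cF x Ux) (cG x Ux)).
have D x v : U x -> is_derive x v (fun x => (F x, G x)) ('D_v F x, 'D_v G x).
  by move=> Ux; apply: is_derive_pair; apply: derivableP; [exact: dF|exact: dG].
split=> [x v Ux|v]; first by have [] := D x v Ux.
by apply: Ck_eq oU _ (IH _ _ (hF v) (hG v)) => x Ux; have [_ ->] := D x v Ux.
Qed.

Lemma is_derive_comp V W Z (F : V -> W) (G : W -> Z) (x v : V) (df : W) m
    (b : 'I_m -> W) (l : 'I_m -> {linear W -> K}) :
  (forall w, w = \sum_i l i w *: b i) ->
  is_derive x v F df -> differentiable G (F x) ->
  is_derive x v (fun y => G (F y)) (\sum_i l i df *: 'D_(b i) G (F x)).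
Proof.
move=> lE dF dG; have := is_derive_diff dF dG.
rewrite {1}(lE df) linear_sum; under eq_bigr do rewrite linearZ/= -deriveE//.
by [].
Qed.

(** The derivative of [G] at [F x] is taken in the direction ['D_v F x], which varies with [x].
    Expanding this direction in a basis of [W] leaves derivatives of [G] along fixed vectors only,
    to which the induction applies. *)
Lemma Ck_comp V W Z k (U : set V) (O : set W) (F : V -> W) (G : W -> Z) :
  has_basis W -> has_basis Z -> open U -> open O -> (forall x, U x -> O (F x)) ->
  Ck_on k U F -> Ck_on k O G -> Ck_on k U (fun x => G (F x)).
Proof.
move=> hW hZ oU oO FO; elim: k F G FO => [|k IH] F G FO.
  move=> [cF _] [cG _]; split=> // x Ux.
  exact: (cvg_comp _ _ (cF x Ux) (cG _ (FO _ Ux))).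
move=> CF CG; have [cF [dF hF]] := CF; have [cG [dG hG]] := CG.
split; first by move=> x Ux; exact: (cvg_comp _ _ (cF x Ux) (cG _ (FO _ Ux))).
have C1G y : O y -> differentiable G y.
  move=> Oy; apply: (C1_differentiable hW hZ); apply: Ck_C1 oO Oy _.
  by elim: (k) CG => // j IHj /Ck_pred.
have [m [b [l [lc lE]]]] := hW.
have D x v : U x -> is_derive x v (fun x => G (F x))
    (\sum_i l i ('D_v F x) *: 'D_(b i) G (F x)).
  move=> Ux; apply: is_derive_comp => //; first by apply: derivableP; exact: dF.
  exact/C1G/FO.
split=> [x v Ux|v]; first by have [] := D x v Ux.
apply: (@Ck_eq _ _ k U (fun x => \sum_i l i ('D_v F x) *: 'D_(b i) G (F x))) => //.
  by move=> x Ux; have [_ ->] := D x v Ux.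
apply: Ck_sum => // i; apply: Ck_scale => //; first exact: Ck_lin (hF v).
exact: (IH F ('D_(b i) G) FO (Ck_pred CF) (hG _)).
Qed.

End Smoothness.

(** * Smooth maps *)

Section SmoothAt.
Context {K : realType}.
Implicit Types V W Z : normedModType K.

Lemma Ck_local V W k (U : set V) (F : V -> W) :
  (forall x, U x -> exists A : set V, [/\ open A, A x & Ck_on k A F]) -> Ck_on k U F.
Proof.
elim: k F => [|k IH] F h.
  by split=> // x /h [A [_ Ax [c _]]]; exact: c.
split; first by move=> x /h [A [_ Ax [c _]]]; exact: c.
split=> [x v /h [A [_ Ax [_ [d _]]]]|v]; first exact: d.
by apply: IH => x /h [A [oA Ax [_ [_ hA]]]]; exists A; split=> //; exact: hA.
Qed.

(** Smoothness of the germ at a point. The rules of calculus are stated in this form so that domains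
    need not be carried along; on open sets it gives back [smooth_on]. *)
Definition smooth_at V W (F : V -> W) (x : V) :=
  exists A : set V, [/\ open A, A x & smooth_on A F].

Lemma smooth_onP V W (U : set V) (F : V -> W) : open U ->
  smooth_on U F <-> forall x, U x -> smooth_at F x.
Proof.
move=> oU; split=> [h x Ux|h k]; first by exists U.
by apply: Ck_local => x /h [A [oA Ax hA]]; exists A.
Qed.

Lemma smooth_at_near V W (F : V -> W) (x : V) : smooth_at F x ->
  \forall y \near x, smooth_at F y.
Proof.
move=> [A [oA Ax hA]]; apply: filterS (open_nbhs_nbhs (conj oA Ax)) => y Oy.
by exists A.
Qed.

Lemma smooth_at_cont V W (F : V -> W) (x : V) : smooth_at F x -> {for x, continuous F}.
Proof. by move=> [A [oA Ax /(_ 0%N)[c _]]]; exact: c. Qed.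

Lemma smooth_at_derivable V W (F : V -> W) (x v : V) : smooth_at F x -> derivable F x v.
Proof. by move=> [A [oA Ax /(_ 1%N)[_ [d _]]]]; exact: d. Qed.

Lemma smooth_at_is_derive V W (F : V -> W) (x v : V) : smooth_at F x ->
  is_derive x v F ('D_v F x).
Proof. by move=> h; apply: derivableP; exact: smooth_at_derivable. Qed.

Lemma smooth_at_derive V W (F : V -> W) (x v : V) : smooth_at F x -> smooth_at ('D_v F) x.
Proof.
by move=> [A [oA Ax hA]]; exists A; split=> // k; have [_ [_]] := hA k.+1; exact.
Qed.

Lemma smooth_at_diff V W (F : V -> W) (x : V) : has_basis V -> has_basis W ->
  smooth_at F x -> differentiable F x.
Proof.
by move=> hV hW [A [oA Ax hA]]; apply: C1_differentiable => //; exact: Ck_C1 oA Ax (hA 1%N).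
Qed.

Lemma near_open (T : topologicalType) (x : T) (P : T -> Prop) :
  (\forall y \near x, P y) -> exists A : set T, [/\ open A, A x & forall y, A y -> P y].
Proof.
move=> h; have : nbhs x [set y | P y] by [].
by rewrite nbhsE => -[A [oA Ax] hA]; exists A.
Qed.

Lemma smooth_at_eq V W (F G : V -> W) (x : V) : (\forall y \near x, F y = G y) ->
  smooth_at F x -> smooth_at G x.
Proof.
move=> /near_open [A' [oA' A'x h]] [A [oA Ax hA]].
exists (A `&` A'); split=> //; first exact: openI.
move=> k; apply: (@Ck_eq _ _ _ _ _ F); first exact: openI.
  by move=> y [_ /h].
by apply: Ck_sub (hA k); exact: subIsetl.
Qed.

Lemma smooth_at_ext V W (F G : V -> W) (x : V) :
  smooth_at F x -> F =1 G -> smooth_at G x.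
Proof. by move=> h /funext<-. Qed.

Lemma smooth_at_cst V W (w : W) (x : V) : smooth_at (fun=> w) x.
Proof. by exists setT; split=> //; [exact: openT|move=> k; exact: Ck_cst]. Qed.

Lemma smooth_at_id V (x : V) : smooth_at (@id V) x.
Proof.
exists setT; split=> //; first exact: openT.
case=> [|k]; first by split=> // y _; exact: cvg_id.
split; first by move=> y _; exact: cvg_id.
split=> [y v _|v]; first exact: derivable_id.
have -> : 'D_v (@id V) = (fun=> v) by apply/funext => y; exact: derive_id.
exact: Ck_cst.
Qed.

Lemma smooth_at_lin V W Z (l : {linear W -> Z}) (F : V -> W) (x : V) :
  continuous l -> smooth_at F x -> smooth_at (fun y => l (F y)) x.
Proof. by move=> lc [A [oA Ax hA]]; exists A; split=> // k; exact: Ck_lin (hA k). Qed.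

Section Two.
Context {V W : normedModType K}.
Implicit Types (F G : V -> W) (x : V).

Lemma smooth_at2 Z F (G : V -> Z) x : smooth_at F x -> smooth_at G x ->
  exists A, [/\ open A, A x, smooth_on A F & smooth_on A G].
Proof.
move=> [A [oA Ax hA]] [A' [oA' A'x hA']]; exists (A `&` A'); split=> //.
- exact: openI.
- by move=> k; apply: Ck_sub (hA k); exact: subIsetl.
- by move=> k; apply: Ck_sub (hA' k); exact: subIsetr.
Qed.

Lemma smooth_atD F G x : smooth_at F x -> smooth_at G x ->
  smooth_at (fun y => F y + G y) x.
Proof.
move=> sF sG; have [A [oA Ax hF hG]] := smooth_at2 sF sG.
by exists A; split=> // k; exact: Ck_add (hF k) (hG k).
Qed.

Lemma smooth_atZ (f : V -> K) G x : smooth_at f x -> smooth_at G x ->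
  smooth_at (fun y => f y *: G y) x.
Proof.
move=> [A [oA Ax hA]] [A' [oA' A'x hA']]; exists (A `&` A'); split=> //.
  exact: openI.
move=> k; apply: Ck_scale; first exact: openI.
  by apply: Ck_sub (hA k); exact: subIsetl.
by apply: Ck_sub (hA' k); exact: subIsetr.
Qed.

Lemma smooth_atN F x : smooth_at F x -> smooth_at (fun y => - F y) x.
Proof.
move=> h; have s := smooth_atZ (smooth_at_cst (-1 : K) x) h.
apply: (smooth_at_ext s) => y.
by rewrite scaleN1r.
Qed.

Lemma smooth_atB F G x : smooth_at F x -> smooth_at G x ->
  smooth_at (fun y => F y - G y) x.
Proof. by move=> hF hG; apply: smooth_atD => //; exact: smooth_atN. Qed.

Lemma smooth_at_sum m (F : 'I_m -> V -> W) (P : pred 'I_m) x :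
  (forall i, P i -> smooth_at (F i) x) ->
  smooth_at (fun y => \sum_(i | P i) F i y) x.
Proof.
move=> h; suff H s : smooth_at (fun y => \sum_(i <- s | P i) F i y) x by exact: H.
elim: s => [|i s IH].
  by apply: (smooth_at_ext (smooth_at_cst 0 x)) => y; rewrite big_nil.
case/boolP: (P i) => Pi.
  by apply: (smooth_at_ext (smooth_atD (h i Pi) IH)) => y; rewrite big_cons Pi.
by apply: (smooth_at_ext IH) => y; rewrite big_cons (negbTE Pi).
Qed.

End Two.

Lemma smooth_at_pair V W Z (F : V -> W) (G : V -> Z) x :
  smooth_at F x -> smooth_at G x -> smooth_at (fun y => (F y, G y)) x.
Proof.
move=> sF sG; have [A [oA Ax hF hG]] := smooth_at2 sF sG.
by exists A; split=> // k; exact: Ck_pair (hF k) (hG k).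
Qed.

Lemma smooth_atM V (f g : V -> K) x : smooth_at f x -> smooth_at g x ->
  smooth_at (fun y => f y * g y) x.
Proof. exact: smooth_atZ. Qed.

Lemma smooth_at_comp V W Z (F : V -> W) (G : W -> Z) (x : V) :
  has_basis W -> has_basis Z -> smooth_at F x -> smooth_at G (F x) ->
  smooth_at (fun y => G (F y)) x.
Proof.
move=> hW hZ sF [A' [oA' A'x hA']]; have cF := smooth_at_cont sF.
have [A [oA Ax hA]] := sF.
have : \forall y \near x, A' (F y) by apply: cF; exact: open_nbhs_nbhs.
move=> /near_open [B [oB Bx BO]].
exists (A `&` B); split=> //; first exact: openI.
move=> k; apply: (Ck_comp hW hZ _ oA' _ _ (hA' k)); first exact: openI.
  by move=> y [_ /BO].
by apply: Ck_sub (hA k); exact: subIsetl.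
Qed.

Lemma smooth_at_rV V m (F : V -> 'rV[K]_m) x :
  (forall i, smooth_at (fun y => F y 0 i) x) -> smooth_at F x.
Proof.
move=> h; apply: (smooth_at_ext (@smooth_at_sum _ _ m
  (fun i y => F y 0 i *: delta_mx 0 i) xpredT x _)); last first.
  by move=> y; rewrite -row_sum_delta.
by move=> i _; apply: smooth_atZ => //; exact: smooth_at_cst.
Qed.

Lemma smooth_at_coord V m (F : V -> 'rV[K]_m) x i :
  smooth_at F x -> smooth_at (fun y => F y 0 i) x.
Proof.
move=> h; apply: (smooth_at_ext (@smooth_at_lin _ _ _ (coord_rV i) F x _ h)) => //.
exact: coord_continuous.
Qed.

(** In one variable every direction is a multiple of 1, so one derivative is enough. The functions
    treated next have derivatives expressed through themselves or each other, which makes the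
    induction on the order immediate. *)
Lemma Ck_on1 k (U : set K) (f f' : K -> K) : open U ->
  (forall x, U x -> is_derive x 1 f (f' x)) -> Ck_on k U f' -> Ck_on k.+1 U f.
Proof.
move=> oU d Cf'.
have dv x v : U x -> is_derive x v f (v *: f' x).
  by move=> /d/(is_deriveZdir v); rewrite [v%:A]mulr1.
split.
  move=> x /d[dx _]; apply: differentiable_continuous; exact/derivable1_diffP.
split=> [x v Ux|v]; first by have [] := dv x v Ux.
apply: (Ck_eq oU _ (Ck_scale oU (Ck_cst k U v) Cf')) => x Ux.
by have [_ ->] := dv x v Ux.
Qed.

Lemma smooth_on_expR : smooth_on setT (@expR K).
Proof.
elim=> [|k IH]; first by split=> // x _; exact: continuous_expR.
by apply: (Ck_on1 openT _ IH) => x _; exact: is_derive_expR.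
Qed.

Lemma smooth_on_cossin : smooth_on setT (@cos K) /\ smooth_on setT (@sin K).
Proof.
suff h k : Ck_on k setT (@cos K) /\ Ck_on k setT (@sin K) by split=> k; have [] := h k.
elim: k => [|k [IHc IHs]].
  by split; split=> // x _; [exact: continuous_cos|exact: continuous_sin].
split; last first.
  by apply: (Ck_on1 openT _ IHc) => x _; exact: is_derive_sin.
apply: (Ck_on1 openT _ (Ck_scale openT (Ck_cst k setT (-1 : K)) IHs)) => x _.
by rewrite scaleN1r; exact: is_derive_cos.
Qed.

Lemma smooth_on_inv : smooth_on [set x : K | x != 0] (@GRing.inv K).
Proof.
have o : open [set x : K | x != 0] by exact: open_neq.
elim=> [|k IH]; first by split=> // x x0; exact: inv_continuous.
apply: (Ck_on1 o _ (Ck_scale o (Ck_cst k _ (-1 : K)) (Ck_scale o IH IH))) => x x0.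
by have := is_deriveV x0 (is_derive_id x 1); rewrite [_ *: 1]mulr1 scaleN1r expr2 invfM.
Qed.

Lemma smooth_on_sqrt : smooth_on [set x : K | 0 < x] (@Num.sqrt K).
Proof.
have o : open [set x : K | 0 < x] by exact: open_gt.
have o' : open [set x : K | x != 0] by exact: open_neq.
elim=> [|k IH]; first by split=> // x x0; exact: sqrt_continuous.
apply: (@Ck_on1 _ _ _ (fun x => 2^-1 *: (Num.sqrt x)^-1) o) => [x x0|].
  by have := is_derive1_sqrt x0; rewrite invfM.
apply: Ck_scale => //; first exact: Ck_cst.
apply: (Ck_comp has_basisK has_basisK o o' _ IH (smooth_on_inv k)) => x x0.
by rewrite /= gt_eqF// sqrtr_gt0.
Qed.

Section Functions.
Variables (V : normedModType K) (f : V -> K) (x : V).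
Hypothesis sf : smooth_at f x.

Lemma smooth_at_fun (U : set K) (g : K -> K) : open U -> smooth_on U g -> U (f x) ->
  smooth_at (fun y => g (f y)) x.
Proof.
move=> oU sg Ufx; apply: (smooth_at_comp has_basisK has_basisK sf).
by exists U.
Qed.

Lemma smooth_at_expR : smooth_at (fun y => expR (f y)) x.
Proof. exact: (smooth_at_fun openT smooth_on_expR I). Qed.

Lemma smooth_at_cos : smooth_at (fun y => cos (f y)) x.
Proof. exact: (smooth_at_fun openT smooth_on_cossin.1 I). Qed.

Lemma smooth_at_sin : smooth_at (fun y => sin (f y)) x.
Proof. exact: (smooth_at_fun openT smooth_on_cossin.2 I). Qed.

Lemma smooth_at_inv : f x != 0 -> smooth_at (fun y => (f y)^-1) x.
Proof. exact: (smooth_at_fun (@open_neq _ 0) smooth_on_inv). Qed.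

Lemma smooth_at_sqrt : 0 < f x -> smooth_at (fun y => Num.sqrt (f y)) x.
Proof. exact: (smooth_at_fun (@open_gt _ 0) smooth_on_sqrt). Qed.
End Functions.

End SmoothAt.

(** * Chain rule, symmetry of second derivatives, Lipschitz bounds *)

Section Rules.
Context {K : realType}.
Implicit Types V W Z : normedModType K.

Lemma is_derive_chain V W Z (F : V -> W) (G : W -> Z) (x v : V) (df : W) :
  has_basis W -> has_basis Z -> is_derive x v F df -> smooth_at G (F x) ->
  is_derive x v (fun y => G (F y)) ('D_df G (F x)).
Proof.
move=> hW hZ dF sG; have dG := smooth_at_diff hW hZ sG.
by rewrite deriveE//; exact: is_derive_diff.
Qed.

Lemma is_derive_translate V W (F : V -> W) (x u w : V) (df : W) :
  is_derive (x + w) u F df -> is_derive x u (fun y => F (y + w)) df.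
Proof.
move=> /is_derive_line d; apply/is_derive_line.
by under eq_fun do rewrite -addrA.
Qed.

(** The mean value theorem is applied to y -> F (y + v) - F y along [u], then to ['D_u F] along [v].
    The second difference on the left is symmetric in [u] and [v], the right-hand side is not
    visibly so. *)
Lemma schwarz_mean V (F : V -> K) (x u v : V) :
  (forall a b : K, 0 <= a <= 1 -> 0 <= b <= 1 -> smooth_at F (x + a *: u + b *: v)) ->
  exists a b : K, [/\ 0 <= a <= 1, 0 <= b <= 1 &
    F (x + u + v) - F (x + u) - (F (x + v) - F x)
    = 'D_v ('D_u F) (x + a *: u + b *: v)].
Proof.
move=> sF; have i0 : 0 <= (0 : K) <= 1 by rewrite lexx ler01.
have i1 : 0 <= (1 : K) <= 1 by rewrite lexx ler01.
pose G y := F (y + v) - F y.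
have dG (a : K) : 0 <= a <= 1 ->
    is_derive (x + a *: u) u G ('D_u F (x + a *: u + v) - 'D_u F (x + a *: u)).
  move=> ha; apply: is_deriveB.
    apply/is_derive_translate/smooth_at_is_derive.
    by have := sF a 1 ha i1; rewrite scale1r.
  by apply/smooth_at_is_derive; have := sF a 0 ha i0; rewrite scale0r addr0.
have [a a01 aE] := MVT_dir (fun t ht => @ex_derive _ _ _ _ _ _ _ (dG t ht)).
have [b b01 bE] := @MVT_dir _ _ ('D_u F) (x + a *: u) v
  (fun t ht => smooth_at_derivable (smooth_at_derive u (sF a t a01 ht))).
exists a, b; split=> //; rewrite -bE -(@derive_val _ _ _ _ _ _ _ (dG a a01)) -aE.
by rewrite /G addrAC.
Qed.

(** The same second difference on a small parallelogram is computed in both orders. The two mixed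
    derivatives therefore agree at two nearby points, and continuity of each brings both back to [x]
    within [e]. *)
Lemma schwarzK V (F : V -> K) (x u v : V) : smooth_at F x ->
  'D_u ('D_v F) x = 'D_v ('D_u F) x.
Proof.
move=> sF; apply/eqP; rewrite -subr_eq0 -normr_le0; apply/ler_addgt0Pl => e e0.
rewrite addr0.
have c1 := smooth_at_cont (smooth_at_derive v (smooth_at_derive u sF)).
have c2 := smooth_at_cont (smooth_at_derive u (smooth_at_derive v sF)).
have e2 : 0 < e / 2 by rewrite divr_gt0.
have /nbhs_normP[d /= d0 dP] : \forall y \near x, [/\ smooth_at F y,
    `|'D_v ('D_u F) x - 'D_v ('D_u F) y| < e / 2 &
    `|'D_u ('D_v F) x - 'D_u ('D_v F) y| < e / 2].
  have n0 := smooth_at_near sF.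
  have n1 : \forall y \near x, `|'D_v ('D_u F) x - 'D_v ('D_u F) y| < e / 2.
    exact: ((cvgrPdist_lt _ _).1 c1 _ e2).
  have n2 : \forall y \near x, `|'D_u ('D_v F) x - 'D_u ('D_v F) y| < e / 2.
    exact: ((cvgrPdist_lt _ _).1 c2 _ e2).
  by move: n0 n1 n2; apply: filterS3 => y h0 h1 h2; split.
(* Both directions are shrunk so that the parallelogram stays in the ball of radius [d]; the summand
   1 keeps the denominator positive. *)
pose s := d / (1 + `|u| + `|v|).
have D0 : 0 < 1 + `|u| + `|v| by rewrite -addrA ltr_pwDl// addr_ge0.
have s0 : 0 < s by rewrite divr_gt0.
have inb (a b : K) : 0 <= a <= 1 -> 0 <= b <= 1 ->
    `|x - (x + a *: (s *: u) + b *: (s *: v))| < d.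
  move=> /andP[a0 a1] /andP[b0 b1].
  rewrite -addrA opprD addrA subrr sub0r normrN (le_lt_trans (ler_normD _ _))//.
  rewrite !normrZ !ger0_norm ?(ltW s0)//.
  apply: (@le_lt_trans _ _ (s * `|u| + s * `|v|)).
    by rewrite lerD// ler_piMl// mulr_ge0// ltW.
  rewrite -mulrDr /s mulrAC ltr_pdivrMr// ltr_pM2l//.
  by rewrite -addrA ltrDr.
  exact: ltW.
have inb' : forall p q : K, 0 <= p <= 1 -> 0 <= q <= 1 ->
    `|x - (x + p *: (s *: v) + q *: (s *: u))| < d.
  by move=> p q hp hq; rewrite addrAC inb.
have [|a1 [b1 [ha hb E1]]] := @schwarz_mean _ F x (s *: u) (s *: v).
  by move=> p q hp hq; have [] := dP _ (inb p q hp hq).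
have [|a2 [b2 [ha' hb' E2]]] := @schwarz_mean _ F x (s *: v) (s *: u).
  by move=> p q hp hq; have [] := dP _ (inb' p q hp hq).
have scal p q y : smooth_at F y -> 'D_(s *: p) ('D_(s *: q) F) y = s * s * 'D_p ('D_q F) y.
  move=> sFy.
  have := @near_eq_derive _ _ _ ('D_(s *: q) F) (fun y => s *: 'D_q F y) y (s *: p).
  move=> ->; last first.
    apply: filterS (smooth_at_near sFy) => z sz.
    by have [_] := is_deriveZdir s (smooth_at_is_derive q sz).
  have /(is_deriveZdir s)[_ ->] :=
    is_deriveZ s (smooth_at_is_derive p (smooth_at_derive q sFy)).
  by rewrite scalerA.
have [S1 B1 _] := dP _ (inb _ _ ha hb).
have [S2 _ B2] := dP _ (inb' _ _ ha' hb').
rewrite (scal v u _ S1) in E1; rewrite (scal u v _ S2) in E2.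
have E : 'D_v ('D_u F) (x + a1 *: (s *: u) + b1 *: (s *: v)) =
    'D_u ('D_v F) (x + a2 *: (s *: v) + b2 *: (s *: u)).
  apply: (@mulfI _ (s * s)); first by rewrite mulf_neq0// gt_eqF.
  apply: (etrans (esym E1)); apply: (etrans _ E2).
  rewrite [x + s *: v + s *: u]addrAC.
  by set p := F _; set q := F _; set r := F _; set t := F _; ring.
rewrite E distrC in B1.
apply: (le_trans (ler_distD ('D_u ('D_v F) (x + a2 *: (s *: v) + b2 *: (s *: u))) _ _)).
by rewrite [leRHS]splitr; exact: lerD (ltW B2) (ltW B1).
Qed.

Lemma schwarz_rV V m (F : V -> 'rV[K]_m) (x u v : V) : smooth_at F x ->
  'D_u ('D_v F) x = 'D_v ('D_u F) x.
Proof.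
move=> sF.
have co p q i : ('D_p ('D_q F) x) 0 i = 'D_p ('D_q (fun y => F y 0 i)) x.
  have lc : continuous (@coord_rV K m i) by exact: coord_continuous.
  have [_ E1] := is_derive_lin (l := coord_rV i) lc
    (smooth_at_is_derive p (smooth_at_derive q sF)).
  rewrite -[LHS]E1.
  apply: near_eq_derive; apply: filterS (smooth_at_near sF) => z sz.
  by have [_ E2] := is_derive_lin (l := coord_rV i) lc (smooth_at_is_derive q sz); rewrite -E2.
apply/rowP => i; exact: etrans (co u v i) (etrans (schwarzK u v (smooth_at_coord i sF)) (esym (co v u i))).
Qed.

(** The mean value theorem along a segment, which stays in the ball by convexity, with bounds on the
    finitely many coordinate derivatives near [x]. It will compare a function with its values on a
    slice. *)
Lemma smooth_lipschitz V (F : V -> K) (x : V) : has_basis V -> smooth_at F x ->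
  exists2 L : K, 0 < L & exists2 e : K, 0 < e & forall u w,
    `|x - u| < e -> `|x - w| < e -> `|F u - F w| <= L * `|u - w|.
Proof.
move=> hV sF; have [m [b [l [lc lE]]]] := hV.
have dnear i : \forall y \near x, `|'D_(b i) F y| < `|'D_(b i) F x| + 1.
  have := smooth_at_cont (smooth_at_derive (b i) sF).
  move/cvgrPdist_lt => /(_ 1 ltr01); apply: filterS => y h.
  rewrite -ltrBlDl; apply: le_lt_trans h; rewrite distrC.
  exact: lerB_dist.
have /nbhs_normP[e /= e0 eP] : \forall y \near x, smooth_at F y /\
    forall i, `|'D_(b i) F y| < `|'D_(b i) F x| + 1.
  have dn : \forall y \near x, forall i, `|'D_(b i) F y| < `|'D_(b i) F x| + 1.
    exact: filter_forall.
  by move: (smooth_at_near sF) dn; apply: filterS2 => y h0 h1; split.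
have [k k0 kP] : exists2 k : K, 0 < k & forall i w, `|l i w| <= k * `|w|.
  have /choice[k kP] : forall i, exists k : K, 0 < k /\ forall w, `|l i w| <= k * `|w|.
    by move=> i; have [k k0 h] := linear_lipschitz (lc i); exists k.
  exists (1 + \sum_i k i).
    by rewrite ltr_pwDl// sumr_ge0// => i _; have [/ltW] := kP i.
  move=> i w; have [ki0 /(_ w)/le_trans] := kP i; apply.
  rewrite ler_wpM2r// (bigD1 i)//= addrCA lerDl addr_ge0// sumr_ge0// => j _.
  by have [/ltW] := kP j.
exists (1 + \sum_i k * (`|'D_(b i) F x| + 1)).
  rewrite ltr_pwDl// sumr_ge0// => i _; rewrite mulr_ge0 ?(ltW k0)// addr_ge0//.
exists e => // u w hu hw.
have hseg (t : K) : 0 <= t <= 1 -> `|x - (w + t *: (u - w))| < e.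
  move=> /andP[t0 t1].
  have -> : x - (w + t *: (u - w)) = (1 - t) *: (x - w) + t *: (x - u).
    rewrite scalerBl scale1r -addrA [- _ + _]addrC -scalerBr opprB.
    by rewrite [x - u + _]addrC addrA subrK opprD addrA -scalerN opprB.
  apply: (le_lt_trans (ler_normD _ _)); rewrite !normrZ !ger0_norm ?subr_ge0//.
  have [->|t0'] := eqVneq t 0; first by rewrite subr0 mul1r mul0r addr0.
  have t0'' : 0 < t by rewrite lt_neqAle eq_sym t0' t0.
  apply: (@lt_le_trans _ _ ((1 - t) * e + t * e)); last by rewrite -mulrDl subrK mul1r.
  apply: ler_ltD; last by rewrite ltr_pM2l.
  by apply: ler_wpM2l; rewrite ?subr_ge0 ?(ltW hw).
have [t t01] := @MVT_dir K V F w (u - w)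
  (fun t ht => smooth_at_derivable (eP _ (hseg t ht)).1).
rewrite [w + (u - w)]addrC subrK => ->.
have [sy dy] := eP _ (hseg t t01); have dF := smooth_at_diff hV has_basisK sy.
rewrite deriveE// (lE (u - w)) linear_sum -lE.
apply: (le_trans (ler_norm_sum _ _ _)); rewrite mulrDl mul1r mulr_suml.
apply: ler_wpDl => //; apply: ler_sum => i _.
rewrite linearZ -deriveE// normrM mulrAC ler_pM// ltW//.
Qed.

End Rules.

(** * The ambient scalar product *)

Section Metric.
Context {K : realType} {n : nat} (nu : bool).
Implicit Types x y z : 'rV[K]_n.+1.

Definition weight (i : 'I_n.+1) : K := if i == 0 then (-1) ^+ nu else 1.

Lemma mdotE x y : mdot nu x y = \sum_i weight i * (x 0 i * y 0 i).
Proof.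
rewrite /mdot [RHS](bigD1 (0 : 'I_n.+1))//= /weight eqxx; congr (_ + _).
by apply: eq_bigr => i /negbTE i0; rewrite /weight i0 mul1r.
Qed.

Lemma mdotC x y : mdot nu x y = mdot nu y x.
Proof. by rewrite !mdotE; apply: eq_bigr => i _; rewrite [x _ _ * _]mulrC. Qed.

Lemma mdotDl x y z : mdot nu (x + y) z = mdot nu x z + mdot nu y z.
Proof. by rewrite !mdotE -big_split; apply: eq_bigr => i _; rewrite !mxE mulrDl mulrDr. Qed.

Lemma mdotZl c x z : mdot nu (c *: x) z = c * mdot nu x z.
Proof. by rewrite !mdotE mulr_sumr; apply: eq_bigr => i _; rewrite !mxE; ring. Qed.

Lemma mdotDr x y z : mdot nu z (x + y) = mdot nu z x + mdot nu z y.
Proof. by rewrite mdotC mdotDl ![mdot nu z _]mdotC. Qed.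

Lemma mdotZr c x z : mdot nu z (c *: x) = c * mdot nu z x.
Proof. by rewrite mdotC mdotZl mdotC. Qed.

Lemma mdotNl x z : mdot nu (- x) z = - mdot nu x z.
Proof. by rewrite -scaleN1r mdotZl mulN1r. Qed.

Lemma mdotNr x z : mdot nu z (- x) = - mdot nu z x.
Proof. by rewrite -scaleN1r mdotZr mulN1r. Qed.

Lemma mdot0l z : mdot nu 0 z = 0.
Proof. by rewrite -(scale0r z) mdotZl mul0r. Qed.

Lemma mdot0r z : mdot nu z 0 = 0.
Proof. by rewrite mdotC mdot0l. Qed.

Definition mdot_lin := (mdotDl, mdotDr, mdotNl, mdotNr, mdotZl, mdotZr).

Lemma is_derive_mdot (V : normedModType K) (F G : V -> 'rV[K]_n.+1) (x v : V) (df dg : 'rV[K]_n.+1) :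
  is_derive x v F df -> is_derive x v G dg ->
  is_derive x v (fun y : V => mdot nu (F y) (G y)) (mdot nu df (G x) + mdot nu (F x) dg).
Proof.
move=> dF dG.
have lc i : continuous (@coord_rV K n.+1 i) by exact: coord_continuous.
have cF i := is_derive_lin (l := coord_rV i) (lc i) dF.
have cG i := is_derive_lin (l := coord_rV i) (lc i) dG.
have h i : is_derive x v (fun y : V => weight i * (F y 0 i * G y 0 i))
    (weight i * (F x 0 i * dg 0 i + G x 0 i * df 0 i)).
  have := is_deriveZ (weight i) (is_deriveM (cF i) (cG i)).
  by [].
rewrite (_ : (fun y : V => _) = \sum_i (fun y : V => weight i * (F y 0 i * G y 0 i))); last first.
  by apply/funext => y; rewrite fct_sumE mdotE.
apply: is_derive_eq (is_derive_sum h) _.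
rewrite !mdotE -big_split/=; apply: eq_bigr => i _.
by rewrite mulrDr addrC [df _ _ * _]mulrC.
Qed.

Lemma smooth_at_mdot (V : normedModType K) (F G : V -> 'rV[K]_n.+1) (x : V) :
  smooth_at F x -> smooth_at G x -> smooth_at (fun y : V => mdot nu (F y) (G y)) x.
Proof.
move=> sF sG; apply: (@smooth_at_ext _ _ _
  (fun y : V => \sum_i weight i * (F y 0 i * G y 0 i))); last by move=> y; rewrite mdotE.
apply: smooth_at_sum => i _; apply: smooth_atM; first exact: smooth_at_cst.
by apply: smooth_atM; exact: smooth_at_coord.
Qed.

End Metric.

Lemma cauchy_schwarz (K : realFieldType) (I : finType) (P : pred I) (a b : I -> K) :
  (\sum_(i | P i) a i * b i) ^+ 2 <=
  (\sum_(i | P i) a i ^+ 2) * (\sum_(i | P i) b i ^+ 2).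
Proof.
set p := \sum_(i | _) a i * b i; set A := \sum_(i | _) a i ^+ 2.
set B := \sum_(i | _) b i ^+ 2.
have A0 : 0 <= A by apply: sumr_ge0 => i _; exact: sqr_ge0.
have B0 : 0 <= B by apply: sumr_ge0 => i _; exact: sqr_ge0.
have [B00|Bn0] := eqVneq B 0.
  have b0 i : P i -> b i = 0.
    move=> Pi; have /eqP := psumr_eq0P (fun i _ => sqr_ge0 (b i)) B00 Pi.
    by rewrite sqrf_eq0 => /eqP.
  rewrite /p big1 => [|i Pi]; first by rewrite expr0n B00 mulr0.
  by rewrite b0// mulr0.
have Bp : 0 < B by rewrite lt_neqAle eq_sym Bn0.
(* The combination [B * a i - p * b i] is, up to the factor [B], the part of [a] orthogonal to [b];
   its square norm is [B * (A * B - p ^+ 2)]. *)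
have : 0 <= \sum_(i | P i) (B * a i - p * b i) ^+ 2.
  by apply: sumr_ge0 => i _; exact: sqr_ge0.
have -> : \sum_(i | P i) (B * a i - p * b i) ^+ 2 = B * (A * B - p ^+ 2).
  have e i : (B * a i - p * b i) ^+ 2 =
      B ^+ 2 * a i ^+ 2 + ((- (2 * B * p)) * (a i * b i) + p ^+ 2 * b i ^+ 2).
    by ring.
  under eq_bigr => i _ do rewrite e.
  rewrite !big_split/= -!mulr_sumr -/A -/B -/p; ring.
by rewrite pmulr_rge0// subr_ge0.
Qed.

(** * Positivity on the tangent spaces of the space forms *)

Section SpaceForm.
Context {K : realType} {n : nat} {nu : bool} {C r : K}.
Hypotheses (r0 : 0 < r) (hC : C = (-1) ^+ nu / r ^+ 2).
Implicit Types p X : 'rV[K]_n.+1.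

Let S (x : 'rV[K]_n.+1) := \sum_(i < n.+1 | i != 0) x 0 i ^+ 2.

Lemma sform_C0 : C != 0.
Proof. by rewrite hC mulf_neq0 ?signr_eq0// invr_neq0// expf_neq0// gt_eqF. Qed.

Lemma sform_Cgt0 : (0 < C) = ~~ nu.
Proof.
have r2 : 0 < (r ^+ 2)^-1 by rewrite invr_gt0 exprn_gt0.
rewrite hC; case: (nu) => /=; rewrite ?expr1 ?expr0 ?mulN1r ?mul1r ?r2//.
by rewrite oppr_gt0 ltNge (ltW r2).
Qed.

Lemma sform_sheet p : nu -> mdot nu p p = C^-1 -> p 0 0 ^+ 2 = r ^+ 2 + S p.
Proof.
move=> hnu; rewrite hC /mdot hnu expr1 invfM invrK invrN invr1 -/(S p).
move=> h; lra.
Qed.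

(** In the hyperbolic case orthogonality says that the product of the first coordinates is the
    Euclidean product of the remaining ones; Cauchy-Schwarz applies, with [S p] computed from the
    equation of the sheet. *)
Lemma sform_orthogonal p X : nu -> mdot nu p p = C^-1 -> mdot nu X p = 0 ->
  p 0 0 ^+ 2 * X 0 0 ^+ 2 <= (p 0 0 ^+ 2 - r ^+ 2) * S X.
Proof.
move=> hnu hp h.
have e : p 0 0 * X 0 0 = \sum_(i < n.+1 | i != 0) p 0 i * X 0 i.
  move: h; rewrite mdotC /mdot hnu expr1; lra.
have -> : p 0 0 ^+ 2 - r ^+ 2 = S p by rewrite (sform_sheet hnu hp) addrAC subrr add0r.
by rewrite -exprMn e; exact: cauchy_schwarz.
Qed.

Lemma mdot_nu X : nu -> mdot nu X X = S X - X 0 0 ^+ 2.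
Proof.
by move=> hnu; rewrite /mdot hnu expr1 mulN1r addrC.
Qed.

Lemma mdot_Nnu X : ~~ nu -> mdot nu X X = S X + X 0 0 ^+ 2.
Proof.
by move=> /negbTE hnu; rewrite /mdot hnu expr0 mul1r addrC.
Qed.

Let S_ge0 X : 0 <= S X. Proof. by apply: sumr_ge0 => i _; exact: sqr_ge0. Qed.

Lemma S_eq0 X : S X = 0 -> X 0 0 = 0 -> X = 0.
Proof.
move=> S0 X0; apply/rowP => i; rewrite mxE; have [->//|i0] := eqVneq i 0.
have /eqP := psumr_eq0P (fun i _ => sqr_ge0 (X 0 i)) S0 i0.
by rewrite sqrf_eq0 => /eqP.
Qed.

(** The ambient metric may be Lorentzian, but it is positive definite on the orthogonal complement
    of a point of the space form. Every vanishing of a tangent vector deduced below from its square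
    goes through this. *)
Lemma tangent_pos p X : mdot nu p p = C^-1 -> mdot nu X p = 0 -> X != 0 ->
  0 < mdot nu X X.
Proof.
move=> hp h; apply: contraNT; rewrite -leNgt => le0.
have r2 : 0 < r ^+ 2 by rewrite exprn_gt0.
have s0 := S_ge0 X; have q0 := sqr_ge0 (X 0 0).
have [hnu|hnu] := boolP nu; last first.
  move: le0; rewrite mdot_Nnu// => le0.
  apply/eqP/S_eq0; first by apply/eqP; rewrite eq_le s0 andbT; lra.
  by apply/eqP; rewrite -sqrf_eq0 eq_le q0 andbT; lra.
have := sform_orthogonal hnu hp h; have := sform_sheet hnu hp.
move: le0; rewrite mdot_nu// => le0 e1 e2; have sp := S_ge0 p.
move: e2; rewrite e1 [_ + _ - _]addrAC subrr add0r => e2.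
have X0 : X 0 0 ^+ 2 = 0.
  apply/eqP; rewrite eq_le q0 andbT; move: e2 le0 s0 q0 sp r2.
  move: (X 0 0 ^+ 2) (S X) (S p) (r ^+ 2) => x s t q; nra.
apply/eqP/S_eq0; last by apply/eqP; rewrite -sqrf_eq0 X0.
by apply/eqP; rewrite eq_le s0 andbT; move: le0; rewrite X0 subr0.
Qed.

(** The strict estimate that keeps points such as f p + r g X, for a unit tangent vector X, on the
    sheet where the first coordinate is positive. *)
Lemma sheet_bound p X : nu -> mdot nu p p = C^-1 -> mdot nu X p = 0 ->
  mdot nu X X = 1 -> (r * X 0 0) ^+ 2 < p 0 0 ^+ 2.
Proof.
move=> hnu hp h; rewrite mdot_nu// => h1.
have r2 : 0 < r ^+ 2 by rewrite exprn_gt0.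
have := sform_orthogonal hnu hp h.
have -> : S X = 1 + X 0 0 ^+ 2 by lra.
rewrite exprMn; move: (X 0 0 ^+ 2) (p 0 0 ^+ 2) (r ^+ 2) r2 => x y q q0 h2.
nra.
Qed.

End SpaceForm.

(** * Charts and slices *)

Section RowVectors.
Context {K : realType} {m : nat}.

Lemma norm_coord_le (v : 'rV[K]_m) i : `|v 0 i| <= `|v|.
Proof.
rewrite [leRHS]/Num.Def.normr/= mx_normrE.
exact: (le_bigmax _ (fun i => `|v i.1 i.2|) (0, i)).
Qed.

Lemma norm_rV_le (v : 'rV[K]_m) (c : K) : 0 <= c -> (forall i, `|v 0 i| <= c) -> `|v| <= c.
Proof.
move=> c0 h; rewrite [leLHS]/Num.Def.normr/= mx_normrE.
by apply: bigmax_le => // -[i j] _ /=; rewrite ord1.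
Qed.

Lemma norm_delta_le (c : K) (k : 'I_m) : `|c *: delta_mx 0 k : 'rV[K]_m| <= `|c|.
Proof.
apply: norm_rV_le => // i; rewrite !mxE eqxx/=.
by case: (i == k); rewrite ?mulr1 ?mulr0 ?normr0.
Qed.

End RowVectors.

(* Implicit function theorem for one equation, as the statement that the [k]-th
   coordinate may be replaced by [H] when the partial derivative of [H] along it
   does not vanish. *)
Section CoordinateReplacement.
Context {K : realType} {m : nat} (H : 'rV[K]_m.+1 -> K) (k : 'I_m.+1).
Notation E := 'rV[K]_m.+1.
Notation ek := (delta_mx 0 k : E).

Definition replace_coord (u : E) : E := u + (H u - u 0 k) *: ek.

(** On a ball the partial derivative keeps the sign it has at the centre. Writing this as a positive
    product treats both signs together; the factor at the centre appears below as [c0]. *)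
Lemma replace_radius (u0 : E) : smooth_at H u0 -> 'D_ek H u0 != 0 ->
  exists2 d : K, 0 < d & forall u : E, `|u0 - u| < d ->
  smooth_at H u /\ 0 < 'D_ek H u * 'D_ek H u0.
Proof.
move=> sH dH; have n1 := smooth_at_near sH.
have sD := smooth_at_derive ek sH.
pose dot (u : E) : K := 'D_ek H u * 'D_ek H u0.
have n2 : \forall u \near u0, 0 < dot u.
  have /smooth_at_cont c : smooth_at dot u0.
    exact: (smooth_atM sD (smooth_at_cst ('D_ek H u0) u0)).
  have d0 : 0 < dot u0 by rewrite /dot -expr2 exprn_even_gt0.
  have n3 : \forall u \near u0, `|dot u0 - dot u| < dot u0.
    exact: ((cvgrPdist_lt _ _).1 c _ d0).
  apply: filterS n3 => u.
  by rewrite ltr_distlC => /andP[h _]; move: h; rewrite subrr.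
have /nbhs_normP[d /= d0 dP] : \forall u \near u0, smooth_at H u /\ 0 < dot u.
  by move: n1 n2; apply: filterS2.
by exists d.
Qed.

Variables (u0 : E) (d c0 : K).
Hypotheses (d0 : 0 < d) (dP : forall u : E, `|u0 - u| < d ->
  smooth_at H u /\ 0 < 'D_ek H u * c0).

Let A : set E := [set u | `|u0 - u| < d].

Let Dk_neq0 u : A u -> 'D_ek H u != 0.
Proof. by move=> /dP [_ h]; apply/eqP => e; move: h; rewrite e mul0r ltxx. Qed.

Let segA u w (t : K) : A u -> A w -> 0 <= t <= 1 -> A (u + t *: (w - u)).
Proof.
move=> hu hw /andP[t0 t1]; rewrite /A/=.
have -> : u0 - (u + t *: (w - u)) = (1 - t) *: (u0 - u) + t *: (u0 - w).
  rewrite scalerBl scale1r -addrA [- _ + _]addrC -scalerBr opprB.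
  by rewrite [u0 - w + _]addrC addrA subrK opprD addrA -scalerN opprB.
apply: (le_lt_trans (ler_normD _ _)); rewrite !normrZ !ger0_norm ?subr_ge0//.
have [->|t0'] := eqVneq t 0; first by rewrite subr0 mul1r mul0r addr0.
have t0'' : 0 < t by rewrite lt_neqAle eq_sym t0' t0.
apply: (@lt_le_trans _ _ ((1 - t) * d + t * d)); last by rewrite -mulrDl subrK mul1r.
apply: ler_ltD; last by rewrite ltr_pM2l.
by apply: ler_wpM2l; rewrite ?subr_ge0 ?(ltW hu).
Qed.

Let mean u w : A u -> A w -> exists2 xi : E, A xi /\ `|xi - u| <= `|w - u| &
  H w - H u = 'D_(w - u) H xi.
Proof.
move=> hu hw.
have hd (t : K) : 0 <= t <= 1 -> derivable H (u + t *: (w - u)) (w - u).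
  by move=> ht; exact: smooth_at_derivable (dP (segA hu hw ht)).1.
have [t t01] := MVT_dir hd.
rewrite [u + (w - u)]addrC subrK => ->; exists (u + t *: (w - u)) => //.
split; first exact: segA.
rewrite addrAC subrr add0r normrZ; case/andP: t01 => t0 t1.
by rewrite ger0_norm// ler_piMl.
Qed.

Let deriv_lin u (a b : K) (v w : E) : A u ->
  'D_(a *: v + b *: w) H u = a * 'D_v H u + b * 'D_w H u.
Proof.
move=> /dP[s _]; have dF := smooth_at_diff (has_basis_rV _) has_basisK s.
have l v' : 'D_v' H u = 'd H u v' by exact: deriveE.
rewrite (l (a *: v + b *: w)) (l v) (l w).
by rewrite linearD linearZ/= linearZ.
Qed.

Let repl_eq u y : replace_coord u = y ->
  H u = y 0 k /\ u = y + (u 0 k - y 0 k) *: ek.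
Proof.
move=> <-; split; first by rewrite !mxE !eqxx/= mulr1 addrC subrK.
apply/rowP => i; rewrite !mxE !eqxx/=.
by have [->|ik] := eqVneq i k; rewrite ?eqxx /=; ring.
Qed.

Let mk_repl (y : E) (s : K) : H (y + (s - y 0 k) *: ek) = y 0 k ->
  replace_coord (y + (s - y 0 k) *: ek) = y.
Proof.
rewrite /replace_coord => ->; apply/rowP => i; rewrite !mxE !eqxx/=.
by have [->|ik] := eqVneq i k; rewrite ?eqxx /=; ring.
Qed.

(** Two points with the same image differ by a multiple of [ek] and have the same value of [H]; by
    the mean value theorem that multiple is killed by a nonzero partial derivative. *)
Let inj u w : A u -> A w -> replace_coord u = replace_coord w -> u = w.
Proof.
move=> hu hw /esym/repl_eq[h1 h2]; have [h3 h4] := repl_eq (erefl (replace_coord u)).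
have [xi [hxi _] e] := mean hu hw.
have dE : w - u = (w 0 k - u 0 k) *: ek + 0 *: ek.
  rewrite scale0r addr0 h2 h4; apply/rowP => i; rewrite !mxE !eqxx/=.
  by case: (i == k) => /=; ring.
move: e; rewrite h1 h3 subrr dE deriv_lin// mul0r addr0 => /esym/eqP.
rewrite mulf_eq0 (negbTE (Dk_neq0 hxi)) orbF => /eqP e.
by apply/esym/eqP; rewrite -subr_eq0 dE e !scale0r addr0.
Qed.

Let oA : open A.
Proof.
have -> : A = ball u0 d by rewrite -ball_normE.
exact: ball_open.
Qed.

(** Local surjectivity. A preimage of [y] must lie on the line through [y] in the direction [ek]; on
    it the intermediate value theorem solves H = y_k, because the two ends of a short segment give
    values on opposite sides of y_k. *)
Let solve u1 (e : K) : A u1 -> 0 < e ->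
  \forall y \near replace_coord u1, exists2 u : E, A u /\ `|u - u1| < e &
    replace_coord u = y.
Proof.
move=> hu1 e0; set y1 := replace_coord u1.
pose b := Num.min e (d - `|u0 - u1|).
have b0 : 0 < b by rewrite lt_min e0 subr_gt0.
(* Three displacements of size at most [q] have to add up to less than [b]. *)
pose q := b / 4.
have q0 : 0 < q by rewrite divr_gt0.
pose P (y : E) (s : K) : E := y + (s - y 0 k) *: ek.
have inb y s : `|y - y1| < q -> `|s - u1 0 k| <= q -> A (P y s) /\ `|P y s - u1| < e.
  move=> hy hs.
  have small : `|P y s - u1| < b.
    have -> : P y s - u1 = (y - y1) + ((s - u1 0 k) *: ek - ((y - y1) 0 k) *: ek).
      rewrite /P /y1 /replace_coord; apply/rowP => i; rewrite !mxE !eqxx/=.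
      by have [->|ik] := eqVneq i k; rewrite ?eqxx /=; ring.
    have h1 : `|(s - u1 0 k) *: ek| <= q by apply: le_trans hs; exact: norm_delta_le.
    have h2 : `|((y - y1) 0 k) *: ek| < q.
      by apply: le_lt_trans hy; apply: le_trans (norm_delta_le _ _) (norm_coord_le _ _).
    have h3 := ler_normD (y - y1) ((s - u1 0 k) *: ek - ((y - y1) 0 k) *: ek).
    have h4 := ler_normB ((s - u1 0 k) *: ek) (((y - y1) 0 k) *: ek).
    have h5 : b = q * 4 by rewrite /q divfK.
    rewrite h5; apply: (le_lt_trans h3); apply: (le_lt_trans (lerD (lexx _) h4)).
    by move: hy h1 h2; lra.
  move: small; rewrite lt_min => /andP[se sd]; split => //.
  rewrite /A/= -[u0](subrK u1) -addrA; apply: (le_lt_trans (ler_normD _ _)).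
  by rewrite -ltrBrDl distrC.
(* Negative exactly when the two ends lie on opposite sides; a strict inequality on a continuous
   function, so it passes from [y1] to nearby [y]. *)
pose G (y : E) : K := (H (P y (u1 0 k + q)) - y 0 k) * (H (P y (u1 0 k - q)) - y 0 k).
have Py1 s : P y1 s = u1 + (s - u1 0 k) *: ek.
  rewrite /P /y1 /replace_coord; apply/rowP => i; rewrite !mxE !eqxx/=.
  by have [->|ik] := eqVneq i k; rewrite ?eqxx /=; ring.
have y1k : y1 0 k = H u1 by have [] := repl_eq (erefl y1).
have side (s : K) : `|s - u1 0 k| <= q -> exists2 D : K, 0 < D * c0 &
    H (P y1 s) - y1 0 k = (s - u1 0 k) * D.
  move=> hs; have [|hA _] := inb y1 s _ hs; first by rewrite subrr normr0.
  have [xi [hxi _] e1] := mean hu1 hA; exists ('D_ek H xi); first exact: (dP hxi).2.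
  rewrite y1k e1 Py1 addrAC subrr add0r -[_ *: ek]addr0 -[X in _ + X](scale0r ek).
  by rewrite deriv_lin// mul0r addr0.
have G1 : G y1 < 0.
  have [|D1 D10 E1] := side (u1 0 k + q).
    by rewrite addrAC subrr add0r ger0_norm// ltW.
  have [|D2 D20 E2] := side (u1 0 k - q).
    by rewrite addrAC subrr add0r normrN ger0_norm// ltW.
  have D12 : 0 < D1 * D2.
    have : 0 < (D1 * c0) * (D2 * c0) by exact: mulr_gt0.
    rewrite mulrACA pmulr_lgt0// -expr2 exprn_even_gt0//=.
    by apply: contraTneq D10 => ->; rewrite mulr0 ltxx.
  rewrite /G E1 E2; have -> : u1 0 k + q - u1 0 k = q by ring.
  have -> : u1 0 k - q - u1 0 k = - q by ring.
  by rewrite mulrACA mulrN mulNr oppr_lt0; exact: mulr_gt0 (mulr_gt0 q0 q0) D12.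
have smP y s : A (P y s) -> smooth_at (fun y => H (P y s)) y.
  move=> hA; apply: (@smooth_at_comp _ _ _ _ (P ^~ s) H y (has_basis_rV _) has_basisK _ (dP hA).1).
  apply: smooth_atD; first exact: smooth_at_id.
  apply: smooth_atZ; last exact: smooth_at_cst.
  apply: smooth_atB; first exact: smooth_at_cst.
  by apply: smooth_at_coord; exact: smooth_at_id.
have cG : {for y1, continuous G}.
  apply: smooth_at_cont.
  have sk : smooth_at (fun y : E => y 0 k) y1 by apply: smooth_at_coord; exact: smooth_at_id.
  have yy : `|y1 - y1| < q by rewrite subrr normr0.
  apply: smooth_atM; apply: smooth_atB => //; apply: smP => //; apply: (inb _ _ yy _).1.
    by rewrite addrAC subrr add0r ger0_norm// ltW.
  by rewrite addrAC subrr add0r normrN ger0_norm// ltW.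
have n1 : \forall y \near y1, G y < 0.
  have G0 : 0 < - G y1 by rewrite oppr_gt0.
  have n3 : \forall y \near y1, `|G y1 - G y| < - G y1.
    exact: ((cvgrPdist_lt _ _).1 cG _ G0).
  by apply: filterS n3 => y; rewrite ltr_distlC => /andP[_]; rewrite addrN.
have n2 : \forall y \near y1, `|y - y1| < q.
  by apply/nbhs_normP; exists q => // y; rewrite /= distrC.
near=> y.
have hy : `|y - y1| < q by near: y.
have Gy : G y < 0 by near: y.
have cH : {within `[u1 0 k - q, u1 0 k + q], continuous (fun s => H (P y s))}.
  apply/continuous_in_subspaceT => s /[1!inE]; rewrite /= in_itv/= => hs.
  have hs' : `|s - u1 0 k| <= q by rewrite ler_distl.
  apply: smooth_at_cont.
  apply: (@smooth_at_comp _ _ _ _ (P y) H s (has_basis_rV _) has_basisK _ (dP (inb _ _ hy hs').1).1).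
  apply: smooth_atD; first exact: smooth_at_cst.
  apply: smooth_atZ; last exact: smooth_at_cst.
  by apply: smooth_atB; [exact: smooth_at_id|exact: smooth_at_cst].
have lepq : u1 0 k - q <= u1 0 k + q by move: q0; lra.
have bt : Num.min (H (P y (u1 0 k - q))) (H (P y (u1 0 k + q))) <= y 0 k <=
    Num.max (H (P y (u1 0 k - q))) (H (P y (u1 0 k + q))).
  move: Gy; rewrite /G; set p := H (P y (u1 0 k - q)); set p' := H (P y (u1 0 k + q)).
  move: p p' (y 0 k) => p p' z pp.
  rewrite ge_min le_max; apply/andP; split; apply/orP.
    by have [h|h] := leP p z; [left|right; nra].
  by have [h|h] := leP z p; [left|right; nra].
have [s sI sE] := IVT lepq cH bt.
have hs : `|s - u1 0 k| <= q by rewrite ler_distl; move: sI; rewrite in_itv.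
have [PA Pe] := inb y s hy hs.
by exists (P y s) => //; exact: mk_repl.
Unshelve. all: by end_near. Qed.

Let G (y : E) : E := xget u0 [set u | A u /\ replace_coord u = y].

Let GE u : A u -> G (replace_coord u) = u.
Proof.
move=> hu; rewrite /G; set S := [set w | _].
have [hA e] : S (xget u0 S) by apply: (@xgetPex _ u0 S); exists u.
exact: inj hA hu e.
Qed.

Let B := replace_coord @` A.

Let oB : open B.
Proof.
rewrite openE => y [u hu <-]; rewrite /interior.
have /(solve hu) : 0 < (1 : K) by [].
apply: (@filterS _ (nbhs (replace_coord u))).
by move=> z [w [hw _] <-]; exists w.
Qed.

Let G_near u1 y1 (e : K) : A u1 -> replace_coord u1 = y1 -> 0 < e -> \forall y \near y1,
  [/\ A (G y), `|G y - u1| < e & replace_coord (G y) = y].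
Proof.
move=> hu y1E e0; have n := solve hu e0; rewrite y1E in n.
by apply: filterS n => y [u [hAu hn] <-]; rewrite GE.
Qed.

Let G_cont u1 y1 : A u1 -> replace_coord u1 = y1 -> {for y1, continuous G}.
Proof.
move=> hu y1E.
have Gy1 : G y1 = u1 by rewrite -y1E GE.
suff : G @ nbhs y1 --> G y1 by [].
rewrite Gy1; apply/cvgrPdist_lt => e e0.
by have n := G_near hu y1E e0; apply: filterS n => y [_ h _]; rewrite distrC.
Qed.

(** The inverse has derivative w = v + R ek in the direction [v]: the k-th component of the replaced
    map requires D_w H = v_k, that is D_v H + R D_k H = v_k. *)
Let R (v u : E) : K := (v 0 k - 'D_v H u) / 'D_ek H u.

Let R_smooth v u : A u -> smooth_at (R v) u.
Proof.
move=> hu; have sH := (dP hu).1; apply: smooth_atM.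
  by apply: smooth_atB; [exact: smooth_at_cst|exact: smooth_at_derive].
apply: smooth_at_inv; first exact: smooth_at_derive.
exact: Dk_neq0.
Qed.

(* The mean value theorem expresses the difference quotient of the inverse
   exactly through the derivatives of [H] at an intermediate point. *)
Let quotient u1 y v (t : K) : A u1 -> replace_coord u1 = y -> t != 0 ->
  A (G (t *: v + y)) -> replace_coord (G (t *: v + y)) = t *: v + y ->
  exists2 xi : E, A xi /\ `|xi - u1| <= `|G (t *: v + y) - u1| &
    t^-1 *: (G (t *: v + y) - u1) = v + R v xi *: ek.
Proof.
move=> hu e1 t0; set w := G _ => hw e2.
have [H1 E1] := repl_eq e1; have [H2 E2] := repl_eq e2.
have [xi [hxi xin] me] := mean hu hw; exists xi => //.
pose g := (w 0 k - u1 0 k) - t * v 0 k.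
have dE : w - u1 = t *: v + g *: ek.
  rewrite E2 E1 /g; apply/rowP => i; rewrite !mxE !eqxx/=.
  by have [->|ik] := eqVneq i k; rewrite ?eqxx /=; ring.
have gE : g = t * R v xi.
  move: me; rewrite H1 H2 dE deriv_lin// !mxE addrK => h.
  apply: (mulIf (Dk_neq0 hxi)); rewrite /R -mulrA divfK ?Dk_neq0// mulrBr h.
  by rewrite addrAC subrr add0r.
by rewrite dE gE scalerDr !scalerA mulrA mulVf// mul1r scale1r.
Qed.

Let G_derive u1 v : A u1 ->
  is_derive (replace_coord u1) v G (v + R v u1 *: ek).
Proof.
move=> hu; set y := replace_coord u1.
have cv : (fun h : K => h^-1 *: ((G \o shift y) (h *: v) - G y)) @ 0^' --> v + R v u1 *: ek.
  apply/cvgrPdist_lt => e e0.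
  have cR := smooth_at_cont (R_smooth v hu).
  have /nbhs_normP[q /= q0 qP] : \forall u \near u1, `|R v u1 - R v u| < e.
    exact: ((cvgrPdist_lt _ _).1 cR _ e0).
  have n1 : \forall t \near (0 : K)^', [/\ A (G (t *: v + y)), `|G (t *: v + y) - u1| < q &
      replace_coord (G (t *: v + y)) = t *: v + y].
    apply: nbhs_dnbhs.
    have c : {for (0 : K), continuous (fun t : K => t *: v + y)}.
      by apply: cvgD; [exact: scalel_continuous|exact: cvg_cst].
    have c' : (fun t : K => t *: v + y) @ nbhs (0 : K) --> y.
      by move: c; rewrite /prop_for /continuous_at /= scale0r add0r.
    exact: c' _ (G_near hu (erefl y) q0).
  near=> t.
  have t0 : t != 0 by near: t; exact: nbhs_dnbhs_neq.
  have [hA hq hE] : [/\ A (G (t *: v + y)), `|G (t *: v + y) - u1| < q &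
      replace_coord (G (t *: v + y)) = t *: v + y] by near: t.
  have [xi [hxi xin] qE] := quotient hu erefl t0 hA hE.
  have -> : t^-1 *: ((G \o shift y) (t *: v) - G y) = v + R v xi *: ek.
    by rewrite -qE /= (GE hu).
  rewrite opprD addrACA subrr add0r -scalerBl.
  apply: (le_lt_trans (norm_delta_le _ _)); apply: qP.
  by rewrite /= distrC (le_lt_trans xin).
split; last exact: cvg_lim.
by apply/cvg_ex; exists (v + R v u1 *: ek).
Unshelve. all: by end_near. Qed.

(** Bootstrap: the derivative of [G] is a smooth function of [G] itself, so each order of regularity
    yields the next. *)
Let G_smooth : smooth_on B G.
Proof.
elim=> [|j IH]; first by split=> // y [u hu yE]; exact: G_cont hu yE.
split=> [y [u hu yE]|]; first exact: G_cont hu yE.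
split=> [y v [u hu <-]|v]; first by have [] := G_derive v hu.
apply: (@Ck_eq _ _ _ _ _ (fun y => v + R v (G y) *: ek) _ oB).
  by move=> y [u hu <-]; have [_ ->] := G_derive v hu; rewrite GE.
apply: Ck_add => //; first exact: Ck_cst.
apply: Ck_scale => //; last exact: Ck_cst.
apply: (Ck_comp (has_basis_rV _) has_basisK oB oA _ IH).
  by move=> y [u hu <-]; rewrite GE.
have : smooth_on A (R v) by apply/smooth_onP => // u; exact: R_smooth.
exact.
Qed.

Lemma replace_coord_local : exists (G : E -> E),
  [/\ open (replace_coord @` [set u | `|u0 - u| < d]),
      forall u, `|u0 - u| < d -> G (replace_coord u) = u &
      smooth_on (replace_coord @` [set u | `|u0 - u| < d]) G].
Proof. by exists G; split. Qed.

End CoordinateReplacement.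

Lemma coordinate_chart (K : realType) (m : nat) (H : 'rV[K]_m.+1 -> K) (k : 'I_m.+1)
    (u0 : 'rV[K]_m.+1) :
  smooth_at H u0 -> 'D_(delta_mx 0 k) H u0 != 0 ->
  exists (A : set 'rV[K]_m.+1) (G : 'rV[K]_m.+1 -> 'rV[K]_m.+1),
    [/\ open A, A u0, forall u, A u -> smooth_at H u,
        forall u, A u -> G (replace_coord H k u) = u &
        open (replace_coord H k @` A) /\ smooth_on (replace_coord H k @` A) G].
Proof.
move=> sH dH; have [d d0 dP] := replace_radius sH dH.
have [G [oB GE sG]] := replace_coord_local dP.
exists [set u | `|u0 - u| < d], G; split=> //.
- have -> : [set u | `|u0 - u| < d] = ball u0 d by rewrite -ball_normE.
  exact: ball_open.
- by rewrite /= subrr normr0.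
- by move=> u /dP[].
Qed.

Lemma smooth_along_open (K : realType) (V W : normedModType K) (U : set V) (F : V -> W) :
  open U -> smooth_along U F <-> forall x, U x -> smooth_at F x.
Proof.
move=> oU; split=> [h x Ux|h x Ux]; last first.
  have [A [oA Ax hA]] := h x Ux; exists A, F; split=> //.
have [A [G [oA Ax hA hG]]] := h x Ux.
have sG : smooth_at G x by exists A.
apply: smooth_at_eq sG; apply: filterS (open_nbhs_nbhs (conj (openI oU oA) (conj Ux Ax))).
by move=> y /hG.
Qed.

Lemma open_preimage (T1 T2 : topologicalType) (U : set T1) (A : set T2) (f : T1 -> T2) :
  open U -> open A -> (forall x, U x -> {for x, continuous f}) ->
  open (U `&` f @^-1` A).
Proof.
move=> oU oA cf; rewrite openE => x [Ux Ax]; rewrite /interior.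
apply: filterI; first exact: open_nbhs_nbhs.
by apply: cf => //; exact: open_nbhs_nbhs.
Qed.

(** * Charts, slices and their tangent vectors *)

Section Charts.
Context {K : realType} {n : nat}.
Notation E := 'rV[K]_n.+1.
Implicit Types (U A S : set E) (Phi G : E -> E) (p q X Y : E).

(** The inverse is part of the data, so that charts can be restricted, composed and inverted
    explicitly. *)
Definition chart U Phi G := [/\ open U, forall q, U q -> smooth_at Phi q,
  open (Phi @` U), forall y, (Phi @` U) y -> smooth_at G y &
  forall q, U q -> G (Phi q) = q].

Lemma chart_sub U A Phi G : open A -> chart U Phi G -> chart (U `&` A) Phi G.
Proof.
move=> oA [oU sP oPU sG GP].
have e : Phi @` (U `&` A) = Phi @` U `&` G @^-1` A.
  apply/seteqP; split=> [y [q [Uq Aq] <-]|y [[q Uq <-]]]; rewrite /preimage/=.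
    by rewrite GP//; split=> //; exists q.
  by rewrite GP// => Aq; exists q.
split; [exact: openI|by move=> q [/sP]| |by move=> y [q [Uq _] <-]; apply: sG; exists q|].
  by rewrite e; apply: open_preimage => // y /sG/smooth_at_cont.
by move=> q [/GP].
Qed.

Lemma chart_comp U Phi G A Phi' G' : chart U Phi G -> chart A Phi' G' ->
  chart (U `&` Phi @^-1` A) (Phi' \o Phi) (G \o G').
Proof.
move=> cP cP'; have [oU sP oPU sG GP] := cP; have [oA sP' oPA sG' GP'] := cP'.
have e : (Phi' \o Phi) @` (U `&` Phi @^-1` A) = Phi' @` (A `&` Phi @` U).
  apply/seteqP; split=> [y [q [Uq Aq] <-]|y [u [Au [q Uq qu]] <-]].
    by exists (Phi q) => //; split=> //; exists q.
  by exists q; rewrite /= ?qu//; split=> //; rewrite /= qu.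
split.
- by apply: open_preimage => // q /sP/smooth_at_cont.
- move=> q [Uq Aq]; apply: smooth_at_comp; [exact: has_basis_rV|exact: has_basis_rV| |].
    exact: sP.
  exact: sP'.
- by rewrite e; have [_ _ o _ _] := chart_sub oPU cP'.
- move=> y; rewrite e => -[u [Au Pu] <-].
  apply: smooth_at_comp; [exact: has_basis_rV|exact: has_basis_rV| |].
    by apply: sG'; exists u.
  by rewrite GP'//; exact: sG.
- by move=> q [Uq Aq] /=; rewrite GP'// GP.
Qed.

Definition slice k S U Phi G := chart U Phi G /\
  forall q, U q -> (S q <-> forall i : 'I_n.+1, (k <= i)%N -> Phi q 0 i = 0).

Lemma submanifoldP k S : submanifold k S <->
  forall p, S p -> exists U Phi G, slice k S U Phi G /\ U p.
Proof.
split=> h p /h.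
  move=> [U [B [Phi [oU Up oB [PU sP [G [sG GP]]] hS]]]].
  exists U, Phi, G; split=> //; split=> //; rewrite -PU in oB sG.
  split=> // ; [exact/smooth_along_open|exact/smooth_along_open].
move=> [U [Phi [G [[[oU sP oPU sG GP] hS] Up]]]].
exists U, (Phi @` U), Phi; split=> //; split=> //; first exact/smooth_along_open.
by exists G; split=> //; exact/smooth_along_open.
Qed.

Lemma chart_tangent U Phi G p X : chart U Phi G -> U p ->
  'D_('D_X Phi p) G (Phi p) = X.
Proof.
move=> [oU sP oPU sG GP] Up.
have sGp : smooth_at G (Phi p) by apply: sG; exists p.
have [_ <-] := is_derive_chain (has_basis_rV _) (has_basis_rV _)
  (smooth_at_is_derive X (sP p Up)) sGp.
rewrite -[RHS](derive_id p X); apply: near_eq_derive.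
by apply: filterS (open_nbhs_nbhs (conj oU Up)) => q /GP.
Qed.

(** Velocities of curves in [S] have vanishing last chart components. Conversely the straight line
    through [Phi p] with velocity ['D_X Phi p] stays in the slice, and its image under [G] is a
    curve in [S] with velocity [X]. *)
Lemma tangent_slice k S U Phi G p X : slice k S U Phi G -> U p -> S p ->
  tangent S p X <-> forall i : 'I_n.+1, (k <= i)%N -> ('D_X Phi p) 0 i = 0.
Proof.
move=> [cP hS] Up Sp; have [oU sP oPU sG GP] := cP.
have lc i : continuous (@coord_rV K n.+1 i) by exact: coord_continuous.
split.
  move=> [c [[e [e0 sc Sc]] c0 <-]] i ki; rewrite derive1E.
  have o : open [set t : K | `|t| < e].
    have -> : [set t : K | `|t| < e] = ball (0 : K) e.
      by rewrite -ball_normE; apply/seteqP; split=> t /=; rewrite sub0r normrN.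
    exact: ball_open.
  have sc0 : smooth_at c 0 by exists [set t : K | `|t| < e]; split=> //=; rewrite normr0.
  have sPc : smooth_at Phi (c 0) by rewrite c0; exact: sP.
  have d := is_derive_chain (has_basis_rV _) (has_basis_rV _)
    (smooth_at_is_derive (1 : K) sc0) sPc.
  have [_ d'] := is_derive_lin (l := coord_rV i) (lc i) d.
  rewrite -c0 -[LHS]d'.
  rewrite -[RHS](derive_cst (0 : K) (0 : K) (1 : K)); apply: near_eq_derive.
  have n1 : \forall t \near (0 : K), `|t| < e.
    by apply: filterS (open_nbhs_nbhs (conj o _)) => //=; rewrite normr0.
  have n2 : \forall t \near (0 : K), U (c t).
    by apply: (smooth_at_cont sc0); rewrite c0; exact: open_nbhs_nbhs.
  move: n1 n2; apply: filterS2 => t te Ut.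
  by rewrite /coord_rV/=; have [h _] := hS _ Ut; apply: h => //; exact: Sc.
move=> h; set Y := 'D_X Phi p.
pose L (t : K) : E := Phi p + t *: Y.
have sL t : smooth_at L t.
  apply: smooth_atD; first exact: smooth_at_cst.
  by apply: smooth_atZ; [exact: smooth_at_id|exact: smooth_at_cst].
have L0 : L 0 = Phi p by rewrite /L scale0r addr0.
have [e /= e0 he] : exists2 e : K, 0 < e & forall t : K, `|t| < e -> (Phi @` U) (L t).
  have : \forall t \near (0 : K), (Phi @` U) (L t).
    apply: (smooth_at_cont (sL 0)); rewrite L0; apply: open_nbhs_nbhs; split=> //.
  move=> /nbhs_normP[e /= e0 he]; exists e => // t te; apply: he.
  by rewrite /= sub0r normrN.
have sGL t : `|t| < e -> smooth_at (fun t => G (L t)) t.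
  move=> te; apply: smooth_at_comp; [exact: has_basis_rV|exact: has_basis_rV|exact: sL|].
  exact/sG/he.
have o : open [set t : K | `|t| < e].
  have -> : [set t : K | `|t| < e] = ball (0 : K) e.
    by rewrite -ball_normE; apply/seteqP; split=> t /=; rewrite sub0r normrN.
  exact: ball_open.
exists (fun t => G (L t)); split; last first.
- rewrite derive1E.
  have dL : is_derive (0 : K) 1 L Y.
    have d := is_derive_scale (is_derive_id (0 : K) 1) (is_derive_cst Y (0 : K) 1).
    have := is_deriveD (is_derive_cst (Phi p) (0 : K) 1) d.
    by rewrite scaler0 add0r scale1r add0r.
  have sG0 : smooth_at G (L 0) by apply/sG/he; rewrite normr0.
  have [_ ->] := is_derive_chain (has_basis_rV _) (has_basis_rV _) dL sG0.
  by rewrite L0; exact: (chart_tangent _ cP).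
- by rewrite L0 GP.
exists e; split=> //; first exact/smooth_onP.
move=> t /he[q Uq qE]; rewrite -qE GP//; apply/hS => // i ki.
rewrite qE /L mxE mxE h// mulr0 addr0.
by have [h1 _] := hS _ Up; exact: h1.
Qed.

Lemma slice_ext k S S' U Phi G p : slice k S U Phi G -> U p ->
  (\forall q \near p, S q <-> S' q) -> exists U' Phi' G', slice k S' U' Phi' G' /\ U' p.
Proof.
move=> [cP hS] Up /near_open [A [oA Ap hA]].
exists (U `&` A), Phi, G; split=> //; split; first exact: chart_sub.
by move=> q [Uq Aq]; rewrite -(hA q Aq); exact: hS.
Qed.

Lemma tangent_ext S S' p X : (\forall q \near p, S q -> S' q) -> tangent S p X ->
  tangent S' p X.
Proof.
move=> nS [c [[e [e0 sc Sc]] c0 cX]].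
have cc : {for 0, continuous c} by have [h _] := sc 0%N; apply: h; rewrite /= normr0.
have nS' : nbhs (c 0) [set q | S q -> S' q] by rewrite c0.
have /nbhs_normP[e' /= e'0 he'] := cc _ nS'.
exists c; split=> //; exists (Num.min e e'); split; first by rewrite lt_min e0.
  by move=> k; apply: Ck_sub (sc k) => t /=; rewrite lt_min => /andP[].
move=> t; rewrite lt_min => /andP[te te']; apply: he'; first by rewrite /= sub0r normrN.
exact: Sc.
Qed.

End Charts.

(** * Cutting a submanifold by one equation *)

Section Cut.
Context {K : realType} {n : nat}.
Notation E := 'rV[K]_n.+1.
Implicit Types (U A S : set E) (Phi G : E -> E) (p q X Y : E).

Lemma chart_setT : chart setT (@id E) id.
Proof.
split=> //; [exact: openT|by move=> q _; exact: smooth_at_id| |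
  by move=> q _; exact: smooth_at_id].
have -> : [set id x | x in setT] = setT :> set E by apply/seteqP; split=> // y _; exists y.
exact: openT.
Qed.

Lemma chart_swap (j k : 'I_n.+1) : chart setT (xcol j k : E -> E) (xcol j k).
Proof.
have s q : smooth_at (xcol j k : E -> E) q.
  apply: smooth_at_rV => i; apply: (@smooth_at_ext _ _ _ (fun u : E => u 0 (tperm j k i))).
    by apply: smooth_at_coord; exact: smooth_at_id.
  by move=> u; rewrite !mxE.
have i q : xcol j k (xcol j k q) = q by apply/rowP => l; rewrite !mxE tpermK.
split=> //; first exact: openT.
have -> : [set xcol j k x | x in setT] = setT :> set E.
  by apply/seteqP; split=> // y _; exists (xcol j k y).
exact: openT.
Qed.

Lemma derive_coord (V : normedModType K) (F : V -> E) (x v : V) i : smooth_at F x ->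
  ('D_v F x) 0 i = 'D_v (fun y => F y 0 i) x.
Proof.
move=> sF; have lc : continuous (@coord_rV K n.+1 i) by exact: coord_continuous.
by have [_ d] := is_derive_lin (l := coord_rV i) lc (smooth_at_is_derive v sF); rewrite -[LHS]d.
Qed.

(** Exchanging two free coordinates does not touch the equations of the slice. It serves to move a
    coordinate with nonzero derivative to the last free place. *)
Lemma slice_swap k S U Phi G (j : 'I_n.+1) (k' : 'I_n.+1) : (j < k)%N -> (k' < k)%N ->
  slice k S U Phi G -> slice k S U (xcol j k' \o Phi) (G \o xcol j k').
Proof.
move=> jk kk [cP hS]; split.
  have := chart_comp cP (chart_swap j k'); congr (chart _ _ _).
  by apply/seteqP; split=> // q [].
move=> q Uq; rewrite (hS q Uq); split=> h i ki.
  by rewrite /= mxE tpermD ?h//; apply: contraTneq ki => <-; rewrite -ltnNge.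
have := h i ki; rewrite /= mxE tpermD//; apply: contraTneq ki => <-; by rewrite -ltnNge.
Qed.

(** The last free coordinate is replaced by [h] itself, so that the new equation becomes the
    vanishing of one more coordinate. *)
Lemma slice_cut1 (k : 'I_n.+1) S U Phi G (h : E -> K) p :
  slice k.+1 S U Phi G -> U p -> S p -> h p = 0 -> smooth_at h p ->
  'D_(delta_mx 0 k) (h \o G) (Phi p) != 0 ->
  exists U' Phi' G', [/\ slice k (S `&` [set q | h q = 0]) U' Phi' G', U' p &
    forall Y, tangent S p Y -> 'D_Y h p = 0 -> tangent (S `&` [set q | h q = 0]) p Y].
Proof.
move=> sl Up Sp hp sh dh; have [cP hS] := sl; have [oU sP oPU sG GP] := cP.
have sH : smooth_at (h \o G) (Phi p).
  apply: smooth_at_comp; [exact: has_basis_rV|exact: has_basisK| |by rewrite GP].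
  by apply: sG; exists p.
have [A [B [oA Ap sHA BE [oB sB]]]] := coordinate_chart sH dh.
have cR : chart A (replace_coord (h \o G) k) B.
  split=> //; last by move=> y; exact: (smooth_onP _ oB).1.
  move=> u Au; apply: smooth_atD; first exact: smooth_at_id.
  apply: smooth_atZ; last exact: smooth_at_cst.
  by apply: smooth_atB; [exact: sHA|apply: smooth_at_coord; exact: smooth_at_id].
have cC := chart_comp cP cR.
set U' := U `&` _ in cC; set Phi' := _ \o Phi in cC; set G' := G \o B in cC.
have U'p : U' p by [].
have Phi'k q : U q -> Phi' q 0 k = h q.
  by move=> Uq; rewrite /Phi' /replace_coord !mxE !eqxx/= GP// mulr1 addrC subrK.
have Phi'i q (i : 'I_n.+1) : (k < i)%N -> Phi' q 0 i = Phi q 0 i.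
  move=> ki; rewrite /Phi' /replace_coord !mxE !eqxx/=.
  by rewrite (_ : i == k = false) ?mulr0 ?addr0//; apply: contraTF ki => /eqP->; rewrite ltnn.
have sl' : slice k (S `&` [set q | h q = 0]) U' Phi' G'.
  split=> // q [Uq Aq]; split.
    move=> [Sq hq] i; rewrite leq_eqVlt => /orP[/eqP/val_inj<-|ki].
      by rewrite Phi'k.
    by rewrite Phi'i//; exact: (hS q Uq).1.
  move=> h0; split; last by rewrite /= -(Phi'k q Uq) h0.
  by apply/(hS q Uq) => i ki; rewrite -Phi'i// h0// ltnW.
exists U', Phi', G'; split=> // Y tY dY.
apply/(tangent_slice Y sl' U'p) => // i.
have [_ sP' _ _ _] := cC.
rewrite (derive_coord _ _ (sP' p U'p)) leq_eqVlt => /orP[/eqP/val_inj<-|ki].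
  rewrite -[RHS]dY; apply: near_eq_derive.
  have nU : nbhs p U by exact: open_nbhs_nbhs.
  by apply: (@filterS _ (nbhs p) _ U) => // q /Phi'k.
have /(tangent_slice Y sl Up Sp)/(_ i ki) <- := tY.
rewrite (derive_coord _ _ (sP p Up)).
have e : (fun y => Phi' y 0 i) = (fun y => Phi y 0 i) by apply/funext => q; exact: Phi'i.
by rewrite -e.
Qed.

(** Regular level sets inside a submanifold. One tangent vector transversal to the level is enough,
    and the vectors in the kernel of the differential are tangent to the cut. *)
Lemma slice_cut (k : nat) S U Phi G (h : E -> K) p X : (k < n.+1)%N ->
  slice k.+1 S U Phi G -> U p -> S p -> h p = 0 -> smooth_at h p ->
  tangent S p X -> 'D_X h p != 0 ->
  exists U' Phi' G', [/\ slice k (S `&` [set q | h q = 0]) U' Phi' G', U' p &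
    forall Y, tangent S p Y -> 'D_Y h p = 0 -> tangent (S `&` [set q | h q = 0]) p Y].
Proof.
move=> kn sl Up Sp hp sh tX dX; pose k' := Ordinal kn.
have [cP hS] := sl; have [oU sP oPU sG GP] := cP.
have sGp : smooth_at G (Phi p) by apply: sG; exists p.
have shG : smooth_at h (G (Phi p)) by rewrite GP.
have sH : smooth_at (fun u => h (G u)) (Phi p).
  by apply: smooth_at_comp; [exact: has_basis_rV|exact: has_basisK| |].
have hX := (tangent_slice X sl Up Sp).1 tX.
have dE : 'D_('D_X Phi p) (fun u => h (G u)) (Phi p) = 'D_X h p.
  have d := smooth_at_is_derive ('D_X Phi p) sGp.
  have [_ ->] := is_derive_chain (has_basis_rV _) has_basisK d shG.
  by rewrite (chart_tangent X cP Up) GP.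
(* The chart image of [X] only has free components, so a nonzero derivative along it forces a
   nonzero partial derivative along some free coordinate. *)
have [j jk dj] : exists2 j : 'I_n.+1, (j <= k)%N & 'D_(delta_mx 0 j) (fun u => h (G u)) (Phi p) != 0.
  apply/not_exists2P => hj; move/eqP: dX; apply; rewrite -dE.
  have dF := smooth_at_diff (has_basis_rV _) has_basisK sH.
  rewrite (deriveE _ dF) (row_sum_delta ('D_X Phi p)) linear_sum big1// => j _.
  rewrite linearZ/=; have [jk|kj] := leqP j k; last by rewrite hX// scale0r.
  have [//|/negP/negPn/eqP] := hj j.
  by rewrite (deriveE _ dF) => ->; rewrite scaler0.
have sl1 := @slice_swap k.+1 S U Phi G j k' jk (ltnSn k) sl.
apply: (@slice_cut1 k' S U _ _ h p sl1 Up Sp hp sh).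
have s1 : smooth_at (fun u : E => xcol j k' u) (xcol j k' (Phi p)).
  by have [_ s _ _ _] := chart_swap j k'; exact: s.
have xK (u : E) : xcol j k' (xcol j k' u) = u by apply/rowP => l; rewrite !mxE tpermK.
have sH' : smooth_at (fun u => h (G u)) (xcol j k' (xcol j k' (Phi p))) by rewrite xK.
have d := smooth_at_is_derive (delta_mx 0 k') s1.
have [_ e] := is_derive_chain (has_basis_rV _) has_basisK d sH'.
move: e; rewrite xK => e.
have e2 : 'D_(delta_mx 0 k') (fun u : E => xcol j k' u) (xcol j k' (Phi p)) = delta_mx 0 j.
  apply/rowP => i; rewrite (derive_coord _ _ s1).
  have fE : (fun u : E => xcol j k' u 0 i) = (fun u : E => u 0 (tperm j k' i)).
    by apply/funext => u; rewrite mxE.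
  have [_ e3] : is_derive (xcol j k' (Phi p)) (delta_mx 0 k')
      (fun u : E => u 0 (tperm j k' i)) ((delta_mx 0 k' : E) 0 (tperm j k' i)).
    apply: (is_derive_lin (l := coord_rV (tperm j k' i))) => //.
    exact: coord_continuous.
  rewrite fE [LHS]e3.
  by rewrite !mxE/= -(inj_eq (@perm_inj _ (tperm j k')) i j) tpermL.
by rewrite e2 in e; rewrite -[X in X != 0]/('D_(delta_mx 0 k') (fun u => h (G (xcol j k' u))) _) e.
Qed.

End Cut.

(** * Tangent spaces of the space forms and of their hyperplane sections *)

Section TangentSpaces.
Context {K : realType} {n : nat}.
Notation E := 'rV[K]_n.+1.
Implicit Types (S : set E) (p q X Y : E).

Lemma tangent_derive0 (W : normedModType K) S p X (F : E -> W) (w : W) : has_basis W ->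
  smooth_at F p -> tangent S p X -> (\forall q \near p, S q -> F q = w) -> 'D_X F p = 0.
Proof.
move=> hW sF tX nF.
have [c [[e [e0 sc Sc]] c0 <-]] := tangent_ext nF tX.
rewrite derive1E.
have o : open [set t : K | `|t| < e].
  have -> : [set t : K | `|t| < e] = ball (0 : K) e.
    by rewrite -ball_normE; apply/seteqP; split=> t /=; rewrite sub0r normrN.
  exact: ball_open.
have sc0 : smooth_at c 0 by exists [set t : K | `|t| < e]; split=> //=; rewrite normr0.
have sF0 : smooth_at F (c 0) by rewrite c0.
have [_ d] := is_derive_chain (has_basis_rV _) hW (smooth_at_is_derive (1 : K) sc0) sF0.
rewrite -c0 -[LHS]d -[RHS](derive_cst w (0 : K) (1 : K)); apply: near_eq_derive.
have n1 : nbhs (0 : K) [set t : K | `|t| < e] by apply: open_nbhs_nbhs; split=> //=; rewrite normr0.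
by apply: filterS n1 => t; exact: Sc.
Qed.

Lemma derive_mdot nu (V : normedModType K) (F G : V -> E) (x v : V) :
  smooth_at F x -> smooth_at G x -> 'D_v (fun y => mdot nu (F y) (G y)) x =
  mdot nu ('D_v F x) (G x) + mdot nu (F x) ('D_v G x).
Proof.
by move=> sF sG; have [_] := is_derive_mdot nu (smooth_at_is_derive v sF) (smooth_at_is_derive v sG).
Qed.

Lemma derive_idE p X : 'D_X (fun q : E => q) p = X.
Proof. exact: derive_id. Qed.

Lemma derive_cstE (V W : normedModType K) (w : W) (x v : V) : 'D_v (fun=> w) x = 0.
Proof. exact: derive_cst. Qed.

Variables (nu : bool) (C r : K).
Hypotheses (r0 : 0 < r) (hC : C = (-1) ^+ nu / r ^+ 2).
Let C0 : C != 0. Proof. exact: sform_C0 hC. Qed.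

Lemma space_form_near p : space_form n nu C p ->
  \forall q \near p, space_form n nu C q <-> mdot nu q q - C^-1 = 0.
Proof.
move=> [hp p0].
have n1 : nbhs p [set q : E | C < 0 -> 0 < q 0 0].
  have [Cl|Cg] := ltP C 0; last by apply: (@filterS _ (nbhs p) _ setT) => //; exact: filterT.
  have c : {for p, continuous (fun q : E => q 0 0)} by exact: coord_continuous.
  have n2 : nbhs p [set q : E | `|p 0 0 - q 0 0| < p 0 0].
    exact: ((cvgrPdist_lt _ _).1 c _ (p0 Cl)).
  by apply: filterS n2 => q /=; rewrite ltr_distlC subrr => /andP[].
apply: filterS n1 => q hq; split=> [[-> _]|/eqP]; first by rewrite subrr.
by rewrite subr_eq0 => /eqP h; split.
Qed.

(** The whole space is cut by <q,q> = 1/C; the position vector [p] is transversal, the derivative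
    along it being 2/C. The condition on the sheet is open and drops out locally. *)
Lemma space_form_cut p : space_form n nu C p -> (exists U Phi G,
  slice n (space_form n nu C) U Phi G /\ U p) /\
  forall X, tangent (space_form n nu C) p X <-> mdot nu X p = 0.
Proof.
move=> hp; have nS := space_form_near hp.
have sid q : smooth_at (fun q : E => q) q by exact: smooth_at_id.
have sm : smooth_at (fun q : E => mdot nu q q - C^-1) p.
  by apply: smooth_atB; [exact: smooth_at_mdot|exact: smooth_at_cst].
have dm X : 'D_X (fun q : E => mdot nu q q - C^-1) p = 2 * mdot nu X p.
  have sp : smooth_at (fun q : E => mdot nu q q) p by exact: smooth_at_mdot.
  have [_ ->] := is_deriveB (smooth_at_is_derive X sp) (is_derive_cst (C^-1) p X).
  by rewrite (derive_mdot nu X (sid p) (sid p)) derive_idE subr0 [mdot nu p X]mdotC; ring.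
have sl : slice n.+1 (@setT E) setT id id.
  split; first exact: chart_setT.
  by move=> q _; split=> // _ i; rewrite leqNgt ltn_ord.
have tT X : tangent (@setT E) p X.
  by apply/(tangent_slice X sl) => // i; rewrite leqNgt ltn_ord.
have hpp : mdot nu p p - C^-1 = 0 by rewrite hp.1 subrr.
have dp : 'D_p (fun q : E => mdot nu q q - C^-1) p != 0.
  by rewrite dm hp.1 mulf_neq0// ?invr_neq0// pnatr_eq0.
have [U [Phi [G [sl' Up tY]]]] := slice_cut (ltnSn n) sl I I hpp sm (tT p) dp.
split; first apply: (slice_ext sl' Up).
  by apply: filterS nS => q ->; split=> [[]|].
move=> X; split=> [tX|hX].
  have : 'D_X (fun q : E => mdot nu q q - C^-1) p = 0.
    apply: (tangent_derive0 has_basisK sm tX); apply: filterS nS => q h Sq.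
    exact: h.1.
  by rewrite dm => /eqP; rewrite mulf_eq0 pnatr_eq0 => /eqP.
apply: (@tangent_ext _ _ (setT `&` [set q | mdot nu q q - C^-1 = 0])).
  by apply: filterS nS => q h [_ /= hq]; apply/h.
by apply: tY => //; rewrite dm hX mulr0.
Qed.

Definition section (p0 : E) (t : K) : set E :=
  space_form n nu C `&` [set q | mdot nu q p0 = t].

(** The transversal direction is the tangential part p0 - C t p of [p0]. Along it the height has
    derivative <p0,p0> - C t^2, whose vanishing would describe a degenerate section. *)
Lemma section_cut p p0 t : section p0 t p -> mdot nu p0 p0 - C * t ^+ 2 != 0 ->
  (0 < n)%N ->
  (exists U Phi G, slice n.-1 (section p0 t) U Phi G /\ U p) /\
  forall X, mdot nu X p = 0 -> mdot nu X p0 = 0 -> tangent (section p0 t) p X.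
Proof.
move=> [hp hpt] v0 n0; have [[U [Phi [G [sl Up]]]] tS] := space_form_cut hp.
have sid q : smooth_at (fun q : E => q) q by exact: smooth_at_id.
have sl0 : smooth_at (fun q : E => mdot nu q p0) p.
  by apply: smooth_at_mdot => //; exact: smooth_at_cst.
have sm : smooth_at (fun q : E => mdot nu q p0 - t) p.
  by apply: smooth_atB => //; exact: smooth_at_cst.
have dm X : 'D_X (fun q : E => mdot nu q p0 - t) p = mdot nu X p0.
  have [_ ->] := is_deriveB (smooth_at_is_derive X sl0) (is_derive_cst t p X).
  rewrite (derive_mdot nu X (sid p) (smooth_at_cst p0 p)) derive_idE derive_cstE.
  by rewrite mdot0r addr0 subr0.
have hpt' : mdot nu p p0 - t = 0 by rewrite hpt subrr.
have tV : tangent (space_form n nu C) p (p0 - (C * t) *: p).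
  by apply/tS; rewrite !mdot_lin hp.1 mdotC hpt; field; exact: C0.
have dV : 'D_(p0 - (C * t) *: p) (fun q : E => mdot nu q p0 - t) p != 0.
  by rewrite dm !mdot_lin hpt (_ : C * t * t = C * t ^+ 2)//; ring.
have sln : slice n.-1.+1 (space_form n nu C) U Phi G by rewrite (prednK n0).
have nn : (n.-1 < n.+1)%N by rewrite ltnS leq_pred.
have [U' [Phi' [G' [sl' Up' tY]]]] := slice_cut nn sln Up hp hpt' sm tV dV.
have e : space_form n nu C `&` [set q | mdot nu q p0 - t = 0] = section p0 t.
  congr (_ `&` _); apply/seteqP; split=> q /=.
    by move/eqP; rewrite subr_eq0 => /eqP.
  by move=> ->; rewrite subrr.
rewrite e in sl' tY; split; first by exists U', Phi', G'.
by move=> X h1 h2; apply: tY; [exact/tS|rewrite dm].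
Qed.

End TangentSpaces.

(** * Concircular fields *)

(** Two linear equations in at least three unknowns. The weights in the matrix turn its left kernel
    into orthogonality for the indefinite metric. *)
Lemma exists_orthogonal2 (K : realType) (n : nat) (nu : bool) (a b : 'rV[K]_n.+1) :
  (2 <= n)%N -> exists X : 'rV[K]_n.+1, [/\ X != 0, mdot nu X a = 0 & mdot nu X b = 0].
Proof.
move=> n2.
pose A := \matrix_(i < n.+1, j < 2) (weight nu i * (if j == 0 then a else b) 0 i).
have kn : kermx A != 0.
  rewrite -mxrank_eq0 mxrank_ker subn_eq0 -ltnNge.
  by apply: leq_ltn_trans (rank_leq_col A) _; rewrite ltnS.
have XA : nz_row (kermx A) *m A = 0.
  by apply/sub_kermxP; exact: nz_row_sub.
exists (nz_row (kermx A)); split; first by rewrite nz_row_eq0.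
  have /matrixP/(_ 0 0) := XA; rewrite !mxE => <-; rewrite mdotE.
  by apply: eq_bigr => i _; rewrite mxE eqxx; ring.
have /matrixP/(_ 0 1) := XA; rewrite !mxE => <-; rewrite mdotE.
by apply: eq_bigr => i _; rewrite mxE/=; ring.
Qed.

Section ConcircularField.
Context {K : realType} {n : nat} {nu : bool} {C r : K}.
Hypotheses (n2 : (2 <= n)%N) (r0 : 0 < r) (hC : C = (-1) ^+ nu / r ^+ 2).
Notation E := 'rV[K]_n.+1.
Notation M := (space_form n nu C).
Implicit Types (p q X Y x z : E).
Let C0 : C != 0. Proof. exact: sform_C0 hC. Qed.

Lemma space_form_dot p : M p -> mdot nu p p = C^-1. Proof. by case. Qed.

Lemma exists_unit_tangent x Y : M x -> exists X,
  [/\ mdot nu X X = 1, mdot nu X x = 0 & mdot nu X Y = 0].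
Proof.
move=> hx; have [X [X0 Xx XY]] := exists_orthogonal2 nu x Y n2.
have XX := tangent_pos r0 hC (space_form_dot hx) Xx X0.
exists ((Num.sqrt (mdot nu X X))^-1 *: X); split; rewrite !mdot_lin ?Xx ?XY ?mulr0//.
have s0 : Num.sqrt (mdot nu X X) != 0 by rewrite gt_eqF// sqrtr_gt0.
by rewrite -{3}(sqr_sqrtr (ltW XX)); field.
Qed.

Lemma sform_Cinv : C^-1 = (-1) ^+ nu * r ^+ 2.
Proof. by rewrite hC invf_div mulrC; case: (nu); rewrite ?expr1 ?expr0 ?invrN invr1. Qed.

(* The constants come from the 3-4-5 triangle. *)
Lemma exists_point : exists a b : K, [/\ 0 < a, b != 0 &
  forall x X, M x -> mdot nu X X = 1 -> mdot nu X x = 0 -> M (a *: x + b *: X)].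
Proof.
have rn0 : r != 0 by rewrite gt_eqF.
have [hnu|hnu] : nu \/ ~~ nu by case: (nu); [left|right].
  exists (5 / 4), (3 / 4 * r); split; first by rewrite divr_gt0.
    by rewrite !mulf_neq0// invr_neq0.
  move=> x X hx XX Xx; split.
    rewrite !mdot_lin (space_form_dot hx) XX Xx [mdot nu x X]mdotC Xx sform_Cinv.
    by rewrite hnu expr1; field.
  move=> Cl; have x0 := hx.2 Cl; have := sheet_bound r0 hC hnu hx.1 Xx XX.
  rewrite !mxE (_ : 3 / 4 * r * X 0 0 = 3 / 4 * (r * X 0 0)); last by rewrite mulrA.
  move: (r * X 0 0) (x 0 0) x0 => u v v0 uv.
  have : - v < u by rewrite ltNge; apply/negP => h; nra.
  by move: v0; lra.
exists (4 / 5), (3 / 5 * r); split; first by rewrite divr_gt0.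
  by rewrite !mulf_neq0// invr_neq0.
move=> x X hx XX Xx; split.
  rewrite !mdot_lin (space_form_dot hx) XX Xx [mdot nu x X]mdotC Xx sform_Cinv.
  by rewrite (negbTE hnu) expr0; field.
have : 0 < C by rewrite (sform_Cgt0 r0 hC).
by move=> Cp /lt_trans/(_ Cp); rewrite ltxx.
Qed.

Section Field.
Variable V : E -> E.
Hypothesis hV : concircular nu C V.

Lemma concircular_tangent p : M p -> mdot nu (V p) p = 0.
Proof.
move=> hp; have [[_ /(_ p hp) t] _] := hV.
by have [_ h] := space_form_cut r0 hC hp; exact/h.
Qed.

(** The flat derivative of V along [c] is a multiple of the velocity plus a multiple of the
    position; both are orthogonal to [z] because [c] stays in its orthogonal hyperplane. *)
Lemma concircular_curve (c : K -> E) z (t : K) :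
  (\forall s \near t, smooth_at c s /\ M (c s)) -> (forall s, mdot nu z (c s) = 0) ->
  is_derive t 1 (fun s => mdot nu z (V (c s))) 0.
Proof.
move=> nc zc; have [sct hct] := nbhs_singleton nc.
have sVc : smooth_at (fun s => V (c s)) t.
  have [[/(_ _ hct) [U [G [oU Uct sG hG]]] _] _] := hV.
  have sGc : smooth_at (fun s => G (c s)) t.
    apply: smooth_at_comp; [exact: has_basis_rV|exact: has_basis_rV|exact: sct|].
    by exists U.
  apply: smooth_at_eq sGc.
  have nU : nbhs t [set s | U (c s)].
    by apply: (smooth_at_cont sct); exact: open_nbhs_nbhs.
  by move: nc nU; apply: filterS2 => s [_ Ms] Us; exact: hG.
have dVc := smooth_at_is_derive (1 : K) sVc.
have sz : smooth_at (fun=> z) t by exact: smooth_at_cst.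
suff h : mdot nu z ('D_1 (fun s => V (c s)) t) = 0.
  by have := is_derive_mdot nu (is_derive_cst z t (1 : K)) dVc; rewrite mdot0l add0r h.
(* The concircular condition speaks of time 0 only, so the parameter is shifted. *)
pose c1 s := c (s + t); have c10 : c1 0 = c t by rewrite /c1 add0r.
have dc1 (W : normedModType K) (F : K -> W) : smooth_at F t ->
    derive1 (fun s => F (s + t)) 0 = 'D_1 F t.
  move=> sF; rewrite derive1E; have := smooth_at_is_derive (1 : K) sF.
  by rewrite -{1}[t]add0r => /is_derive_translate[_ ->].
have cc : curve_in M c1.
  have /nbhs_normP[e /= e0 he] := nc.
  exists e; split=> // [|s se]; last first.
    by apply: (he _ _).2; rewrite /= opprD addrCA subrr addr0 normrN.
  apply/smooth_onP.
    have -> : [set s : K | `|s| < e] = ball (0 : K) e.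
      by rewrite -ball_normE; apply/seteqP; split=> s /=; rewrite sub0r normrN.
    exact: ball_open.
  move=> s /= se; apply: (@smooth_at_comp _ _ _ _ (fun s => s + t) c).
  - exact: has_basisK.
  - exact: has_basis_rV.
  - by apply: smooth_atD; [exact: smooth_at_id|exact: smooth_at_cst].
  - by apply: (he _ _).1; rewrite /= opprD addrCA subrr addr0 normrN.
have [_ [mu [_ /(_ c1 cc)]]] := hV.
rewrite /covder /tproj c10 (dc1 _ _ sct).
rewrite [derive1 _ 0](dc1 _ _ sVc) => /eqP; rewrite subr_eq => /eqP ->.
have zdc : mdot nu z ('D_1 c t) = 0.
  have := derive_mdot nu (1 : K) sz sct; rewrite derive_cstE mdot0l add0r => <-.
  by under eq_fun do rewrite zc; exact: derive_cst.
by rewrite !mdot_lin zdc zc !mulr0 addr0.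
Qed.

(** The segment from [p] to [q] is projected radially to the space form, giving a curve in the plane
    of [p] and [q]. Positivity of C <p,q> keeps [w], which is C <m,m>, positive on the segment, so
    the projection is defined. *)
Lemma concircular_chord p q z : M p -> M q -> 0 < C * mdot nu p q ->
  mdot nu z p = 0 -> mdot nu z q = 0 -> mdot nu z (V q) = mdot nu z (V p).
Proof.
move=> hp hq pq zp zq; pose m (t : K) : E := p + t *: (q - p).
pose w (t : K) := C * mdot nu (m t) (m t).
have sm t : smooth_at m t.
  apply: smooth_atD; first exact: smooth_at_cst.
  by apply: smooth_atZ; [exact: smooth_at_id|exact: smooth_at_cst].
have sw t : smooth_at w t.
  by apply: smooth_atM; [exact: smooth_at_cst|exact: smooth_at_mdot].
pose c (t : K) : E := (Num.sqrt (w t))^-1 *: m t.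
have sc t : 0 < w t -> smooth_at c t.
  move=> wt; apply: smooth_atZ => //; apply: smooth_at_inv; last by rewrite gt_eqF// sqrtr_gt0.
  exact: smooth_at_sqrt.
have wE t : w t = (1 - t) ^+ 2 + t ^+ 2 + 2 * t * (1 - t) * (C * mdot nu p q).
  rewrite /w /m !mdot_lin (space_form_dot hp) (space_form_dot hq) [mdot nu q p]mdotC.
  by field; exact: C0.
have w01 (t : K) : 0 <= t <= 1 -> 0 < w t.
  move=> /andP[t0 t1]; rewrite wE ltr_pwDl//; last first.
    by apply: mulr_ge0; rewrite ?(ltW pq)// !mulr_ge0 ?subr_ge0.
  by have [->|tn] := eqVneq t 0; [rewrite subr0 expr0n addr0 expr1n|
    rewrite ltr_wpDl ?sqr_ge0// exprn_even_gt0].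
have m01 (t : K) : 0 <= t <= 1 -> C < 0 -> 0 < m t 0 0.
  move=> /andP[t0 t1] Cl; have p0 := hp.2 Cl; have q0 := hq.2 Cl.
  rewrite /m !mxE; have -> : p 0 0 + t * (q 0 0 - p 0 0) = (1 - t) * p 0 0 + t * q 0 0 by ring.
  have [->|tn] := eqVneq t 0; first by rewrite subr0 mul0r addr0 mul1r.
  by rewrite ltr_wpDl ?mulr_ge0 ?subr_ge0 ?(ltW p0)// mulr_gt0// lt_neqAle eq_sym tn.
have hc t : 0 < w t -> (C < 0 -> 0 < m t 0 0) -> M (c t).
  move=> wt mt; split; last by move=> /mt h; rewrite /c mxE mulr_gt0// invr_gt0 sqrtr_gt0.
  have s0 : Num.sqrt (w t) != 0 by rewrite gt_eqF// sqrtr_gt0.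
  rewrite /c mdotZl mdotZr; apply: (mulfI C0); rewrite divff// mulrCA [C * _]mulrCA -/(w t).
  by rewrite -[X in _ * (_ * X)](sqr_sqrtr (ltW wt)); field.
have near01 (t : K) : 0 <= t <= 1 -> \forall s \near t, smooth_at c s /\ M (c s).
  move=> ht.
  have k1 : nbhs t [set s | 0 < w s].
    have nh : nbhs t [set s | `|w t - w s| < w t].
      exact: ((cvgrPdist_lt _ _).1 (smooth_at_cont (sw t)) _ (w01 t ht)).
    by apply: filterS nh => s /=; rewrite ltr_distlC subrr => /andP[].
  have k2 : nbhs t [set s | C < 0 -> 0 < m s 0 0].
    have [Cl|Cg] := ltP C 0; last by apply: (@filterS _ (nbhs t) _ setT) => //; exact: filterT.
    have cm := smooth_at_cont (smooth_at_coord 0 (sm t)).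
    have nh : nbhs t [set s | `|m t 0 0 - m s 0 0| < m t 0 0].
      exact: ((cvgrPdist_lt _ _).1 cm _ (m01 t ht Cl)).
    by apply: filterS nh => s /=; rewrite ltr_distlC subrr => /andP[].
  by move: k1 k2; apply: filterS2 => s h1 h2; split; [exact: sc|exact: hc].
have zc s : mdot nu z (c s) = 0 by rewrite /c /m !mdot_lin zp zq subrr mulr0 addr0 mulr0.
have dphi (t : K) : 0 <= t <= 1 -> is_derive t 1 (fun s => mdot nu z (V (c s))) 0.
  by move=> ht; apply: concircular_curve => //; exact: near01.
have dphi' (t : K) : 0 <= t <= 1 -> derivable (fun s => mdot nu z (V (c s))) (0 + t *: 1) 1.
  by move=> ht; rewrite add0r [_%:A]mulr1; have [] := dphi t ht.
have [t t01] := MVT_dir dphi'.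
have tE : 0 + t *: 1 = t :> K by rewrite add0r [_%:A]mulr1.
rewrite tE; have [_ ->] := dphi t t01.
have c0E : c 0 = p.
  by rewrite /c wE /m subr0 expr1n expr0n/= mulr0 !mul0r !addr0 sqrtr1 invr1 !scale0r scale1r addr0.
have c1E : c 1 = q.
  rewrite /c wE /m subrr expr1n expr0n/= mulr0 mul0r addr0 add0r sqrtr1 invr1 !scale1r.
  by rewrite addrC subrK.
by rewrite add0r c0E c1E => /eqP; rewrite subr_eq0 => /eqP.
Qed.

(** Removing from V q - V p its components in the plane of [p] and [q] leaves a vector orthogonal to
    that plane, hence orthogonal to V q - V p by the previous lemma, hence to itself; definiteness
    on the tangent space at [p] makes it zero. *)
Lemma concircular_span p q : M p -> M q -> 0 < C * mdot nu p q ->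
  exists a b : K, V q - V p = a *: p + b *: q.
Proof.
move=> hp hq pq; have Epp := space_form_dot hp.
pose d := V q - V p; have dE : d = V q - V p by []; clearbody d.
pose X := q - (C * mdot nu q p) *: p.
have XE : q = X + (C * mdot nu q p) *: p by rewrite /X subrK.
have Xp : mdot nu X p = 0 by rewrite /X !mdot_lin Epp; field; exact: C0.
clearbody X; pose k := mdot nu d X / mdot nu X X.
pose d' := d - (C * mdot nu d p) *: p - k *: X.
have d'E : d' = d - (C * mdot nu d p) *: p - k *: X by []; clearbody d'.
have d'p : mdot nu d' p = 0.
  by rewrite d'E !mdot_lin Epp Xp; field; exact: C0.
have d'X : mdot nu d' X = 0.
  rewrite d'E !mdot_lin [mdot nu p X]mdotC Xp mulr0 subr0.
  have [->|X0] := eqVneq X 0; first by rewrite !mdot0r mulr0 subrr.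
  have XX := tangent_pos r0 hC Epp Xp X0.
  by rewrite /k divfK ?subrr// gt_eqF.
have d'q : mdot nu d' q = 0 by rewrite XE !mdot_lin d'X d'p mulr0 addr0.
have dd : mdot nu d' d = 0.
  by rewrite dE !mdot_lin (concircular_chord hp hq pq d'p d'q) subrr.
have d'0 : d' = 0.
  apply/eqP/negPn/negP => d'n0.
  have := tangent_pos r0 hC Epp d'p d'n0.
  by rewrite {2}d'E !mdot_lin dd d'p d'X !mulr0 !subr0 ltxx.
rewrite -dE; exists (C * mdot nu d p - k * (C * mdot nu q p)), k.
move: d'E; rewrite d'0 => /esym/eqP; rewrite subr_eq0 subr_eq => /eqP dq.
rewrite [LHS]dq [in k *: q]XE scalerDr scalerA scalerBl [RHS]addrC -[RHS]addrA.
by congr (_ + _); rewrite addrC subrK.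
Qed.

(** V q - p0 lies in the span of [p1] and [q] and also in the span of [p2] and [q]. For [q] outside
    the plane of [p1] and [p2] these meet in the line of [q], and tangency of V q determines the
    coefficient. *)
Lemma concircular_local x : M x -> exists p0, \forall q \near x, M q ->
  V q = p0 - (C * mdot nu q p0) *: q.
Proof.
move=> hx; have [a [b [a0 b0 hab]]] := exists_point.
have [X1 [X11 X1x _]] := exists_unit_tangent x hx.
have [X2 [X22 X2x X21]] := exists_unit_tangent X1 hx.
have X12 : mdot nu X1 X2 = 0 by rewrite mdotC.
pose p1 := a *: x + b *: X1; pose p2 := a *: x + b *: X2.
have M1 : M p1 by exact: hab. have M2 : M p2 by exact: hab.
have xx := space_form_dot hx.
have p1x : mdot nu p1 x = a / C by rewrite /p1 !mdot_lin X1x xx mulr0 addr0.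
have p2x : mdot nu p2 x = a / C by rewrite /p2 !mdot_lin X2x xx mulr0 addr0.
have p12 : mdot nu p1 p2 = a ^+ 2 / C.
  by rewrite /p1 /p2 !mdot_lin [mdot nu x X2]mdotC X2x X12 X1x xx; ring.
(* A covector separating the plane of [p1] and [p2] from [x]: the coefficient of [x] makes it
   orthogonal to both points, while its product with [x] is - b / a. *)
pose z1 := (- (b * C / a)) *: x + X1 + X2.
have an0 : a != 0 by rewrite gt_eqF.
have z1p1 : mdot nu z1 p1 = 0.
  rewrite /z1 /p1 !mdot_lin X21 X2x X1x X11 xx [mdot nu x X1]mdotC X1x; field.
  by rewrite an0 C0.
have z1p2 : mdot nu z1 p2 = 0.
  rewrite /z1 /p2 !mdot_lin X12 X2x X1x X22 xx [mdot nu x X2]mdotC X2x; field.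
  by rewrite an0 C0.
have z1x : mdot nu z1 x != 0.
  rewrite /z1 !mdot_lin xx X1x X2x !addr0 (_ : - (b * C / a) / C = - (b / a)).
    by rewrite oppr_eq0 mulf_neq0// invr_neq0.
  by field; rewrite an0 C0.
have X1p1 : mdot nu X1 p1 = b by rewrite /p1 !mdot_lin X1x X11; ring.
have X1p2 : mdot nu X1 p2 = 0 by rewrite /p2 !mdot_lin X1x X12; ring.
clearbody p1 p2 z1.
have Cp21 : 0 < C * mdot nu p2 p1.
  by rewrite mdotC p12 mulrC divfK// exprn_gt0.
have [b1 [a1 e12]] := concircular_span M2 M1 Cp21.
(* The relation V p1 - V p2 = b1 p2 + a1 p1 is split so that [p0] is reached from [p1] and from [p2]
   alike. *)
pose p0 := V p1 - a1 *: p1.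
have p0E2 : p0 = V p2 + b1 *: p2.
  by rewrite /p0 -[V p1](subrK (V p2)) e12 [_ + _ + V p2]addrAC addrK addrC.
exists p0.
have sd y z : smooth_at (fun q : E => mdot nu y q) z.
  by apply: smooth_at_mdot; [exact: smooth_at_cst|exact: smooth_at_id].
have npos p : 0 < C * mdot nu p x -> nbhs x [set q | 0 < C * mdot nu p q].
  move=> px; have s : smooth_at (fun q : E => C * mdot nu p q) x.
    by apply: smooth_atM; [exact: smooth_at_cst|exact: sd].
  have nh : nbhs x [set q | `|C * mdot nu p x - C * mdot nu p q| < C * mdot nu p x].
    exact: ((cvgrPdist_lt _ _).1 (smooth_at_cont s) _ px).
  by apply: filterS nh => q /=; rewrite ltr_distlC subrr => /andP[].
have k1 := npos p1 _; have k2 := npos p2 _.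
have k3 : nbhs x [set q | mdot nu z1 q != 0].
  exact: (smooth_at_cont (sd z1 x) (open_nbhs_nbhs (conj (@open_neq _ 0) z1x))).
have {}k1 := k1 _; have {}k2 := k2 _.
near=> q => hq.
have h1 : 0 < C * mdot nu p1 q.
  by near: q; apply: k1; rewrite p1x mulrC divfK.
have h2 : 0 < C * mdot nu p2 q.
  by near: q; apply: k2; rewrite p2x mulrC divfK.
have h3 : mdot nu z1 q != 0 by near: q.
have [c1 [d1 e1]] := concircular_span M1 hq h1.
have [c2 [d2 e2]] := concircular_span M2 hq h2.
have f1 : V q - p0 = (c1 + a1) *: p1 + d1 *: q.
  by rewrite /p0 opprB addrCA e1 addrA -scalerDl [a1 + c1]addrC.
have f2 : V q - p0 = (c2 - b1) *: p2 + d2 *: q.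
  by rewrite p0E2 opprD addrA e2 addrAC -scalerBl.
have dd : d1 = d2.
  have := congr1 (mdot nu z1) f1; rewrite f2 !mdot_lin z1p1 z1p2 !mulr0 !add0r.
  by move=> /(mulIf h3).
have c0 : c1 + a1 = 0.
  have := f1; rewrite f2 dd => /addIr /(congr1 (mdot nu X1)).
  rewrite !mdot_lin X1p1 X1p2 mulr0 => /esym/eqP; rewrite mulf_eq0 (negbTE b0) orbF.
  by move/eqP.
clearbody p0; move: f1; rewrite c0 scale0r add0r => /eqP; rewrite subr_eq => /eqP Vq.
have := concircular_tangent hq; rewrite Vq !mdot_lin (space_form_dot hq) => h.
suff -> : d1 = - (C * mdot nu q p0) by rewrite scaleNr [LHS]addrC.
have -> : d1 = C * (d1 / C) by rewrite mulrC divfK.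
by move/eqP: h; rewrite addr_eq0 => /eqP ->; rewrite mulrN [mdot nu p0 q]mdotC.
Unshelve. all: by end_near. Qed.

End Field.
End ConcircularField.

(** * The tangential part of the axis *)

Lemma chart_sym (K : realType) (n : nat) (U : set 'rV[K]_n.+1) Phi G :
  chart U Phi G -> chart (Phi @` U) G Phi.
Proof.
move=> [oU sP oPU sG GP].
have e : G @` (Phi @` U) = U.
  apply/seteqP; split=> [_ [_ [q Uq <-] <-]|q Uq]; first by rewrite GP.
  by exists (Phi q); [exists q|rewrite GP].
split=> //; first by rewrite e.
  by rewrite e.
by move=> _ [q Uq <-]; rewrite GP.
Qed.

Lemma derive_line0 (K : realType) (V W : normedModType K) (F : V -> W) (x v : V) :
  (\forall s \near (0 : K), F (s *: v + x) = 0) -> 'D_v F x = 0.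
Proof.
move=> h; rewrite derive_line -[RHS](derive_cst (0 : W) (0 : K) (1 : K)).
exact: near_eq_derive.
Qed.

Lemma tangent_sub (K : realType) (n : nat) (S S' : set 'rV[K]_n.+1) p X :
  S `<=` S' -> tangent S p X -> tangent S' p X.
Proof.
move=> sS [c [[e [e0 sc Sc]] c0 cX]]; exists c; split=> //; exists e; split=> //.
by move=> t /Sc/sS.
Qed.

Lemma cramer2 (K : fieldType) (x y a b c d : K) : x * a + y * b = 0 ->
  x * c + y * d = 0 -> a * d - b * c != 0 -> x = 0 /\ y = 0.
Proof.
move=> e1 e2 det; split; apply: (mulIf det); rewrite mul0r.
  have -> : x * (a * d - b * c) = (x * a + y * b) * d - (x * c + y * d) * b by ring.
  by rewrite e1 e2 !mul0r subrr.
have -> : y * (a * d - b * c) = (x * c + y * d) * a - (x * a + y * b) * c by ring.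
by rewrite e1 e2 !mul0r subrr.
Qed.

Lemma sum_eq2 (V : nmodType) (I : finType) (a b : I) (F : I -> V) : a != b ->
  (forall i, i != a -> i != b -> F i = 0) -> \sum_i F i = F a + F b.
Proof.
move=> ab F0; rewrite (bigD1 a)//= (bigD1 b) 1?eq_sym//= big1 ?addr0//.
by move=> i /andP[]; exact: F0.
Qed.

Section LocalGeometry.
Context {K : realType} {n : nat} {nu : bool} {C r : K}.
Hypotheses (n2 : (2 <= n)%N) (r0 : 0 < r) (hC : C = (-1) ^+ nu / r ^+ 2).
Notation E := 'rV[K]_n.+1.
Notation MC := (space_form n nu C).
Implicit Types (p q X Y x z : E).
Let C0 : C != 0. Proof. exact: sform_C0 hC. Qed.

Variables (M U : set E) (Phi G Nh : E -> E) (p0 : E) (lam : K).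
Hypothesis slM : slice n.-1 M U Phi G.
Hypothesis MMC : M `<=` MC.
Hypothesis sNh : forall q, U q -> smooth_at Nh q.
Hypothesis Nh1 : forall q, M q -> U q -> mdot nu (Nh q) (Nh q) = 1.
Hypothesis Nhq : forall q, M q -> U q -> mdot nu (Nh q) q = 0.
Hypothesis NhT : forall q X, M q -> U q -> tangent M q X -> mdot nu (Nh q) X = 0.
Hypothesis Nhp0 : forall q, M q -> U q -> mdot nu (Nh q) p0 = lam.

Let h q := mdot nu q p0.
Let S2 q := mdot nu p0 p0 - lam ^+ 2 - C * h q ^+ 2.
Hypothesis S2_gt0 : forall q, U q -> 0 < S2 q.

Definition speed q := Num.sqrt (S2 q).
(** On M this is the tangential part of the axis. Using [Nh] in place of the normal defines it on an
    open set; its length on M is [speed], a function of the height alone. *)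
Definition Tfield q := p0 - (C * h q) *: q - lam *: Nh q.
Definition Wfield q := (speed q)^-1 *: Tfield q.

Let sid q : smooth_at (fun q : E => q) q. Proof. exact: smooth_at_id. Qed.

Lemma smooth_height q : smooth_at h q.
Proof. by apply: smooth_at_mdot => //; exact: smooth_at_cst. Qed.

Lemma smooth_S2 q : smooth_at S2 q.
Proof.
apply: smooth_atB; first exact: smooth_at_cst.
apply: smooth_atM; first exact: smooth_at_cst.
by under eq_fun do rewrite expr2; apply: smooth_atM; exact: smooth_height.
Qed.

Lemma speed_gt0 q : U q -> 0 < speed q.
Proof. by move=> Uq; rewrite sqrtr_gt0 S2_gt0. Qed.

Lemma speed_neq0 q : U q -> speed q != 0.
Proof. by move=> Uq; rewrite gt_eqF ?speed_gt0. Qed.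

Lemma sqr_speed q : U q -> speed q ^+ 2 = S2 q.
Proof. by move=> Uq; rewrite sqr_sqrtr// ltW ?S2_gt0. Qed.

Lemma smooth_speed q : U q -> smooth_at speed q.
Proof. by move=> Uq; apply: smooth_at_sqrt; [exact: smooth_S2|exact: S2_gt0]. Qed.

Lemma smooth_Tfield q : U q -> smooth_at Tfield q.
Proof.
move=> Uq; apply: smooth_atB; last first.
  by apply: smooth_atZ; [exact: smooth_at_cst|exact: sNh].
apply: smooth_atB; first exact: smooth_at_cst.
apply: smooth_atZ => //; apply: smooth_atM; first exact: smooth_at_cst.
exact: smooth_height.
Qed.

Lemma smooth_Wfield q : U q -> smooth_at Wfield q.
Proof.
move=> Uq; apply: smooth_atZ; last exact: smooth_Tfield.
by apply: smooth_at_inv; [exact: smooth_speed|exact: speed_neq0].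
Qed.

Section AtPoint.
Variable q : E.
Hypotheses (Mq : M q) (Uq : U q).
Let qq : mdot nu q q = C^-1. Proof. by case: (MMC Mq). Qed.

(* On the tangent space of [M] both [mdot nu q] and [mdot nu (Nh q)] vanish, so
   they are combinations of the last two components of the derivative of the
   chart; the 2 x 2 matrix of coefficients is invertible because [q] and
   [Nh q] are independent. *)
Lemma tangent_hypersurface X : tangent M q X <-> mdot nu X q = 0 /\ mdot nu X (Nh q) = 0.
Proof.
split=> [tX|[Xq XN]].
  split; last by rewrite mdotC NhT.
  have [_ tS] := space_form_cut r0 hC (MMC Mq); apply/tS.
  exact: tangent_sub MMC tX.
have [cP hS] := slM; have cPs := chart_sym cP.
have PU : (Phi @` U) (Phi q) by exists q.
have [_ sP _ sG GP] := cP.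
have sGq := sG _ PU.
have n0 : (0 < n)%N by exact: ltnW.
apply/(tangent_slice X slM Uq Mq).
pose a : 'I_n.+1 := inord n.-1; pose b : 'I_n.+1 := ord_max.
have aE : a = n.-1 :> nat by rewrite /a inordK// ltnS leq_pred.
have bE : b = n :> nat by [].
have ab : a != b by rewrite -val_eqE/= aE neq_ltn prednK ?leqnn.
pose e (i : 'I_n.+1) : E := 'D_(delta_mx 0 i) G (Phi q).
have te (i : 'I_n.+1) : (i < n.-1)%N -> tangent M q (e i).
  move=> ilt; apply/(tangent_slice _ slM Uq Mq) => j nj.
  have := chart_tangent (delta_mx 0 i) cPs PU; rewrite GP// => ->.
  rewrite mxE eqxx/= (_ : j == i = false)//.
  by apply: contraTF nj => /eqP ->; rewrite -ltnNge.
pose f (i : 'I_n.+1) (Y : E) : K := ('D_Y Phi q) 0 i.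
have expand Y z : (forall i : 'I_n.+1, (i < n.-1)%N -> mdot nu (e i) z = 0) ->
    mdot nu Y z = f a Y * mdot nu (e a) z + f b Y * mdot nu (e b) z.
  move=> hz; rewrite -{1}(chart_tangent Y cP Uq).
  have dG := smooth_at_diff (has_basis_rV _) (has_basis_rV _) sGq.
  rewrite (deriveE _ dG) (row_sum_delta ('D_Y Phi q)) linear_sum.
  have -> : mdot nu (\sum_i 'd G (Phi q) (('D_Y Phi q) 0 i *: delta_mx 0 i)) z =
      \sum_i f i Y * mdot nu (e i) z.
    elim/big_rec2 : _ => [|i u v _ <-]; first by rewrite mdot0l.
    by rewrite mdotDl linearZ/= mdotZl /e (deriveE _ dG).
  apply: (sum_eq2 (F := fun i => f i Y * mdot nu (e i) z) ab) => i ia ib.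
  rewrite hz ?mulr0//; move: ia ib; rewrite -!val_eqE/= aE => ia ib.
  have := ltn_ord i; rewrite ltnS leq_eqVlt (negbTE ib)/= => iltn.
  by rewrite ltn_neqAle ia -ltnS prednK.
have eq0 (i : 'I_n.+1) : (i < n.-1)%N -> mdot nu (e i) q = 0.
  move=> /te te'; have [_ tS] := space_form_cut r0 hC (MMC Mq); apply/tS.
  exact: tangent_sub MMC te'.
have eN0 (i : 'I_n.+1) : (i < n.-1)%N -> mdot nu (e i) (Nh q) = 0.
  by move=> /te te'; rewrite mdotC NhT.
pose al := mdot nu (e a) q; pose be := mdot nu (e b) q.
pose ga := mdot nu (e a) (Nh q); pose de := mdot nu (e b) (Nh q).
have Eq Y : mdot nu Y q = f a Y * al + f b Y * be := expand Y q eq0.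
have EN Y : mdot nu Y (Nh q) = f a Y * ga + f b Y * de := expand Y (Nh q) eN0.
(* The forms <., q> and <., Nh q> are independent, tested on [Nh q] and on [q]; a singular matrix of
   coefficients would contradict this. *)
have indep s t : (forall Y, s * mdot nu Y q + t * mdot nu Y (Nh q) = 0) -> s = 0 /\ t = 0.
  move=> hst; have := hst (Nh q); rewrite Nh1// Nhq// mulr0 add0r mulr1 => t0.
  have := hst q; rewrite t0 mul0r addr0 qq => /eqP.
  by rewrite mulf_eq0 invr_eq0 (negbTE C0) orbF => /eqP.
have det : al * de - be * ga != 0.
  apply/negP => /eqP d0.
  have [ga0 /eqP] : ga = 0 /\ - al = 0.
    apply: indep => Y; rewrite Eq EN.
    have -> : ga * (f a Y * al + f b Y * be) + - al * (f a Y * ga + f b Y * de) =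
      - f b Y * (al * de - be * ga) by ring.
    by rewrite d0 mulr0.
  rewrite oppr_eq0 => /eqP al0.
  have [_ /eqP] : de = 0 /\ - be = 0.
    apply: indep => Y; rewrite Eq EN.
    have -> : de * (f a Y * al + f b Y * be) + - be * (f a Y * ga + f b Y * de) =
      f a Y * (al * de - be * ga) by ring.
    by rewrite d0 mulr0.
  rewrite oppr_eq0 => /eqP be0.
  have := Eq q; rewrite al0 be0 !mulr0 addr0 qq => /eqP.
  by rewrite invr_eq0 (negbTE C0).
have [fa fb] := cramer2 (etrans (esym (Eq X)) Xq) (etrans (esym (EN X)) XN) det.
move=> i; rewrite leq_eqVlt => /orP[/eqP ia|].
  have -> : i = a by apply: val_inj; rewrite /= -ia aE.
  exact: fa.
rewrite prednK// => ni.
have -> : i = b by apply: val_inj; apply/eqP; rewrite /= eqn_leq ni -ltnS ltn_ord.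
exact: fb.
Qed.

(** In chart coordinates both sides equal minus the product of the normal with a second derivative
    of the parametrization [G], by differentiating <N, D_b G> = 0 along the slice; second
    derivatives commute. *)
Lemma shape_symmetric X Y : tangent M q X -> tangent M q Y ->
  mdot nu ('D_X Nh q) Y = mdot nu ('D_Y Nh q) X.
Proof.
have [cP hS] := slM; have cPs := chart_sym cP; have [oU sP oPU sG GP] := cP.
have PU : (Phi @` U) (Phi q) by exists q.
have sGq := sG _ PU.
suff half X' Y' : tangent M q X' -> tangent M q Y' -> mdot nu ('D_X' Nh q) Y' =
    - mdot nu (Nh q) ('D_('D_X' Phi q) ('D_('D_Y' Phi q) G) (Phi q)).
  move=> tX tY; have eX := half _ _ tX tY; have eY := half _ _ tY tX.
  have e := schwarz_rV ('D_X Phi q) ('D_Y Phi q) sGq.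
  exact: etrans eX (etrans (congr1 (fun v => - mdot nu (Nh q) v) e) (esym eY)).
move=> tX tY; set a := 'D_X' Phi q; set b := 'D_Y' Phi q.
have ha := (tangent_slice X' slM Uq Mq).1 tX.
have hb := (tangent_slice Y' slM Uq Mq).1 tY.
have sNG : smooth_at (fun u => Nh (G u)) (Phi q).
  apply: smooth_at_comp; [exact: has_basis_rV|exact: has_basis_rV|exact: sGq|].
  by rewrite GP//; exact: sNh.
have sDG : smooth_at ('D_b G) (Phi q) by exact: smooth_at_derive.
(* The line in the direction [a] stays in the slice, since the components of [a] vanish there; so
   the function differentiated is zero near 0 on that line. *)
have d0 : 'D_a (fun u => mdot nu (Nh (G u)) ('D_b G u)) (Phi q) = 0.
  apply: derive_line0.
  have cl : {for (0 : K), continuous (fun s : K => s *: a + Phi q)}.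
    by apply: cvgD; [exact: scalel_continuous|exact: cvg_cst].
  have nP : nbhs (0 : K) [set s : K | (Phi @` U) (s *: a + Phi q)].
    by apply: cl; rewrite scale0r add0r; exact: open_nbhs_nbhs.
  apply: filterS nP => s [p Up pE]; rewrite -pE GP//.
  have Mp : M p.
    apply/(hS p Up) => i ki; rewrite pE !mxE ha// mulr0 add0r.
    exact: (hS q Uq).1.
  apply: NhT => //; apply/(tangent_slice _ slM Up Mp) => i ki.
  have PUp : (Phi @` U) (Phi p) by exists p.
  by have := chart_tangent b cPs PUp; rewrite GP// => ->; exact: hb.
have sNGq : smooth_at Nh (G (Phi q)) by rewrite GP//; exact: sNh.
have dG := smooth_at_is_derive a sGq.
have [_ dN] := is_derive_chain (has_basis_rV _) (has_basis_rV _) dG sNGq.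
have e1 : 'D_a (fun u => Nh (G u)) (Phi q) = 'D_X' Nh q.
  by apply: (etrans dN); rewrite (chart_tangent X' cP Uq) GP.
have e2 : 'D_b G (Phi q) = Y' by exact: (chart_tangent Y' cP Uq).
have e3 : Nh (G (Phi q)) = Nh q by rewrite GP.
pose f (u v w : E) := mdot nu u v + mdot nu w ('D_a ('D_b G) (Phi q)).
have E0 := etrans (f_equal3 f (esym e1) (esym e2) (esym e3))
  (etrans (esym (derive_mdot nu a sNG sDG)) d0).
by apply/eqP; rewrite -addr_eq0; apply/eqP.
Qed.

Let Sn0 := speed_neq0 Uq.
Let SS := sqr_speed Uq.
Let qh : mdot nu q p0 = h q. Proof. by []. Qed.
Let pq : mdot nu p0 q = h q. Proof. exact: mdotC. Qed.
Let Np0 : mdot nu (Nh q) p0 = lam. Proof. exact: Nhp0. Qed.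
Let NN1 : mdot nu (Nh q) (Nh q) = 1. Proof. exact: Nh1. Qed.
Let Nq0 : mdot nu (Nh q) q = 0. Proof. exact: Nhq. Qed.

Lemma Wfield_scale : speed q *: Wfield q = Tfield q.
Proof. by rewrite /Wfield scalerA divff// scale1r. Qed.

Lemma Wfield_q : mdot nu (Wfield q) q = 0.
Proof.
rewrite /Wfield mdotZl /Tfield !mdot_lin qq pq Nq0; field.
by rewrite Sn0 C0.
Qed.

Lemma Wfield_N : mdot nu (Wfield q) (Nh q) = 0.
Proof.
rewrite /Wfield mdotZl /Tfield !mdot_lin NN1 [mdot nu q _]mdotC Nq0 [mdot nu p0 _]mdotC Np0.
by ring.
Qed.

Lemma Wfield_p0 : mdot nu (Wfield q) p0 = speed q.
Proof.
rewrite /Wfield mdotZl /Tfield !mdot_lin qh Np0.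
apply: (mulfI Sn0); rewrite mulrA divff// mul1r -[RHS]expr2 SS /S2; ring.
Qed.

Lemma Wfield_unit : mdot nu (Wfield q) (Wfield q) = 1.
Proof.
apply: (mulfI Sn0); rewrite -mdotZr Wfield_scale /Tfield mdotDr mdotDr !mdotNr !mdotZr.
by rewrite Wfield_q Wfield_N Wfield_p0; ring.
Qed.

Lemma Wfield_tangent : tangent M q (Wfield q).
Proof. by apply/tangent_hypersurface; rewrite Wfield_q Wfield_N. Qed.

Let nearMU (W : normedModType K) (F F' : E -> W) :
  (forall p, M p -> U p -> F p = F' p) -> \forall p \near q, M p -> F p = F' p.
Proof.
move=> FF; have [[oU _ _ _ _] _] := slM.
have nU : nbhs q U by exact: open_nbhs_nbhs.
by apply: filterS nU => p Up Mp; exact: FF.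
Qed.

Let dN_normal Y : tangent M q Y -> mdot nu ('D_Y Nh q) (Nh q) = 0.
Proof.
move=> tY; have sN := sNh Uq.
have := tangent_derive0 has_basisK (smooth_at_mdot nu sN sN) tY (nearMU Nh1).
rewrite (derive_mdot nu Y sN sN) [mdot nu (Nh q) _]mdotC -mulr2n => /eqP.
by rewrite mulrn_eq0 => /eqP.
Qed.

Let dN_q Y : tangent M q Y -> mdot nu ('D_Y Nh q) q = 0.
Proof.
move=> tY; have sN := sNh Uq.
have := tangent_derive0 has_basisK (smooth_at_mdot nu sN (sid q)) tY (nearMU Nhq).
by rewrite (derive_mdot nu Y sN (sid q)) derive_idE NhT// addr0.
Qed.

Let dN_W Y : tangent M q Y -> mdot nu ('D_Y Nh q) (Wfield q) = 0.
Proof.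
move=> tY; have sN := sNh Uq; have sc := smooth_at_cst p0 q.
have := tangent_derive0 has_basisK (smooth_at_mdot nu sN sc) tY (nearMU Nhp0).
rewrite (derive_mdot nu Y sN sc) derive_cstE mdot0r addr0 => e.
by rewrite /Wfield mdotZr /Tfield mdotDr mdotDr !mdotNr !mdotZr e dN_q// dN_normal//; ring.
Qed.

(** With Z = D_W N, which is tangent, symmetry gives <Z,Z> = <D_Z N, W>. The latter vanishes because
    D_Z N is orthogonal to p0, q and N, whose span contains W. Definiteness concludes. *)
Lemma derive_normal_W : 'D_(Wfield q) Nh q = 0.
Proof.
have tW := Wfield_tangent; set Z := 'D_(Wfield q) Nh q.
have tZ : tangent M q Z by apply/tangent_hypersurface; rewrite dN_q ?dN_normal.
apply/eqP/negPn/negP => Z0.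
have := tangent_pos r0 hC qq (dN_q tW) Z0.
by rewrite (shape_symmetric tW tZ) dN_W// ltxx.
Qed.

(** The identity speed W = T is differentiated along W. The normal contributes nothing, so D_W T = -
    C h W - C speed q; the formula for speed^2 gives D_W speed = - C h, and the multiples of W
    cancel. *)
Lemma derive_W_W : 'D_(Wfield q) Wfield q = - C *: q.
Proof.
set w := Wfield q; have [[oU _ _ _ _] _] := slM.
have nU : nbhs q U by exact: open_nbhs_nbhs.
have sS := smooth_speed Uq; have sW := smooth_Wfield Uq; have sN := sNh Uq.
have dS := smooth_at_is_derive w sS; have dW := smooth_at_is_derive w sW.
have dN := smooth_at_is_derive w sN; rewrite derive_normal_W in dN.
have dh : is_derive q w h (speed q).
  have := is_derive_mdot nu (is_derive_id q w) (is_derive_cst p0 q w).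
  by rewrite mdot0r addr0 Wfield_p0.
have dCh : is_derive q w (fun p => C * h p) (C * speed q).
  exact: is_deriveZ.
have dT : is_derive q w Tfield (- ((C * h q) *: w + (C * speed q) *: q)).
  have d1 := is_derive_scale dCh (is_derive_id q w).
  have d2 := is_deriveZ lam dN.
  have := is_deriveB (is_deriveB (is_derive_cst p0 q w) d1) d2.
  by rewrite scaler0 subr0 sub0r.
have dSW : is_derive q w Tfield (speed q *: 'D_w Wfield q + 'D_w speed q *: w).
  apply: near_eq_is_derive (is_derive_scale dS dW).
  by apply: filterS nU => p Up; rewrite /Wfield scalerA divff ?scale1r// speed_neq0.
have dSS : is_derive q w (fun p => speed p *: speed p) (speed q *: 'D_w speed q + 'D_w speed q *: speed q).
  exact: is_derive_scale.
have dS2 : is_derive q w (fun p => speed p *: speed p) (- (C * (2 * h q * speed q))).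
  have d1 : is_derive q w (fun p => C * (h p *: h p)) (C * (h q *: speed q + speed q *: h q)).
    apply: is_deriveZ; exact: is_derive_scale.
  have d2 := is_deriveB (is_derive_cst (mdot nu p0 p0 - lam ^+ 2) q w) d1.
  apply: near_eq_is_derive (is_derive_eq d2 _); last first.
    rewrite sub0r; congr (- (C * _)); rewrite -![_ *: _]/(_ * _); ring.
  apply: filterS nU => p Up; rewrite -[RHS]expr2 sqr_speed//.
have eS : 'D_w speed q = - (C * h q).
  have [_ e1] := dSS; have [_ e2] := dS2; move: e1; rewrite e2 -![_ *: _]/(_ * _) => e.
  have n20 : (2 : K) != 0 by rewrite pnatr_eq0.
  apply: (mulfI Sn0); apply: (mulfI n20).
  have -> : 2 * (speed q * 'D_w speed q) = speed q * 'D_w speed q + 'D_w speed q * speed q by ring.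
  by rewrite -e; ring.
have [_ e1] := dT; have [_ e2] := dSW.
have := etrans (esym e2) e1; rewrite eS scaleNr opprD [RHS]addrC => /addIr e.
by apply: (scalerI Sn0); rewrite e scalerA mulrN scaleNr [C * _]mulrC.
Qed.

End AtPoint.
End LocalGeometry.

(** * Gronwall's inequality and the rulings *)

(** The sum of squares [Q] satisfies |Q'| <= k Q. Rescaling time as s t with s in [0,1] treats both
    signs of [t] at once: Q(s t) exp(- k |t| s) has nonpositive derivative and vanishes at s = 0. *)
Lemma gronwall (K : realType) (I : finType) (u : I -> K -> K) (L e : K) :
  0 <= L -> (forall i (t : K), `|t| < e -> derivable (u i) t 1) ->
  (forall i (t : K), `|t| < e -> `|'D_1 (u i) t| <= L * \sum_j `|u j t|) ->
  (forall i, u i 0 = 0) -> forall i (t : K), `|t| < e -> u i t = 0.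
Proof.
move=> L0 du bu u0 i t te.
pose Q (t : K) := \sum_j u j t ^+ 2.
pose Q' (t : K) := \sum_j 2 * (u j t * 'D_1 (u j) t).
have dQ (s : K) : `|s| < e -> is_derive s 1 Q (Q' s).
  move=> se; have h j : is_derive s 1 (fun s => u j s ^+ 2) (2 * (u j s * 'D_1 (u j) s)).
    have d := derivableP (du j s se).
    have := is_deriveM d d; rewrite -![_ *: _]/(_ * _) => dd.
    have -> : (fun s => u j s ^+ 2) = u j * u j by apply/funext => x; rewrite expr2.
    by apply: is_derive_eq dd _; ring.
  rewrite /Q' /Q.
  have -> : (fun t => \sum_j u j t ^+ 2) = \sum_(j < #|I|) (fun s : K => u (enum_val j) s ^+ 2).
    by apply/funext => x; rewrite fct_sumE (reindex (@enum_val I I))//; exact/onW_bij/enum_val_bij.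
  rewrite (reindex (@enum_val I I))/=; last exact/onW_bij/enum_val_bij.
  exact: is_derive_sum.
(* The cardinal comes from Cauchy-Schwarz, used to bound the square of the sum of absolute values by
   [Q]. *)
pose k := 2 * L * #|I|%:R.
have k0 : 0 <= k by rewrite !mulr_ge0.
have bQ (s : K) : `|s| < e -> `|Q' s| <= k * Q s.
  move=> se; set S := \sum_j `|u j s|.
  have S2 : S ^+ 2 <= #|I|%:R * Q s.
    have := cauchy_schwarz (fun=> true) (fun j => `|u j s|) (fun=> 1).
    under eq_bigr do rewrite mulr1; rewrite -/S => /le_trans; apply.
    have -> : \sum_(j : I) 1 ^+ 2 = #|I|%:R :> K.
      by under eq_bigr do rewrite expr1n; rewrite sumr_const.
    have -> : \sum_(j : I) `|u j s| ^+ 2 = Q s.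
      by apply: eq_bigr => j _; rewrite -normrX ger0_norm// sqr_ge0.
    by rewrite mulrC.
  apply: (le_trans (ler_norm_sum _ _ _)).
  apply: (@le_trans _ _ (\sum_j 2 * (`|u j s| * (L * S)))).
    apply: ler_sum => j _; rewrite !normrM ger0_norm// ler_wpM2l// ler_wpM2l//.
    exact: bu.
  rewrite -mulr_sumr -mulr_suml -/S /k.
  have -> : 2 * (S * (L * S)) = (2 * L) * S ^+ 2 by ring.
  by rewrite -[leRHS]mulrA; apply: ler_wpM2l => //; rewrite mulr_ge0.
pose k' := k * `|t|.
pose F (s : K) := Q (s * t) * expR (- k' * s).
have st (s : K) : 0 <= s <= 1 -> `|s * t| < e.
  by move=> /andP[s0 s1]; rewrite normrM ger0_norm// (le_lt_trans _ te)// ler_piMl.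
have dF (s : K) : 0 <= s <= 1 -> is_derive s 1 F
    ((t * Q' (s * t) - k' * Q (s * t)) * expR (- k' * s)).
  move=> hs; have dst : is_derive s 1 (fun s : K => s * t) t.
    have := is_deriveM (is_derive_id s (1 : K)) (is_derive_cst t s (1 : K)).
    by rewrite scaler0 add0r => h; apply: is_derive_eq h _; rewrite [_ *: _]mulr1.
  have d1 : is_derive s 1 (fun s => Q (s * t)) (Q' (s * t) * t).
    exact: (@is_derive1_comp _ Q (fun s : K => s * t) s _ _ (dQ _ (st s hs)) dst).
  have dks : is_derive s 1 (fun s : K => - k' * s) (- k').
    have := is_deriveZ (- k') (is_derive_id s (1 : K)).
    by move=> h; apply: is_derive_eq h _; rewrite [_ *: _]mulr1.
  have d2 : is_derive s 1 (fun s => expR (- k' * s)) (expR (- k' * s) * - k').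
    exact: (@is_derive1_comp _ (@expR K) (fun s : K => - k' * s) s _ _ (is_derive_expR _) dks).
  have := is_deriveM d1 d2 => h; apply: is_derive_eq h _.
  rewrite -![_ *: _]/(_ * _); ring.
have dF' (s : K) : 0 <= s <= 1 -> derivable F (0 + s *: 1) 1.
  by move=> hs; rewrite add0r [_%:A]mulr1; have [] := dF s hs.
have [s s01] := MVT_dir dF'.
have -> : 0 + s *: 1 = s :> K by rewrite add0r [_%:A]mulr1.
have [_ ->] := dF s s01.
rewrite add0r /F mul0r mul1r {2}/Q big1 ?mul0r ?subr0; last by move=> j _; rewrite u0 expr0n.
move=> e1.
have le0 : Q t * expR (- k' * 1) <= 0.
  rewrite e1 mulr_le0_ge0 ?expR_ge0// subr_le0.
  apply: (le_trans (ler_norm _)); rewrite normrM /k' -mulrA mulrC [`|t| * _]mulrC mulrA.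
  by rewrite ler_wpM2r//; exact/bQ/st.
have Qt0 : Q t <= 0.
  by move: le0; rewrite pmulr_lle0 ?expR_gt0.
have Qt : Q t = 0.
  by apply/eqP; rewrite eq_le Qt0 sumr_ge0// => j _; rewrite sqr_ge0.
have hi := psumr_eq0P (fun j _ => sqr_ge0 (u j t)) Qt.
by apply/eqP; rewrite -sqrf_eq0 (hi i).
Qed.

(** * Linear bounds near a submanifold *)

Section Bounds.
Context {K : realType} {n : nat}.
Notation E := 'rV[K]_n.+1.

Lemma derive_expand (m : nat) (F : E -> 'rV[K]_m) (y v : E) : smooth_at F y ->
  'D_v F y = \sum_j v 0 j *: 'D_(delta_mx 0 j) F y.
Proof.
move=> sF; have dF := smooth_at_diff (has_basis_rV _) (has_basis_rV _) sF.
rewrite (deriveE _ dF) {1}(row_sum_delta v) linear_sum; apply: eq_bigr => j _.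
by rewrite linearZ/= (deriveE _ dF).
Qed.

(** The direction varies with the point while smoothness concerns constant directions; expansion in
    the standard basis bridges the two. *)
Lemma smooth_at_derive_field (F X : E -> E) (x : E) : smooth_at F x -> smooth_at X x ->
  smooth_at (fun y => 'D_(X y) F y) x.
Proof.
move=> sF sX.
apply: (@smooth_at_eq _ _ _ (fun y => \sum_j X y 0 j *: 'D_(delta_mx 0 j) F y)).
  by apply: filterS (smooth_at_near sF) => y sFy; rewrite -derive_expand.
apply: smooth_at_sum => j _; apply: smooth_atZ; first exact: smooth_at_coord.
exact: smooth_at_derive.
Qed.

Lemma derive_bound (F : E -> E) (x : E) : smooth_at F x -> exists2 L : K, 0 <= L &
  \forall y \near x, forall v i, `|('D_v F y) 0 i| <= L * \sum_j `|v 0 j|.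
Proof.
move=> sF.
pose B j := `|'D_(delta_mx 0 j) F x| + 1.
have nj (j : 'I_n.+1) : \forall y \near x, `|'D_(delta_mx 0 j) F y| <= B j.
  have c := smooth_at_cont (smooth_at_derive (delta_mx 0 j) sF).
  have kj : \forall y \near x, `|'D_(delta_mx 0 j) F x - 'D_(delta_mx 0 j) F y| < 1.
    exact: ((cvgrPdist_lt _ _).1 c _ ltr01).
  apply: filterS kj => y k; rewrite /B -lerBlDl; apply: le_trans (ltW k).
  by rewrite distrC; exact: lerB_dist.
have nb : \forall y \near x, forall j, `|'D_(delta_mx 0 j) F y| <= B j.
  exact: (@filter_forall _ _ (fun j y => `|'D_(delta_mx 0 j) F y| <= B j) (nbhs x) (nbhs_filter x) nj).
exists (\sum_j B j); first by apply: sumr_ge0 => j _; rewrite addr_ge0.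
move: nb (smooth_at_near sF); apply: filterS2 => y hB sFy v i.
apply: (le_trans (norm_coord_le _ _)); rewrite (derive_expand v sFy).
apply: (le_trans (ler_norm_sum _ _ _)); rewrite mulr_sumr; apply: ler_sum => j _.
rewrite normrZ mulrC ler_wpM2r//; apply: (le_trans (hB j)).
by rewrite (bigD1 j)//= lerDl sumr_ge0// => l _; rewrite addr_ge0.
Qed.

(* Hadamard's lemma: compare the values at a point and at its projection onto
   the slice. *)
Lemma vanish_bound k (M U : set E) Phi G (x : E) (g : E -> K) : slice k M U Phi G ->
  U x -> M x -> smooth_at g x -> (forall y, M y -> U y -> g y = 0) ->
  exists2 L : K, 0 <= L &
  \forall y \near x, `|g y| <= L * \sum_(i < n.+1 | (k <= i)%N) `|Phi y 0 i|.
Proof.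
move=> [[oU sP oPU sG GP] hS] Ux Mx sg g0.
have PUx : (Phi @` U) (Phi x) by exists x.
have sgG : smooth_at (fun u => g (G u)) (Phi x).
  apply: smooth_at_comp; [exact: has_basis_rV|exact: has_basisK|exact: sG|].
  by rewrite GP.
have [L L0 [e e0 he]] := smooth_lipschitz (has_basis_rV _) sgG.
have nPU : nbhs (Phi x) (Phi @` U) by exact: open_nbhs_nbhs.
have /nbhs_normP[d /= d0 hd] := nPU.
exists L; first exact: ltW.
pose b := Num.min d e; have b0 : 0 < b by rewrite lt_min d0.
have n1 : nbhs x [set y | `|Phi x - Phi y| < b].
  exact: ((cvgrPdist_lt _ _).1 (smooth_at_cont (sP x Ux)) _ b0).
have n2 : nbhs x U by exact: open_nbhs_nbhs.
move: n1 n2; apply: filterS2 => y /= yb Uy.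
pose w : E := \row_i (if (k <= i)%N then 0 else Phi y 0 i).
have wx : `|Phi x - w| < b.
  apply: le_lt_trans yb; apply: norm_rV_le => // i; rewrite !mxE.
  case: ifP => ki; last by have := norm_coord_le (Phi x - Phi y) i; rewrite !mxE.
  by rewrite ((hS x Ux).1 Mx i ki) subrr normr0.
move: (yb) (wx); rewrite !lt_min => /andP[yd ye] /andP[wd we].
have [p Up pw] := hd w wd.
have Mp : M p.
  by apply/(hS p Up) => i ki; rewrite pw mxE ki.
have := he (Phi y) w ye we; rewrite GP// -pw GP// (g0 p Mp Up) subr0 pw => /le_trans; apply.
rewrite ler_wpM2l ?(ltW L0)//; apply: norm_rV_le => [|i]; first exact: sumr_ge0.
rewrite !mxE; case: ifP => ki; last by rewrite subrr normr0 sumr_ge0.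
by rewrite subr0 (bigD1 i)//= lerDl sumr_ge0.
Qed.

End Bounds.

(** * Trigonometric functions of curvature C *)

Section Trigonometry.
Context {K : realType} {nu : bool} {C r : K}.
Hypotheses (r0 : 0 < r) (hC : C = (-1) ^+ nu / r ^+ 2).

(** With [geo_sin], the solutions of y'' = - C y with initial data (1,0) and (0,1). In this
    normalization the derivatives and the relation between the squares read the same for both signs
    of C. *)
Definition geo_cos (z : K) : K := fC C (z / r).
Definition geo_sin (z : K) : K := r * gC C (z / r).

Lemma geo_smooth z : smooth_at geo_cos z /\ smooth_at geo_sin z.
Proof.
have s : smooth_at (fun z : K => z / r) z.
  by apply: smooth_atM; [exact: smooth_at_id|exact: smooth_at_cst].
rewrite /geo_cos /geo_sin /fC /gC; case: ifP => _; split.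
- exact: smooth_at_cos.
- by apply: smooth_atM; [exact: smooth_at_cst|exact: smooth_at_sin].
- apply: smooth_atM; last exact: smooth_at_cst.
  by apply: smooth_atD; apply: smooth_at_expR => //; exact: smooth_atN.
- apply: smooth_atM; first exact: smooth_at_cst.
  apply: smooth_atM; last exact: smooth_at_cst.
  by apply: smooth_atB; apply: smooth_at_expR => //; exact: smooth_atN.
Qed.

Lemma geo_C : C * r = (if 0 < C then 1 else -1) / r.
Proof.
have rn0 : r != 0 by rewrite gt_eqF.
by rewrite (sform_Cgt0 r0 hC) hC; case: (nu); rewrite ?expr0 ?expr1 /=; field.
Qed.

Lemma is_derive_div (z : K) : is_derive z 1 (fun z : K => z / r) r^-1.
Proof.
have := is_deriveZ r^-1 (is_derive_id z (1 : K)) => h.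
have -> : (fun z : K => z / r) = r^-1 \*: id by apply/funext => y; rewrite mulrC.
by apply: is_derive_eq h _; rewrite [_ *: _]mulr1.
Qed.

Lemma is_derive_comp_div (f : K -> K) (z d : K) : is_derive (z / r) 1 f d ->
  is_derive z 1 (fun z => f (z / r)) (d / r).
Proof. by move=> h; exact: (@is_derive1_comp _ f (fun z : K => z / r) z _ _ h (is_derive_div z)). Qed.

Lemma is_derive_cosh (y : K) : is_derive y 1 (@cosh K) (sinh y) /\ is_derive y 1 (@sinh K) (cosh y).
Proof.
have e1 := is_derive_expR y.
have e2 : is_derive y 1 (fun y : K => expR (- y)) (- expR (- y)).
  have dN : is_derive y 1 (fun y : K => - y) (- 1) by exact: is_deriveN.
  have := @is_derive1_comp _ (@expR K) (fun y : K => - y) y _ _ (is_derive_expR _) dN.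
  by move=> h; apply: is_derive_eq h _; rewrite mulrN1.
have sc (f : K -> K) d : is_derive y 1 f d -> is_derive y 1 (fun y => f y / 2) (d / 2).
  move=> h; have := is_deriveZ 2^-1 h => h2.
  have -> : (fun y => f y / 2) = 2^-1 \*: f by apply/funext => t; rewrite mulrC.
  by apply: is_derive_eq h2 _; rewrite [_ *: _]mulrC.
split; first by apply: sc; exact: is_deriveD.
have := sc _ _ (is_deriveB e1 e2).
by rewrite opprK.
Qed.

Lemma geo_derive (z : K) :
  is_derive z 1 geo_cos (- C * geo_sin z) /\ is_derive z 1 geo_sin (geo_cos z).
Proof.
have rn0 : r != 0 by rewrite gt_eqF.
have Z (f : K -> K) d : is_derive z 1 f (d / r) -> is_derive z 1 (fun z => r * f z) d.
  move=> h; have := is_deriveZ r h => h2; apply: is_derive_eq h2 _.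
  by rewrite -[LHS]/(r * (d / r)) mulrC divfK.
have f (X : K) : - C * (r * X) = - ((C * r) * X) by ring.
have e := geo_C; move: e; rewrite /geo_cos /geo_sin /fC /gC; case: ifP => _ e; split.
- apply: is_derive_eq (is_derive_comp_div (is_derive_cos (z / r))) _.
  by rewrite f e; ring.
- exact: Z (is_derive_comp_div (is_derive_sin (z / r))).
- apply: is_derive_eq (is_derive_comp_div (is_derive_cosh (z / r)).1) _.
  by rewrite f e; ring.
exact: Z (is_derive_comp_div (is_derive_cosh (z / r)).2).
Qed.

Lemma geo_sq z : geo_cos z ^+ 2 + C * geo_sin z ^+ 2 = 1.
Proof.
have rn0 : r != 0 by rewrite gt_eqF.
have e : C * r ^+ 2 = if 0 < C then 1 else -1.
  by rewrite expr2 mulrA geo_C divfK.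
rewrite /geo_sin exprMn mulrA e /geo_cos /fC /gC; case: ifP => _.
  by rewrite mul1r cos2Dsin2.
have h : expR (z / r) * expR (- (z / r)) = 1 by rewrite -expRD subrr expR0.
by rewrite /cosh /sinh -[RHS]h; field.
Qed.

Lemma geo0 : geo_cos 0 = 1 /\ geo_sin 0 = 0.
Proof.
rewrite /geo_cos /geo_sin /fC /gC mul0r; case: ifP => _.
  by rewrite cos0 sin0 mulr0.
by rewrite /cosh /sinh oppr0 expR0 subrr mul0r mulr0; split=> //; field.
Qed.

Lemma geoN z : geo_cos (- z) = geo_cos z /\ geo_sin (- z) = - geo_sin z.
Proof.
rewrite /geo_cos /geo_sin /fC /gC mulNr; case: ifP => _.
  by rewrite cosN sinN mulrN.
by rewrite /cosh /sinh opprK; split; [rewrite addrC|field].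
Qed.

End Trigonometry.

(** * The rulings stay in the hypersurface *)

Section Ruling.
Context {K : realType} {n : nat} {nu : bool} {C r : K}.
Hypotheses (n2 : (2 <= n)%N) (r0 : 0 < r) (hC : C = (-1) ^+ nu / r ^+ 2).
Notation E := 'rV[K]_n.+1.
Notation MC := (space_form n nu C).
Implicit Types (p q X Y x : E).

Variables (M U : set E) (Phi G Nh : E -> E) (p0 : E) (lam : K).
Hypothesis slM : slice n.-1 M U Phi G.
Hypothesis MMC : M `<=` MC.
Hypothesis sNh : forall q, U q -> smooth_at Nh q.
Hypothesis Nh1 : forall q, M q -> U q -> mdot nu (Nh q) (Nh q) = 1.
Hypothesis Nhq : forall q, M q -> U q -> mdot nu (Nh q) q = 0.
Hypothesis NhT : forall q X, M q -> U q -> tangent M q X -> mdot nu (Nh q) X = 0.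
Hypothesis Nhp0 : forall q, M q -> U q -> mdot nu (Nh q) p0 = lam.
Hypothesis S2_gt0 : forall q, U q ->
  0 < mdot nu p0 p0 - lam ^+ 2 - C * mdot nu q p0 ^+ 2.

Notation W := (@Wfield K n nu C Nh p0 lam).
Notation f := (@geo_cos K C r).
Notation g := (@geo_sin K C r).

Let smW q : U q -> smooth_at W q.
Proof. by move=> Uq; apply: (smooth_Wfield sNh S2_gt0 Uq). Qed.

Let tW q : M q -> U q -> tangent M q (W q).
Proof.
move=> Mq Uq.
exact: (Wfield_tangent n2 r0 hC slM MMC Nh1 Nhq NhT Nhp0 S2_gt0 Mq Uq).
Qed.

Let dWW q : M q -> U q -> 'D_(W q) W q = - C *: q.
Proof.
move=> Mq Uq.
exact: (derive_W_W n2 r0 hC slM MMC sNh Nh1 Nhq NhT Nhp0 S2_gt0 Mq Uq).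
Qed.

Definition ruling (q : E) (z : K) : E := f z *: q + g z *: W q.
Definition ruling' (q : E) (z : K) : E := (- C * g z) *: q + f z *: W q.

Lemma is_derive_ruling q (z : K) : is_derive z 1 (ruling q) (ruling' q z).
Proof.
have [df dg] := geo_derive r0 hC z.
have := is_deriveD (is_derive_scale df (is_derive_cst q z (1 : K)))
  (is_derive_scale dg (is_derive_cst (W q) z (1 : K))).
by rewrite !scaler0 !add0r.
Qed.

Lemma is_derive_ruling' q (z : K) : is_derive z 1 (ruling' q) (- C *: ruling q z).
Proof.
have [df dg] := geo_derive r0 hC z.
have d1 : is_derive z 1 (fun z => - C * g z) (- C * f z) by exact: is_deriveZ.
have := is_deriveD (is_derive_scale d1 (is_derive_cst q z (1 : K)))
  (is_derive_scale df (is_derive_cst (W q) z (1 : K))).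
by rewrite !scaler0 !add0r /ruling scalerDr !scalerA.
Qed.

Lemma ruling0 q : ruling q 0 = q.
Proof. by rewrite /ruling (@geo0 K C r).1 (@geo0 K C r).2 scale1r scale0r addr0. Qed.

Lemma ruling'0 q : ruling' q 0 = W q.
Proof. by rewrite /ruling' (@geo0 K C r).1 (@geo0 K C r).2 mulr0 scale0r add0r scale1r. Qed.

Lemma smooth_at_fst (V V' : normedModType K) (z : V * V') : smooth_at fst z.
Proof.
have c : continuous (fst : V * V' -> V) by move=> y; exact: cvg_fst.
exact: (@smooth_at_lin _ _ _ _ (fst : {linear (V * V')%type -> V}) id z c (smooth_at_id z)).
Qed.

Lemma smooth_at_snd (V V' : normedModType K) (z : V * V') : smooth_at snd z.
Proof.
have c : continuous (snd : V * V' -> V') by move=> y; exact: cvg_snd.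
exact: (@smooth_at_lin _ _ _ _ (snd : {linear (V * V')%type -> V'}) id z c (smooth_at_id z)).
Qed.

Lemma smooth_ruling q (z : K) : U q ->
  smooth_at (fun qz : E * K => ruling qz.1 qz.2) (q, z).
Proof.
move=> Uq; have [sf sg] := @geo_smooth K C r z.
have s1 := smooth_at_fst (q, z); have s2 := smooth_at_snd (q, z).
have sfz : smooth_at (fun qz : E * K => f qz.2) (q, z).
  exact: (@smooth_at_comp _ _ _ _ snd f (q, z) has_basisK has_basisK s2 sf).
have sgz : smooth_at (fun qz : E * K => g qz.2) (q, z).
  exact: (@smooth_at_comp _ _ _ _ snd g (q, z) has_basisK has_basisK s2 sg).
have sWq : smooth_at (fun qz : E * K => W qz.1) (q, z).
  exact: (@smooth_at_comp _ _ _ _ fst W (q, z) (has_basis_rV _) (has_basis_rV _) s1 (smW Uq)).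
by apply: smooth_atD; apply: smooth_atZ.
Qed.

Lemma ruling_near x (A : set E) : U x -> nbhs x A ->
  exists2 e : K, 0 < e & \forall q \near x, forall z : K, `|z| < e -> A (ruling q z).
Proof.
move=> Ux nA.
have c := smooth_at_cont (smooth_ruling 0 Ux).
have nA' : nbhs (ruling x 0) A by rewrite ruling0.
have [[P Q] /= [nP nQ] PQ] := c _ nA'.
have /nbhs_normP[e /= e0 he] := nQ.
exists e => //; apply: filterS nP => q Pq z ze.
apply: (PQ (q, z)); split=> //=; apply: he.
by rewrite /= sub0r normrN.
Qed.

(* Along a geodesic [c] issued from [M] in the direction of [W], the defining
   functions of [M] at [c] and the difference [c' - W c] satisfy a linear
   differential inequality. *)
Lemma ruling_in x (A : set E) : M x -> U x -> nbhs x A ->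
  exists2 e : K, 0 < e & \forall q \near x, M q -> forall z : K, `|z| < e ->
    [/\ M (ruling q z), U (ruling q z), A (ruling q z) &
        W (ruling q z) = ruling' q z].
Proof.
move=> Mx Ux nA; have [cP hS] := slM; have [oU sP oPU sG GP] := cP.
(* [a] measures how far W is from preserving the equations of M, [b] how far it is from being
   geodesic. The relevant components vanish on M, hence are bounded by [R], the size of the defining
   functions. *)
pose a y := 'D_(W y) Phi y; pose b y := C *: y + 'D_(W y) W y.
have sa : smooth_at a x by apply: smooth_at_derive_field; [exact: sP|exact: smW].
have sb : smooth_at b x.
  apply: smooth_atD; last by apply: smooth_at_derive_field; exact: smW.
  by apply: smooth_atZ; [exact: smooth_at_cst|exact: smooth_at_id].
pose R y := \sum_(i < n.+1 | (n.-1 <= i)%N) `|Phi y 0 i|.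
have a0 (i : 'I_n.+1) y : (n.-1 <= i)%N -> M y -> U y -> a y 0 i = 0.
  by move=> ni My Uy; exact: (tangent_slice _ slM Uy My).1 (tW My Uy) i ni.
have b0 (i : 'I_n.+1) y : M y -> U y -> b y 0 i = 0.
  by move=> My Uy; rewrite /b dWW// scaleNr subrr mxE.
have /choice[La hLa] (i : 'I_n.+1) : exists L : K, 0 <= L /\
    \forall y \near x, (n.-1 <= i)%N -> `|a y 0 i| <= L * R y.
  have [ni|ni] := leqP n.-1 i; last by exists 0; split=> //; apply: (@filterS _ (nbhs x) _ setT) => //; exact: filterT.
  have [L L0 hL] := vanish_bound slM Ux Mx (smooth_at_coord i sa) (fun y => a0 i y ni).
  by exists L; split=> //; apply: (@filterS _ (nbhs x) _ _ _ _ hL).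
have /choice[Lb hLb] (i : 'I_n.+1) : exists L : K, 0 <= L /\
    \forall y \near x, `|b y 0 i| <= L * R y.
  have [L L0 hL] := vanish_bound slM Ux Mx (smooth_at_coord i sb) (b0 i).
  by exists L.
have [Lc Lc0 hLc] := derive_bound (sP x Ux).
have [Ld Ld0 hLd] := derive_bound (smW Ux).
pose L := \sum_i La i + \sum_i Lb i + Lc + Ld.
have La_le i : La i <= L.
  rewrite /L (bigD1 i)//= -!addrA lerDl; do !apply: addr_ge0 => //.
    by apply: sumr_ge0 => j _; have [] := hLa j.
  by apply: sumr_ge0 => j _; have [] := hLb j.
have Lb_le i : Lb i <= L.
  rewrite /L (bigD1 i (F := Lb))//= addrCA -!addrA lerDl.
  do !apply: addr_ge0 => //.
    by apply: sumr_ge0 => j _; have [] := hLa j.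
  by apply: sumr_ge0 => j _; have [] := hLb j.
have Sa0 : 0 <= \sum_i La i by apply: sumr_ge0 => j _; have [] := hLa j.
have Sb0 : 0 <= \sum_i Lb i by apply: sumr_ge0 => j _; have [] := hLb j.
have Lc_le : Lc <= L by rewrite /L; lra.
have Ld_le : Ld <= L by rewrite /L; lra.
have L0 : 0 <= L by apply: (le_trans Lc0).
have nLai (i : 'I_n.+1) : \forall y \near x, (n.-1 <= i)%N -> `|a y 0 i| <= La i * R y.
  by have [] := hLa i.
have nLbi (i : 'I_n.+1) : \forall y \near x, `|b y 0 i| <= Lb i * R y.
  by have [] := hLb i.
have nLa : nbhs x [set y | forall i : 'I_n.+1, (n.-1 <= i)%N -> `|a y 0 i| <= La i * R y].
  exact: (@filter_forall _ _ (fun (i : 'I_n.+1) (y : E) => (n.-1 <= i)%N -> `|a y 0 i| <= La i * R y)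
    (nbhs x) (nbhs_filter x) nLai).
have nLb : nbhs x [set y | forall i : 'I_n.+1, `|b y 0 i| <= Lb i * R y].
  exact: (@filter_forall _ _ (fun (i : 'I_n.+1) (y : E) => `|b y 0 i| <= Lb i * R y)
    (nbhs x) (nbhs_filter x) nLbi).
have nU : nbhs x U by exact: open_nbhs_nbhs.
pose good (y : E) := [/\ forall i : 'I_n.+1, (n.-1 <= i)%N -> `|a y 0 i| <= La i * R y,
  forall i : 'I_n.+1, `|b y 0 i| <= Lb i * R y,
  forall v i, `|('D_v Phi y) 0 i| <= Lc * \sum_j `|v 0 j|,
  forall v i, `|('D_v W y) 0 i| <= Ld * \sum_j `|v 0 j| & U y /\ A y].
have nAll : nbhs x good.
  near=> y; split; [near: y; exact: nLa|near: y; exact: nLb|near: y; exact: hLc|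
    near: y; exact: hLd|].
  by split; near: y; [exact: nU|exact: nA].
have [e e0 he] := ruling_near Ux nAll.
exists e => //; move: he nU; apply: (@filterS2 _ (nbhs x)) => q hq Uq Mq.
have cU (z : K) : `|z| < e -> U (ruling q z) by case/hq => _ _ _ _ [].
have cA (z : K) : `|z| < e -> A (ruling q z) by case/hq => _ _ _ _ [].
pose eps (t : K) : E := ruling' q t - W (ruling q t).
(* The unknowns of Gronwall's inequality: the defining functions along the geodesic, padded by zeros
   at the free coordinates, and the components of c' - W(c). *)
pose u (k : 'I_n.+1 + 'I_n.+1) (t : K) : K := match k with
  | inl i => if (n.-1 <= i)%N then Phi (ruling q t) 0 i else 0
  | inr j => eps t 0 j end.
have sumu (t : K) : \sum_k `|u k t| = R (ruling q t) + \sum_j `|eps t 0 j|.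
  rewrite big_sumType/=; congr (_ + _); rewrite /R [RHS]big_mkcond/=.
  by apply: eq_bigr => i _; case: ifP; rewrite ?normr0.
have lc i : continuous (@coord_rV K n.+1 i) by exact: coord_continuous.
have split_dir (F : E -> E) y v w : smooth_at F y -> 'D_(v + w) F y = 'D_v F y + 'D_w F y.
  move=> sF; have dF := smooth_at_diff (has_basis_rV _) (has_basis_rV _) sF.
  by rewrite (deriveE _ dF) (deriveE v dF) (deriveE w dF) linearD.
have cE (t : K) : ruling' q t = W (ruling q t) + eps t by rewrite /eps addrC subrK.
have dPhi (t : K) : `|t| < e -> is_derive t 1 (fun s => Phi (ruling q s))
    (a (ruling q t) + 'D_(eps t) Phi (ruling q t)).
  move=> te; have sy := sP _ (cU t te).
  have := is_derive_chain (has_basis_rV _) (has_basis_rV _) (is_derive_ruling q t) sy.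
  by rewrite cE split_dir.
(* From c'' = - C c and the derivative of W along c' = W + eps: the part along W combines with - C c
   into - b. *)
have deps (t : K) : `|t| < e -> is_derive t 1 eps
    (- b (ruling q t) - 'D_(eps t) W (ruling q t)).
  move=> te; have sy := smW (cU t te).
  have d := is_derive_chain (has_basis_rV _) (has_basis_rV _) (is_derive_ruling q t) sy.
  have d' := is_deriveB (is_derive_ruling' q t) d.
  have sp := split_dir W _ (W (ruling q t)) (eps t) sy.
  have ve (c w1 w2 : E) : - C *: c - (w1 + w2) = - (C *: c + w1) - w2.
    by rewrite scaleNr !opprD addrA.
  have := ve (ruling q t) ('D_(W (ruling q t)) W (ruling q t)) ('D_(eps t) W (ruling q t)).
  by rewrite -sp -cE => <-.
have coordD (v w : E) i : coord_rV i (v + w) = v 0 i + w 0 i by rewrite /coord_rV mxE.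
have coordNB (v w : E) i : coord_rV i (- v - w) = - v 0 i - w 0 i by rewrite /coord_rV !mxE.
have du k (t : K) : `|t| < e -> derivable (u k) t 1 /\
    `|'D_1 (u k) t| <= L * \sum_j `|u j t|.
  move=> te; have [g1 g2 g3 g4 _] := hq t te; set y := ruling q t in g1 g2 g3 g4.
  have R0 : 0 <= R y by apply: sumr_ge0.
  have e0' : 0 <= \sum_j `|eps t 0 j| by apply: sumr_ge0.
  have LS : 0 <= L * \sum_j `|u j t| by rewrite mulr_ge0// sumr_ge0.
  case: k => [i|j].
    have [ni|ni] := boolP (n.-1 <= i)%N; last first.
      have -> : u (inl i) = cst 0 by apply/funext => s; rewrite /u (negbTE ni).
      by split; [exact: derivable_cst|rewrite derive_cst normr0].
    have -> : u (inl i) = fun s => coord_rV i (Phi (ruling q s)).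
      by apply/funext => s; rewrite /u ni.
    have [d1 d2] := is_derive_lin (l := coord_rV i) (lc i) (dPhi t te); split; first exact: d1.
    have -> : 'D_1 (fun s => coord_rV i (Phi (ruling q s))) t = a y 0 i + ('D_(eps t) Phi y) 0 i.
      exact: etrans d2 (coordD _ _ _).
    rewrite sumu mulrDr (le_trans (ler_normD _ _))// lerD//.
      by apply: (le_trans (g1 i ni)); rewrite ler_wpM2r.
    by apply: (le_trans (g3 _ i)); rewrite ler_wpM2r.
  have [d1 d2] := is_derive_lin (l := coord_rV j) (lc j) (deps t te); split; first exact: d1.
  have -> : 'D_1 (u (inr j)) t = - b y 0 j - ('D_(eps t) W y) 0 j.
    exact: etrans d2 (coordNB _ _ _).
  rewrite sumu mulrDr (le_trans (ler_normB _ _))// normrN lerD//.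
    by apply: (le_trans (g2 j)); rewrite ler_wpM2r.
  by apply: (le_trans (g4 _ j)); rewrite ler_wpM2r.
have u0 k : u k 0 = 0.
  case: k => [i|j] /=.
    by rewrite ruling0; case: ifP => // ni; exact: (hS q Uq).1.
  by rewrite /eps ruling0 ruling'0 subrr mxE.
have uz := gronwall L0 (fun k t te => (du k t te).1) (fun k t te => (du k t te).2) u0.
move=> z ze; split; [|exact: cU|exact: cA|].
  apply/(hS _ (cU z ze)) => i ni.
  by have := uz (inl i) z ze; rewrite /= ni.
apply/esym/eqP; rewrite -subr_eq0; apply/eqP/rowP => j; rewrite [RHS]mxE.
exact: (uz (inr j) z ze).
Unshelve. all: by end_near. Qed.

End Ruling.

(** The case of row vectors of length one: replacing their only coordinate by [H] is the map [k]
    itself, so the coordinate chart supplies its inverse. *)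
Lemma inverse_1d (K : realType) (k : K -> K) (z0 d : K) : smooth_at k z0 ->
  is_derive z0 1 k d -> d != 0 ->
  exists (A J : set K) (zeta : K -> K), [/\ open A, A z0, open J, smooth_on J zeta &
    (forall z, A z -> J (k z) /\ zeta (k z) = z) /\
    (forall y, J y -> A (zeta y) /\ k (zeta y) = y)].
Proof.
move=> sk [_ dk] d0.
pose e : 'rV[K]_1 := delta_mx 0 0; pose H (u : 'rV[K]_1) : K := k (u 0 0).
have e00 : e 0 0 = 1 by rewrite mxE !eqxx.
have row1 (u : 'rV[K]_1) : u 0 0 *: e = u.
  by apply/rowP => i; rewrite !mxE (ord1 i) !eqxx mulr1.
pose L (z : K) : 'rV[K]_1 := z *: e.
have L00 z : (L z) 0 0 = z by rewrite /L mxE e00 mulr1.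
have sL z : smooth_at L z.
  by apply: smooth_atZ; [exact: smooth_at_id|exact: smooth_at_cst].
have sc (u : 'rV[K]_1) : smooth_at (fun u : 'rV[K]_1 => u 0 0) u.
  by apply: smooth_at_coord; exact: smooth_at_id.
have sH : smooth_at H (L z0).
  apply: (@smooth_at_comp _ _ _ _ (fun u : 'rV[K]_1 => u 0 0) k (L z0) has_basisK has_basisK (sc _)).
  by rewrite L00.
have dH : 'D_e H (L z0) != 0.
  have dc : is_derive (L z0) e (fun u : 'rV[K]_1 => u 0 0) 1.
    have lc : continuous (@coord_rV K 1 0) by exact: coord_continuous.
    have h := is_derive_lin (l := coord_rV 0) lc (is_derive_id (L z0) e).
    exact: is_derive_eq h e00.
  have skL : smooth_at k ((L z0) 0 0) by rewrite L00.
  have [_ h] := is_derive_chain has_basisK has_basisK dc skL.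
  by rewrite [X in X != 0]h L00 dk.
have [B [G [oB Bz0 sHB GB [oI sI]]]] := coordinate_chart sH dH.
have rcE u : replace_coord H 0 u = L (k (u 0 0)).
  rewrite /replace_coord /L /H -[X in X + _]row1 -scalerDl.
  by rewrite [X in X *: _]addrC subrK.
have cL z : {for z, continuous L} by exact: smooth_at_cont.
pose I := replace_coord H 0 @` B.
have oA : open [set z | B (L z)].
  have := @open_preimage _ _ setT B L openT oB (fun z _ => cL z).
  by rewrite setTI.
have oJ : open [set y | I (L y)].
  have := @open_preimage _ _ setT I L openT oI (fun z _ => cL z).
  by rewrite setTI.
exists [set z | B (L z)], [set y | I (L y)], (fun y => (G (L y)) 0 0); split=> //.
- apply/smooth_onP => // y Iy; apply: smooth_at_coord.
  apply: smooth_at_comp; [exact: has_basis_rV|exact: has_basis_rV|exact: sL|].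
  exact: (smooth_onP _ oI).1.
split=> [z Bz|y [u Bu]] /=.
  have <- : replace_coord H 0 (L z) = L (k z) by rewrite rcE L00.
  by split; [exists (L z)|rewrite GB].
rewrite rcE => uE; rewrite -uE -rcE GB//; split; first by rewrite /L row1.
by have := congr1 (fun w : 'rV[K]_1 => w 0 0) uE; rewrite !L00.
Qed.

(** * Geodesics and the exponential map *)

Section Geodesics.
Context {K : realType} {n : nat} {nu : bool} {C r : K}.
Hypotheses (r0 : 0 < r) (hC : C = (-1) ^+ nu / r ^+ 2).
Notation E := 'rV[K]_n.+1.
Notation MC := (space_form n nu C).
Notation f := (@geo_cos K C r).
Notation g := (@geo_sin K C r).
Variables (q w : E).
Hypotheses (hq : MC q) (wq : mdot nu w q = 0) (ww : mdot nu w w = 1).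
Let C0 : C != 0. Proof. exact: sform_C0 hC. Qed.

Definition geodesic (z : K) : E := f z *: q + g z *: w.

Lemma geodesic_space_form z : MC (geodesic z).
Proof.
have fg := geo_sq r0 hC z; split.
  rewrite /geodesic !mdot_lin hq.1 ww wq [mdot nu q w]mdotC wq.
  by rewrite -[RHS]mulr1 -[X in _ = _ * X]fg; field; exact: C0.
move=> Cl; have q0 := hq.2 Cl.
have hnu : nu by move: (sform_Cgt0 r0 hC); rewrite ltNge (ltW Cl); case: (nu).
have := sheet_bound r0 hC hnu hq.1 wq ww; rewrite /geodesic !mxE.
have Cn : (0 < C) = false by rewrite ltNge (ltW Cl).
rewrite /geo_cos /geo_sin /fC /gC Cn /cosh /sinh => h.
have E0 := expR_gt0 (z / r); have F0 := expR_gt0 (- (z / r)).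
move: (expR (z / r)) (expR (- (z / r))) E0 F0 => a b a0 b0.
(* In terms of exponentials the first coordinate is a positive combination of q_0 + r w_0 and q_0 -
   r w_0, both positive by [sheet_bound]. *)
have -> : (a + b) / 2 * q 0 0 + r * ((a - b) / 2) * w 0 0 =
  (a * (q 0 0 + r * w 0 0) + b * (q 0 0 - r * w 0 0)) / 2 by field.
move: (q 0 0) (r * w 0 0) q0 h => u v u0 h.
have h1 : 0 < u + v by rewrite ltNge; apply/negP => h1; nra.
have h2 : 0 < u - v by rewrite ltNge; apply/negP => h2; nra.
by rewrite divr_gt0// addr_gt0// mulr_gt0.
Qed.

(** The curve t -> geodesic (t z) has second derivative a multiple of its position, which is normal
    to the space form. *)
Lemma geodesic_exp z : is_exp nu C q (z *: w) (geodesic z).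
Proof.
pose g' (z : K) : E := (- C * g z) *: q + f z *: w.
have dG (s : K) : is_derive s 1 geodesic (g' s).
  have [df dg] := geo_derive r0 hC s.
  have := is_deriveD (is_derive_scale df (is_derive_cst q s (1 : K)))
    (is_derive_scale dg (is_derive_cst w s (1 : K))).
  by rewrite !scaler0 !add0r.
have dG' (s : K) : is_derive s 1 g' (- C *: geodesic s).
  have [df dg] := geo_derive r0 hC s.
  have d1 : is_derive s 1 (fun s => - C * g s) (- C * f s) by exact: is_deriveZ.
  have := is_deriveD (is_derive_scale d1 (is_derive_cst q s (1 : K)))
    (is_derive_scale df (is_derive_cst w s (1 : K))).
  by rewrite !scaler0 !add0r /geodesic scalerDr !scalerA.
have sG s : smooth_at geodesic s.
  by have [sf sg] := @geo_smooth K C r s; apply: smooth_atD; apply: smooth_atZ => //;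
    exact: smooth_at_cst.
have sG' s : smooth_at g' s.
  have [sf sg] := @geo_smooth K C r s; apply: smooth_atD; apply: smooth_atZ => //;
    try exact: smooth_at_cst.
  by apply: smooth_atM => //; exact: smooth_at_cst.
have dtz (t : K) : is_derive t 1 (fun t : K => t * z) z.
  have h := is_derive_scale (is_derive_id t (1 : K)) (is_derive_cst z t (1 : K)).
  by apply: is_derive_eq h _; rewrite scaler0 add0r scale1r.
have comp (F : K -> E) (d : E) (t : K) : smooth_at F (t * z) -> is_derive (t * z) 1 F d ->
    is_derive t 1 (fun t => F (t * z)) (z *: d).
  move=> sF dF; have [_ e] := is_deriveZdir z dF.
  have zz : z *: 1 = z :> K by exact: mulr1.
  rewrite zz in e; apply: is_derive_eq e.
  exact: is_derive_chain has_basisK (has_basis_rV _) (dtz t) sF.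
pose c (t : K) : E := geodesic (t * z).
have dc (t : K) : is_derive t 1 c (z *: g' (t * z)) by apply: comp.
have dc1 : derive1 c = fun t => z *: g' (t * z).
  by apply/funext => t; rewrite derive1E; have [] := dc t.
have dc2 (t : K) : derive1 (derive1 c) t = (z * z * - C) *: c t.
  rewrite dc1 derive1E.
  have d := is_deriveZ z (comp _ _ t (sG' _) (dG' (t * z))).
  by have [_ ->] := d; rewrite !scalerA.
exists c; split.
- apply/smooth_onP; first exact: openT.
  move=> t _; apply: (@smooth_at_comp _ _ _ _ (fun t : K => t * z) geodesic t
    has_basisK (has_basis_rV _) _ (sG _)).
  by apply: smooth_atM; [exact: smooth_at_id|exact: smooth_at_cst].
- by move=> t; exact: geodesic_space_form.
- move=> t; rewrite /covder dc2 /tproj mdotZl (geodesic_space_form (t * z)).1.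
  by rewrite mulrCA divff// mulr1 subrr.
- rewrite dc1 /c mul0r /geodesic /g' (@geo0 K C r).1 (@geo0 K C r).2.
  by rewrite mulr0 !scale0r !scale1r addr0 add0r.
- by rewrite /c mul1r.
Qed.

End Geodesics.

(** * The local description *)

Section LocalDescription.
Context {K : realType} {n : nat} {nu : bool} {C r : K}.
Hypotheses (n2 : (2 <= n)%N) (r0 : 0 < r) (hC : C = (-1) ^+ nu / r ^+ 2).
Notation E := 'rV[K]_n.+1.
Notation MC := (space_form n nu C).
Implicit Types (p q X Y : E).

Variables (M U : set E) (Phi G Nh : E -> E) (p0 : E) (lam : K).
Hypothesis slM : slice n.-1 M U Phi G.
Hypothesis MMC : M `<=` MC.
Hypothesis sNh : forall q, U q -> smooth_at Nh q.
Hypothesis Nh1 : forall q, M q -> U q -> mdot nu (Nh q) (Nh q) = 1.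
Hypothesis Nhq : forall q, M q -> U q -> mdot nu (Nh q) q = 0.
Hypothesis NhT : forall q X, M q -> U q -> tangent M q X -> mdot nu (Nh q) X = 0.
Hypothesis Nhp0 : forall q, M q -> U q -> mdot nu (Nh q) p0 = lam.
Hypothesis S2_gt0 : forall q, U q ->
  0 < mdot nu p0 p0 - lam ^+ 2 - C * mdot nu q p0 ^+ 2.

Notation W := (@Wfield K n nu C Nh p0 lam).
Notation S := (@speed K n nu C p0 lam).
Notation f := (@geo_cos K C r).
Notation g := (@geo_sin K C r).
Notation R := (@ruling K n nu C r Nh p0 lam).
Notation R' := (@ruling' K n nu C r Nh p0 lam).
Let C0 : C != 0. Proof. exact: sform_C0 hC. Qed.

Let tW q : M q -> U q -> tangent M q (W q).
Proof.
move=> Mq Uq.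
exact: (Wfield_tangent n2 r0 hC slM MMC Nh1 Nhq NhT Nhp0 S2_gt0 Mq Uq).
Qed.
Let Wq q : M q -> U q -> mdot nu (W q) q = 0.
Proof. move=> Mq Uq; exact: (Wfield_q r0 hC MMC Nhq S2_gt0 Mq Uq). Qed.
Let Wp0 q : M q -> U q -> mdot nu (W q) p0 = S q.
Proof. move=> Mq Uq; exact: (Wfield_p0 Nhp0 S2_gt0 Mq Uq). Qed.
Let W1 q : M q -> U q -> mdot nu (W q) (W q) = 1.
Proof. move=> Mq Uq; exact: (Wfield_unit r0 hC MMC Nh1 Nhq Nhp0 S2_gt0 Mq Uq). Qed.
Let S_gt0 q : U q -> 0 < S q.
Proof. by move=> Uq; exact: (speed_gt0 S2_gt0 Uq). Qed.
Let SS q : U q -> S q ^+ 2 = mdot nu p0 p0 - lam ^+ 2 - C * mdot nu q p0 ^+ 2.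
Proof. by move=> Uq; exact: (sqr_speed S2_gt0 Uq). Qed.
Let smR q (z : K) : U q -> smooth_at (fun qz : E * K => R qz.1 qz.2) (q, z).
Proof. by move=> Uq; exact: (smooth_ruling sNh S2_gt0 z Uq). Qed.

(** Running a ruling backwards: if the velocity at the end point is again W there, the time - z
    leads back to [q], by f^2 + C g^2 = 1. *)
Let RK q z : W (R q z) = R' q z -> R (R q z) (- z) = q.
Proof.
move=> e; rewrite /ruling (@geoN K C r z).1 (@geoN K C r z).2.
rewrite -/(R q z) e /ruling /ruling' !scalerDr !scalerA addrACA -!scalerDl.
have -> : f z * f z + - g z * (- C * g z) = f z ^+ 2 + C * g z ^+ 2 by ring.
have -> : f z * g z + - g z * f z = 0 by ring.
by rewrite (geo_sq r0 hC) scale1r !scale0r addr0.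
Qed.

Let heightR q z : M q -> U q -> mdot nu (R q z) p0 = f z * mdot nu q p0 + g z * S q.
Proof. by move=> Mq Uq; rewrite /ruling mdotDl mdotZl mdotZl Wp0. Qed.

(** P is taken in the level set of [h] through [x]. The neighbourhoods are shrunk so that rulings
    are controlled forwards from P and backwards from its image; the candidate inverse is q -> (F q,
    zq q), and [RK] verifies it in both directions. *)
Lemma local_description (x : E) : M x -> U x ->
  exists (Uf P Q : set E) (a : K) (I0 : set K) (eta1 eta2 : E -> E),
    [/\ (open Uf /\ Uf x),
        umbilical_section nu C Q,
        P `<=` Q /\ submanifold (n - 2) P,
        [/\ open I0, is_interval I0 & I0 0] &
        [/\ unit_normal_along nu P P Q eta1,
            unit_normal_along nu P Q (space_form n nu C) eta2,
            forall p z, P p -> I0 z ->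
              is_exp nu C p (z *: Wa a eta1 eta2 p) (Psi C r a eta1 eta2 (p, z)) &
            diffeo (P `*` I0) (M `&` Uf) (Psi C r a eta1 eta2)]].
Proof.
move=> Mx Ux; have [[oU _ _ _ _] _] := slM.
pose h q := mdot nu q p0; pose h0 := h x; pose S0 := S x.
have S00 : 0 < S0 by exact: S_gt0.
have Sn0 : S0 != 0 by rewrite gt_eqF.
have SE q : h q = h0 -> S q = S0.
  by move=> hq; rewrite /S0 /speed -![mdot nu _ p0 ^+ 2]/(h _ ^+ 2) hq.
(* The height along any ruling issued from the level [h0]: since the speed depends on the height
   only, [k] is the same for all of them. *)
pose k (z : K) := f z * h0 + g z * S0.
pose k' (z : K) := - C * g z * h0 + f z * S0.
have [f0 g0] := @geo0 K C r.
have k0 : k 0 = h0 by rewrite /k f0 g0 mul1r mul0r addr0.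
have k'0 : k' 0 = S0 by rewrite /k' f0 g0 mulr0 mul0r add0r mul1r.
have smk z : smooth_at k z.
  have [sf sg] := @geo_smooth K C r z.
  by apply: smooth_atD; apply: smooth_atM => //; exact: smooth_at_cst.
have smk' z : smooth_at k' z.
  have [sf sg] := @geo_smooth K C r z.
  apply: smooth_atD; apply: smooth_atM => //; try exact: smooth_at_cst.
  by apply: smooth_atM => //; exact: smooth_at_cst.
have dk : is_derive (0 : K) 1 k (k' 0).
  have [df dg] := geo_derive r0 hC (0 : K).
  have d := is_deriveD (is_derive_scale df (is_derive_cst h0 (0 : K) (1 : K)))
    (is_derive_scale dg (is_derive_cst S0 (0 : K) (1 : K))).
  by apply: is_derive_eq d _; rewrite !scaler0 !add0r.
have k'n0 : k' 0 != 0 by rewrite k'0.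
have [A [J [zeta [oA A0 oJ szeta [AJ JA]]]]] := inverse_1d (smk 0) dk k'n0.
(* The quantity k'^2 + C k^2 is conserved. So at height k(z) the speed is the absolute value of
   k'(z), and it is k'(z) as long as this is positive. *)
have kk' z : k' z ^+ 2 = S0 ^+ 2 + C * h0 ^+ 2 - C * k z ^+ 2.
  have fg := geo_sq r0 hC z.
  have -> : S0 ^+ 2 + C * h0 ^+ 2 = (S0 ^+ 2 + C * h0 ^+ 2) * 1 by rewrite mulr1.
  by rewrite -[X in _ * X]fg /k /k'; ring.
have Sk q z : U q -> h q = k z -> 0 < k' z -> S q = k' z.
  move=> Uq hq kz; apply/eqP; rewrite -(@eqrXn2 _ 2)// ?ltW ?S_gt0//.
  rewrite SS// kk' -/(h q) hq; apply/eqP; rewrite /S0 SS// -/(h x) -/h0; ring.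
have smh q : smooth_at h q.
  by apply: smooth_at_mdot; [exact: smooth_at_id|exact: smooth_at_cst].
pose O := U `&` h @^-1` J.
have oO : open O by apply: open_preimage => // q _; exact: smooth_at_cont.
have Ox : O x by split=> //; rewrite /preimage/= -/h0 -k0; exact: (AJ 0 A0).1.
have [e1 e10 n1] := ruling_in n2 r0 hC slM MMC sNh Nh1 Nhq NhT Nhp0 S2_gt0 Mx Ux
  (open_nbhs_nbhs (conj oO Ox)).
have [B [oB Bx hB]] := near_open n1.
(* Here the heights lie in the domain of [zeta], and the rulings issued from points of M stay in M
   for times below [e1] of either sign; points of [B2] have rulings that remain in this set up to
   [e2]. *)
pose Oa := O `&` B.
have oOa : open Oa by exact: openI.
have Oax : Oa x by [].
have [e2 e20 n2'] := ruling_near (r := r) sNh S2_gt0 Ux (open_nbhs_nbhs (conj oOa Oax)).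
have [B2 [oB2 B2x hB2]] := near_open n2'.
have nA : nbhs (0 : K) A by exact: open_nbhs_nbhs.
have /nbhs_normP[e3 /= e30 hA] := nA.
have nk' : nbhs (0 : K) [set z | `|k' 0 - k' z| < k' 0].
  by apply: ((cvgrPdist_lt _ _).1 (smooth_at_cont (smk' 0))); rewrite k'0.
have /nbhs_normP[e4 /= e40 hk'] := nk'.
(* Four constraints: rulings stay in M, they stay in [Oa], [k] is inverted by [zeta], and k' is
   positive. *)
pose e := Num.min (Num.min e1 e2) (Num.min e3 e4).
have e0 : 0 < e by rewrite !lt_min e10 e20 e30 e40.
have ze (z : K) : `|z| < e -> [/\ `|z| < e1, `|z| < e2, A z & 0 < k' z].
  rewrite !lt_min => /andP[/andP[z1 z2] /andP[z3 z4]]; split=> //.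
    by apply: hA; rewrite /= sub0r normrN.
  have := hk' z; rewrite /= sub0r normrN ltr_distlC subrr => /(_ z4).
  by case/andP.
pose O1 := Oa `&` B2.
have oO1 : open O1 by exact: openI.
pose zq q := zeta (h q).
have smzq q : O q -> smooth_at zq q.
  move=> [Uq Jq]; apply: (@smooth_at_comp _ _ _ _ h zeta q has_basisK has_basisK (smh q)).
  exact: (smooth_onP _ oJ).1.
pose F q := R q (- zq q).
have smF q : O q -> smooth_at F q.
  move=> Oq; have [Uq Jq] := Oq.
  have [sf sg] := @geo_smooth K C r (- zq q).
  have sN : smooth_at (fun q => - zq q) q by apply: smooth_atN; exact: smzq.
  apply: smooth_atD; apply: smooth_atZ.
  - exact: (@smooth_at_comp _ _ _ _ (fun q => - zq q) f q has_basisK has_basisK sN sf).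
  - exact: smooth_at_id.
  - exact: (@smooth_at_comp _ _ _ _ (fun q => - zq q) g q has_basisK has_basisK sN sg).
  - exact: (smooth_Wfield sNh S2_gt0 Uq).
pose I0 := [set z : K | `|z| < e].
have oI0 : open I0.
  have -> : I0 = ball (0 : K) e.
    by rewrite -ball_normE; apply/seteqP; split=> s /=; rewrite sub0r normrN.
  exact: ball_open.
have smzqOa q : Oa q -> smooth_at zq q by move=> [Oq _]; exact: smzq.
have smFOa q : Oa q -> smooth_at F q by move=> [Oq _]; exact: smF.
(* Defined through the candidate inverse, time in [I0] and foot in [O1], so that its trace on M is
   exactly the image of [Psi]. *)
pose Uf := (Oa `&` zq @^-1` I0) `&` (Oa `&` F @^-1` O1).
have oUf : open Uf.
  apply: openI; apply: open_preimage => // q /[dup] Oq.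
    by move=> /smzqOa/smooth_at_cont.
  by move=> /smFOa/smooth_at_cont.
have zx : zq x = 0 by rewrite /zq -/h0 -k0 (AJ 0 A0).2.
have Fx : F x = x by rewrite /F zx oppr0 ruling0.
have Ufx : Uf x.
  by split; split=> //; rewrite /preimage/= ?zx ?Fx// /I0/= normr0.
pose P := M `&` O1 `&` [set q | h q = h0].
pose Q := section nu C p0 h0.
(* The squared length of the axis p0 - C h0 q on the level [h0], split into its parts tangent and
   normal to M. *)
pose v := S0 ^+ 2 + lam ^+ 2.
have v0 : 0 < v by rewrite ltr_pwDl ?sqr_ge0// exprn_gt0.
have vE : mdot nu p0 p0 - C * h0 ^+ 2 = v by rewrite /v /S0 SS// -/(h x) -/h0; ring.
have PU q : P q -> [/\ M q, U q & h q = h0] by move=> [[Mq [[[Uq _] _] _]] hq].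
have PE q : P q -> [/\ mdot nu q q = C^-1, mdot nu q p0 = h0, mdot nu (Nh q) q = 0,
    mdot nu (Nh q) p0 = lam & mdot nu (Nh q) (Nh q) = 1].
  move=> /PU[Mq Uq hq]; split=> //; [by case: (MMC Mq)|exact: Nhq|exact: Nhp0|exact: Nh1].
pose sv := Num.sqrt v.
have sv0 : sv != 0 by rewrite gt_eqF// sqrtr_gt0.
have sv2 : sv ^+ 2 = v by rewrite sqr_sqrtr// ltW.
(* With T0 = p0 - C h0 q one has <T0,T0> = v and <T0,N> = lam on P, so lam T0 - v N is orthogonal to
   T0 and has squared length v S0^2. The sign is the one for which W has components lam / sv and S0
   / sv on [eta1] and [eta2]. *)
pose eta1 q := (sv * S0)^-1 *: (lam *: (p0 - (C * h0) *: q) - v *: Nh q).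
pose eta2 q := sv^-1 *: (p0 - (C * h0) *: q).
pose a := acos (lam / sv).
have lam_sv : (lam / sv) ^+ 2 = lam ^+ 2 / v by rewrite expr_div_n sv2.
have lam1 : -1 <= lam / sv <= 1.
  have : (lam / sv) ^+ 2 <= 1.
    by rewrite lam_sv ler_pdivrMr// mul1r /v lerDr sqr_ge0.
  by move: (lam / sv) => y y1; apply/andP; split; nra.
have cosa : cos a = lam / sv by rewrite /a acosK// in_itv.
have sina : sin a = S0 / sv.
  rewrite /a sin_acos// lam_sv.
  have -> : 1 - lam ^+ 2 / v = (S0 / sv) ^+ 2.
    by rewrite expr_div_n sv2 /v; field; rewrite gt_eqF.
  by rewrite sqrtr_sqr ger0_norm// divr_ge0 ?sqrtr_ge0// ltW.
have WaE q : P q -> Wa a eta1 eta2 q = W q.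
  move=> /PU[Mq Uq hq]; rewrite /Wa cosa sina /eta1 /eta2 /Wfield SE// /Tfield.
  rewrite -/(h q) hq; apply/rowP => i; rewrite !mxE.
  move: (p0 0 i - C * h0 * q 0 i) (Nh q 0 i) => y u.
  have -> : lam / sv * ((sv * S0)^-1 * (lam * y - v * u)) + S0 / sv * (sv^-1 * y) =
    (sv ^+ 2)^-1 * S0^-1 * ((S0 ^+ 2 + lam ^+ 2) * y - lam * v * u).
    by field; rewrite sv0 Sn0.
  by rewrite sv2 -/v; field; rewrite Sn0 gt_eqF.
have I00 : I0 0 by rewrite /I0/= normr0.
have p00 : p0 != 0.
  apply: contraTneq v0 => pz; rewrite -leNgt -vE pz mdot0r.
  by rewrite /h0 /h pz mdot0r expr0n/= mulr0 subrr.
have n0 : (0 < n)%N by exact: ltn_trans n2.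
have PQ : P `<=` Q by move=> q Pq; have [Mq _ hq] := PU q Pq; split=> //; exact: MMC.
have vn0 : mdot nu p0 p0 - C * h0 ^+ 2 != 0 by rewrite vE gt_eqF.
have umbQ : umbilical_section nu C Q.
  split; last by exists p0, h0, setT; split=> //; [exact: openT|rewrite setIT].
  split; first by move=> q [].
  by apply/submanifoldP => q Qq; have [] := section_cut r0 hC Qq vn0 n0.
have subP : submanifold (n - 2) P.
  apply/submanifoldP => q Pq; have [Mq Uq hq] := PU q Pq.
  have O1q : O1 q by case: Pq => -[].
  have hq0 : h q - h0 = 0 by rewrite hq subrr.
  have sh0 : smooth_at (fun q => h q - h0) q.
    by apply: smooth_atB; [exact: smh|exact: smooth_at_cst].
  (* The field W is the transversal direction for cutting M by the level of the height: the
     derivative along it is the speed. *)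
  have dh0 : 'D_(W q) (fun q => h q - h0) q != 0.
    have [_ ->] := is_deriveB (smooth_at_is_derive (W q) (smh q)) (is_derive_cst h0 q (W q)).
    rewrite (derive_mdot nu (W q) (smooth_at_id q) (smooth_at_cst p0 q)) derive_idE derive_cstE.
    by rewrite mdot0r addr0 subr0 Wp0// gt_eqF// S_gt0.
  have sl2 : slice (n - 2).+1 M U Phi G by rewrite subnSK// subn1.
  have nn : (n - 2 < n.+1)%N by rewrite ltnS leq_subr.
  have [U' [Phi' [G' [sl' U'q _]]]] := slice_cut nn sl2 Uq Mq hq0 sh0 (tW Mq Uq) dh0.
  apply: (slice_ext sl' U'q).
  have nO1 : nbhs q O1 by exact: open_nbhs_nbhs.
  apply: filterS nO1 => y O1y; split=> [[My hy]|[[My _] hy]]; last first.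
    by split=> //=; rewrite hy subrr.
  by split=> //=; apply/eqP; rewrite -subr_eq0 hy.
have tP q X : P q -> tangent P q X ->
    [/\ mdot nu X q = 0, mdot nu X p0 = 0 & mdot nu X (Nh q) = 0].
  move=> Pq tX; have [Mq Uq hq] := PU q Pq.
  have PM : P `<=` M by move=> y [[]].
  have [Xq XN] := (tangent_hypersurface n2 r0 hC slM MMC Nh1 Nhq NhT Mq Uq X).1
    (tangent_sub PM tX).
  split=> //; have nP : \forall y \near q, P y -> h y = h0.
    by apply: (@filterS _ (nbhs q) _ setT) => //; [move=> y _ []|exact: filterT].
  have := tangent_derive0 has_basisK (smh q) tX nP.
  rewrite (derive_mdot nu X (smooth_at_id q) (smooth_at_cst p0 q)) derive_idE derive_cstE.
  by rewrite mdot0r addr0.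
have tQ q X : Q q -> tangent Q q X -> mdot nu X q = 0 /\ mdot nu X p0 = 0.
  move=> Qq tX; have QM : Q `<=` MC by move=> y [].
  split; first exact: ((space_form_cut r0 hC Qq.1).2 X).1 (tangent_sub QM tX).
  have nQ : \forall y \near q, Q y -> h y = h0.
    by apply: (@filterS _ (nbhs q) _ setT) => //; [move=> y _ []|exact: filterT].
  have := tangent_derive0 has_basisK (smh q) tX nQ.
  rewrite (derive_mdot nu X (smooth_at_id q) (smooth_at_cst p0 q)) derive_idE derive_cstE.
  by rewrite mdot0r addr0.
pose T0 q : E := p0 - (C * h0) *: q.
have smT0 q : smooth_at T0 q.
  apply: smooth_atB; first exact: smooth_at_cst.
  by apply: smooth_atZ; [exact: smooth_at_cst|exact: smooth_at_id].
have extU (F' : E -> E) : (forall q, U q -> smooth_at F' q) -> smooth_along P F'.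
  move=> sF' q Pq; have [Mq Uq hq] := PU q Pq.
  by exists U, F'; split=> //; exact/smooth_onP.
have bE : mdot nu p0 p0 = v + C * h0 ^+ 2 by rewrite -vE subrK.
have un1 : unit_normal_along nu P P Q eta1.
  split.
    apply: extU => q Uq; apply: smooth_atZ; first exact: smooth_at_cst.
    apply: smooth_atB; apply: smooth_atZ; try exact: smooth_at_cst.
      exact: smT0.
    exact: sNh.
  move=> q Pq; have [qq qp Nq Np NN] := PE q Pq.
  split.
  - have [_ tS] := section_cut r0 hC (PQ q Pq) vn0 n0; apply: tS.
      rewrite /eta1 mdotZl !mdot_lin qq Nq [mdot nu p0 q]mdotC qp.
      by field; rewrite sv0 Sn0 C0.
    rewrite /eta1 mdotZl !mdot_lin Np qp.
    have -> : lam * (mdot nu p0 p0 - C * h0 * h0) - v * lam =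
      lam * (mdot nu p0 p0 - C * h0 ^+ 2 - v) by ring.
    by rewrite vE subrr !mulr0.
  - rewrite /eta1 mdotZl mdotZr !mdot_lin qq NN Nq Np qp.
    rewrite [mdot nu q (Nh q)]mdotC Nq [mdot nu p0 (Nh q)]mdotC Np.
    rewrite [mdot nu p0 q]mdotC qp bE.
    transitivity ((sv ^+ 2)^-1 * (S0 ^+ 2)^-1 * (v * (v - lam ^+ 2))).
      by field; rewrite sv0 Sn0 C0.
    have -> : v - lam ^+ 2 = S0 ^+ 2 by rewrite /v addrK.
    by rewrite sv2; field; rewrite Sn0 gt_eqF.
  - move=> X tX; have [Xq Xp XN] := tP q X Pq tX.
    rewrite mdotC /eta1 !mdot_lin Xq Xp XN; ring.
have un2 : unit_normal_along nu P Q MC eta2.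
  split; first by apply: extU => q Uq; apply: smooth_atZ; [exact: smooth_at_cst|exact: smT0].
  move=> q Pq; have [qq qp Nq Np NN] := PE q Pq; split.
  - have [_ tS] := space_form_cut r0 hC (PQ q Pq).1; apply/tS.
    by rewrite /eta2 !mdot_lin qq [mdot nu p0 q]mdotC qp; field; rewrite sv0 C0.
  - rewrite /eta2 mdotZl mdotZr !mdot_lin qq qp [mdot nu p0 q]mdotC qp bE.
    transitivity ((sv ^+ 2)^-1 * v); first by field; rewrite sv0 C0.
    by rewrite sv2 mulVf// gt_eqF.
  - move=> X tX; have [Xq Xp] := tQ q X (PQ q Pq) tX.
    rewrite mdotC /eta2 !mdot_lin Xq Xp; ring.
exists Uf, P, Q, a, I0, eta1, eta2; split=> //.
  split=> // y1 y2; rewrite /I0/= !ltr_norml => /andP[y1e _] /andP[_ y2e] y /andP[yl yr].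
  by rewrite ltr_norml (lt_le_trans y1e yl) (le_lt_trans yr y2e).
have PsiE q z : P q -> Psi C r a eta1 eta2 (q, z) = R q z.
  by move=> Pq; rewrite /Psi /= WaE.
split=> //.
  move=> q z Pq _; have [Mq Uq _] := PU q Pq; rewrite WaE// PsiE//.
  exact: (geodesic_exp r0 hC (MMC Mq) (Wq Mq Uq) (W1 Mq Uq) z).
have PF q z : P q -> `|z| < e -> [/\ M (R q z), Oa (R q z), h (R q z) = k z &
    W (R q z) = R' q z].
  move=> Pq zI; have [z1 z2 zA kz] := ze z zI; have [Mq Uq hq] := PU q Pq.
  have [[_ [[_ Bq] B2q]] _] := Pq.
  have [Mz Uz Oz Wz] := hB q Bq Mq z z1; split=> //; first exact: hB2.
  by rewrite /h heightR// -/(h q) hq SE.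
have GF q z : P q -> `|z| < e -> zq (R q z) = z /\ F (R q z) = q.
  move=> Pq zI; have [z1 z2 zA kz] := ze z zI; have [Mz Oz hz Wz] := PF q z Pq zI.
  have zz : zq (R q z) = z by rewrite /zq hz (AJ z zA).2.
  by split=> //; rewrite /F zz; exact: RK.
split.
- apply/seteqP; split=> [_ [[q z] [/= Pq zI] <-]|q [Mq [[Oaq zI] [_ O1F]]]].
    have [Mz Oz hz Wz] := PF q z Pq zI; have [zz Fz] := GF q z Pq zI.
    have [[_ O1q] _] := Pq.
    by rewrite PsiE//; split=> //; split; split=> //; rewrite /preimage/= ?zz ?Fz.
  rewrite /preimage/= in zI O1F.
  have [[[Uq Jq] Bq] _] := (Oaq, I).
  set z := zq q in zI; have [z1 z2 zA kz] := ze z zI.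
  have Nz1 : `|- z| < e1 by rewrite normrN.
  have [MF _ _ WF] := hB q Bq Mq (- z) Nz1; rewrite -/(F q) in MF WF.
  have hq : h q = k z by rewrite /k [RHS](JA (h q) Jq).2.
  have Sq : S q = k' z by exact: Sk.
  (* Going back by the time z from height k with speed k' gives f k - g k' = (f^2 + C g^2) h0. *)
  have hF : h (F q) = h0.
    rewrite /h heightR// -/(h q) hq Sq (@geoN K C r z).1 (@geoN K C r z).2 /k /k'.
    rewrite -[RHS]mulr1 -(geo_sq r0 hC z); ring.
  have PFq : P (F q) by split.
  exists (F q, z) => //; rewrite PsiE//=.
  by rewrite -[z]opprK; apply: RK.
- move=> [q z] [/= Pq zI]; have [Mq Uq hq] := PU q Pq.
  have [D [oD Dq hD]] := smR z Uq.
  exists D, (fun qz => R qz.1 qz.2); split=> //.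
  by move=> [q' z'] [[/= Pq' _] _]; rewrite PsiE.
exists (fun q => (F q, zq q)); split.
  move=> q [Mq [[Oaq _] _]].
  have [D [oD Dq hD]] := smooth_at_pair (smFOa q Oaq) (smzqOa q Oaq).
  by exists D, (fun q => (F q, zq q)).
move=> [q z] [/= Pq zI]; rewrite PsiE//; have [-> ->] := GF q z Pq zI.
by [].
Qed.

End LocalDescription.

Theorem theorem6 (K : realType) (n : nat) (hn : (2 <= n)%N)
    (C r : K) (nu : bool) (hC0 : C != 0) (hr : 0 < r)
    (hC : C = (-1) ^+ nu / r ^+ 2)
    (M : set 'rV[K]_n.+1) (N V : 'rV[K]_n.+1 -> 'rV[K]_n.+1)
    (hM : concircular_hypersurface nu C M N V)
    (hnontrivial : ~ totally_umbilical nu C M N)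
    (hT : forall p, M p -> V p - mdot nu (V p) (N p) *: N p != 0) :
  forall x, M x ->
    exists (U P Q : set 'rV[K]_n.+1) (a : K) (I0 : set K)
           (eta1 eta2 : 'rV[K]_n.+1 -> 'rV[K]_n.+1),
      [/\ (open U /\ U x),
          umbilical_section nu C Q,
          P `<=` Q /\ submanifold (n - 2) P,
          [/\ open I0, is_interval I0 & I0 0] &
          [/\ unit_normal_along nu P P Q eta1,
              unit_normal_along nu P Q (space_form n nu C) eta2,
              forall p z, P p -> I0 z ->
                is_exp nu C p (z *: Wa a eta1 eta2 p) (Psi C r a eta1 eta2 (p, z)) &
              diffeo (P `*` I0) (M `&` U) (Psi C r a eta1 eta2)]].
Proof.
move=> x Mx; have [[MMC /submanifoldP subM] [sN hN] hV [lam hlam]] := hM.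
have hx := MMC x Mx.
have [p0 nV] := concircular_local hn hr hC hV hx.
have [U0 [Phi [G [slM U0x]]]] := subM x Mx.
(* The ambient extension of the normal; it agrees with [N] only on M near [x]. *)
have [A1 [Nh [oA1 A1x sNh NhN]]] := sN x Mx.
have N0 q : M q -> mdot nu (N q) q = 0.
  move=> Mq; have [tN _ _] := hN q Mq.
  exact: ((space_form_cut hr hC (MMC q Mq)).2 (N q)).1 tN.
have Np0 q : M q -> V q = p0 - (C * mdot nu q p0) *: q -> mdot nu (N q) p0 = lam.
  by move=> Mq Vq; rewrite -(hlam q Mq) Vq !mdot_lin N0// mulr0 subr0.
(* At [x] this is the squared length of the tangential part of the axis, positive by [hT] and
   definiteness; positivity then persists nearby. *)
pose S2 q := mdot nu p0 p0 - lam ^+ 2 - C * mdot nu q p0 ^+ 2.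
have S2x : 0 < S2 x.
  have Vx := nbhs_singleton nV (MMC x Mx); have NVx := hlam x Mx.
  have Tx : mdot nu (V x - mdot nu (V x) (N x) *: N x) x = 0.
    by rewrite !mdot_lin N0// (concircular_tangent hr hC hV hx) mulr0 subr0.
  have [_ NN _] := hN x Mx; have Npx := Np0 x Mx Vx.
  have := tangent_pos hr hC hx.1 Tx (hT x Mx).
  rewrite [mdot nu (V x) (N x)]mdotC NVx Vx !mdot_lin NN Npx N0// hx.1.
  rewrite [mdot nu p0 (N x)]mdotC Npx [mdot nu x (N x)]mdotC N0// [mdot nu p0 x]mdotC.
  rewrite /S2; move: (mdot nu p0 p0) (mdot nu x p0) => b h.
  congr (0 < _); field; exact: hC0.
have nS2 : nbhs x [set q | 0 < S2 q].
  have sS : smooth_at S2 x.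
    have sh : smooth_at (fun q => mdot nu q p0) x.
      by apply: smooth_at_mdot; [exact: smooth_at_id|exact: smooth_at_cst].
    apply: smooth_atB; first exact: smooth_at_cst.
    apply: smooth_atM; first exact: smooth_at_cst.
    by under eq_fun do rewrite expr2; exact: smooth_atM.
  have n1 : nbhs x [set q | `|S2 x - S2 q| < S2 x].
    exact: ((cvgrPdist_lt _ _).1 (smooth_at_cont sS) _ S2x).
  by apply: (@filterS _ (nbhs x) _ _ _ _ n1) => q /=; rewrite ltr_distlC subrr => /andP[].
have [A2 [oA2 A2x hA2]] := near_open nS2.
have [A3 [oA3 A3x hA3]] := near_open nV.
pose U := U0 `&` (A1 `&` (A2 `&` A3)).
have Ux : U x by [].
have sl : slice n.-1 M U Phi G.
  split; last by move=> q [U0q _]; exact: slM.2.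
  by apply: chart_sub slM.1; do !apply: openI.
have NE q : M q -> U q -> Nh q = N q by move=> Mq [_ [A1q _]]; exact: NhN.
apply: (@local_description K n nu C r hn hr hC M U Phi G Nh p0 lam) => //.
- by move=> q [_ [A1q _]]; exact: (smooth_onP _ oA1).1.
- by move=> q Mq Uq; rewrite NE//; have [] := hN q Mq.
- by move=> q Mq Uq; rewrite NE// N0.
- by move=> q X Mq Uq tX; rewrite NE//; have [_ _] := hN q Mq; exact.
- move=> q Mq Uq; rewrite NE//; apply: Np0 => //.
  by apply: hA3; [case: Uq => _ [_ []]|exact: MMC].
- by move=> q [_ [_ [A2q _]]]; exact: hA2.
Qed.
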